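(* Let $k$ be an algebraically closed field of characteristic $p>0$, $G$ a finite $p$-group, and $\mathscr B$ a $G$-Galois algebra over $\mathscr A = k[[x]]$ with total fraction field $\mathscr L$, and $\mathscr K = k((x))$. Assume that $( * )$ $G_0(\mathfrak m_1/\mathfrak m_{\mathscr A})$ is a normal subgroup of $G$. Let $\mathscr X \to \mathbb P^1$ be the HKG-cover associated to $(\mathscr B, G)$, and let $z \in \mathscr L$ be a magical element for $\mathscr L/\mathscr K$ with dual element $z^{\vee}$. Then there are isomorphisms of $k[G]$-modules \begin{align*} H^0(\mathscr X, \Omega_{\mathscr X}) &\cong \frac{\Omega_{\mathscr B}^{\log}}{\bigoplus_{g \in G} g^*(z)\, \Omega_{\mathscr A}^{\log}},\\ H^1(\mathscr X, \mathcal O_{\mathscr X}) &\cong \frac{\bigoplus_{g \in G} g^*(z^{\vee})\, \mathfrak m_{\mathscr A}}{\mathfrak m_{\mathscr B}},\\ H^1_{dR}(\mathscr X) &\cong \left\{ (\omega, \nu) \in \frac{\Omega_{\mathscr L}}{\bigoplus_{g \in G} g^*(z)\, \Omega_{\mathscr A}^{\log}} \times \frac{\bigoplus_{g \in G} g^*(z^{\vee})\, \mathfrak m_{\mathscr A}}{\mathfrak m_{\mathscr B}} : \ \omega - d\nu \in \Omega_{\mathscr B}^{\log} \right\}. \end{align*}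
   Context: Setting. $\mathscr A = \mathscr B^G = k[[x]]$, with maximal ideal $\mathfrak m_{\mathscr A} = (x)$ and fraction field $\mathscr K = k((x))$. $\mathscr B = \prod_{i=1}^r k[[t_i]]$ is the integral closure of $\mathscr A$ in the $G$-Galois étale $\mathscr K$-algebra $\mathscr L = \prod_{i=1}^r k((t_i))$. $\mathfrak m_i$ is the maximal ideal of $\mathscr B$ corresponding to $(t_i) \subset k[[t_i]]$, $\mathfrak m_{\mathscr B} = \bigcap_i \mathfrak m_i$ is the Jacobson radical of $\mathscr B$, and $\operatorname{ord}_{\mathfrak m_i}: \mathscr L \to \mathbb Z \cup \{\infty\}$ is the $t_i$-adic valuation of the $i$-th component. $G_j(\mathfrak m_i/\mathfrak m_{\mathscr A})$ is the $j$-th (lower) ramification group of $\mathfrak m_i$ over $\mathfrak m_{\mathscr A}$; in particular $G_0(\mathfrak m_i/\mathfrak m_{\mathscr A}) \cong \operatorname{Gal}(k((t_i))/\mathscr K)$ is the decomposition group. Under $( * )$, put $G_j := G_j(\mathfrak m_1/\mathfrak m_{\mathscr A})$ and $d' := \sum_{j \ge 1} (\# G_j - 1)$. HKG-cover. By Harbater, Katz and Gabber there is a unique $G$-cover $\pi : \mathscr X \to \mathbb P^1$ ($\mathscr X$ smooth projective, possibly disconnected), ramified at most over $\infty$, such that $\widehat{\mathcal O}_{\mathscr X,\infty} := (\pi_*\mathcal O_{\mathscr X})_\infty \otimes_{\mathcal O_{\mathbb P^1,\infty}} \widehat{\mathcal O}_{\mathbb P^1,\infty} \cong \mathscr B$ as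 $k[G]$-algebras, compatibly with an identification $\widehat{\mathcal O}_{\mathbb P^1,\infty} = k[[x]]$ in which $1/x$ is an affine coordinate on $\mathbb P^1\setminus\{\infty\}$; it is called the HKG-cover associated to $(\mathscr B,G)$. Cohomology of a disjoint union of curves is the direct sum over components. Differentials. $\Omega_C$ denotes continuous $k$-linear Kähler differentials: $\Omega_{\mathscr A} = k[[x]]\,dx$, $\Omega_{\mathscr K} = k((x))\,dx$, $\Omega_{\mathscr B} = \prod_i k[[t_i]]\,dt_i$, $\Omega_{\mathscr L} = \prod_i k((t_i))\,dt_i$. Logarithmic differentials: $\Omega_{\mathscr A}^{\log} = \frac1x \Omega_{\mathscr A}$, $\Omega_{\mathscr B}^{\log} = \prod_i \frac1{t_i} k[[t_i]]\,dt_i$. $\Omega_{\mathscr K}$ is viewed inside $\Omega_{\mathscr L} = \mathscr L \otimes_{\mathscr K} \Omega_{\mathscr K}$. Magical element. $z \in \mathscr L$ is a magical element for $\mathscr L/\mathscr K$ if $\operatorname{ord}_{\mathfrak m_i}(z) \ge -d'$ for all $i=1,\dots,r$ and $\operatorname{tr}_{\mathscr L/\mathscr K}(z) \in \mathscr A^{\times}$. Its dual $z^{\vee} \in \mathscr L$ is defined by $\operatorname{tr}_{\mathscr L/\mathscr K}(g_1(z)\cdot g_2(z^{\vee})) = 1$ if $g_1 = g_2$ and $0$ otherwise, for $g_1, g_2 \in G$. $g^*(z)$ denotes the action of $g \in G$ on $z$. (In particular the submodule inclusions implicit in the quotients hold.) *)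

(* Defs.v *)
From HB Require Import structures.
From mathcomp Require Import all_boot all_order all_algebra.
From mathcomp Require Import all_fingroup all_solvable.
From mathcomp Require Import zify.
From mathcomp Require Import boolp classical_sets functions cardinality fsbigop.

Set Implicit Arguments.
Unset Strict Implicit.
Unset Printing Implicit Defensive.

Import Order.TTheory GRing.Theory Num.Theory.

Local Open Scope classical_set_scope.
Local Open Scope ring_scope.

Section Laurent.
Variable k : fieldType.

Definition below (m : int) (f : int -> k) := forall n, n < m -> f n = 0.

Definition laurent_pred : {pred (int -> k)} := fun f => `[< exists m, below m f >].

Record laurent := Laurent { lcoef :> int -> k; _ : lcoef \in laurent_pred }.

HB.instance Definition _ := [isSub for lcoef].
HB.instance Definition _ := [Choice of laurent by <:].

Lemma laurentP (f : laurent) : exists m, below m f.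
Proof. by case: f => f fP; apply/asboolP. Qed.

Lemma laurent_ext (f g : laurent) : (forall n, f n = g n) -> f = g.
Proof. by move=> fg; apply/val_inj/funext. Qed.

Lemma below_le m n f : m <= n -> below n f -> below m f.
Proof. by move=> mn fn i im; apply: fn; apply: lt_le_trans mn. Qed.

Fact laurent_zmod_closed : zmod_closed laurent_pred.
Proof.
split=> [|f g /asboolP[m fm] /asboolP[n gn]]; first by apply/asboolP; exists 0.
apply/asboolP; exists (Num.min m n) => i; rewrite lt_min => /andP[im jn].
have -> : (f - g) i = f i - g i by [].
by rewrite fm // gn // subrr.
Qed.
HB.instance Definition _ :=
  GRing.isZmodClosed.Build (int -> k) laurent_pred laurent_zmod_closed.
HB.instance Definition _ := [SubChoice_isSubZmodule of laurent by <:].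

Lemma lcoefD (f g : laurent) n : (f + g) n = f n + g n.
Proof. by []. Qed.

(* The sum is finite: its support lies in a bounded interval. *)
Definition lmul_coef (f g : int -> k) (n : int) : k :=
  \sum_(i \in [set: int]) f i * g (n - i).

Lemma int_split (m n : int) : m <= n -> exists j : nat, n = m + j%:Z.
Proof. by move=> mn; exists `|n - m|%N; lia. Qed.

Lemma lmul_coefE a b (f g : int -> k) (m : nat) : below a f -> below b g ->
  lmul_coef f g (a + b + m%:Z) =
  \sum_(i < m.+1) f (a + i%:Z) * g (b + (m - i)%N%:Z).
Proof.
move=> fa gb.
have u : uniq [seq a + i%:Z | i <- iota 0 m.+1].
  by rewrite map_inj_uniq ?iota_uniq // => i j /addrI[].
rewrite /lmul_coef (fsbigE _ _ u) //; last first.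
  move=> i _ /mapP iP; case: (ltP i a) => [/fa-> | ai]; first by rewrite mul0r.
  rewrite [g _]gb ?mulr0 //.
  have [j ij] := int_split ai.
  have : ~ (j < m.+1)%N by move=> jm; apply: iP; exists j; rewrite ?mem_iota.
  by rewrite ij; lia.
rewrite big_map -{1}[m.+1]subn0 -/(index_iota _ _) big_mkord.
rewrite (eq_bigl xpredT) => [|i]; last by rewrite in_setT.
apply: eq_bigr => i _; congr (_ * g _).
by have := ltn_ord i; lia.
Qed.

Lemma below_mul a b (f g : int -> k) :
  below a f -> below b g -> below (a + b) (lmul_coef f g).
Proof.
move=> fa gb n nab; rewrite /lmul_coef fsbig1 // => i _.
case: (ltP i a) => [/fa-> | ai]; first by rewrite mul0r.
by rewrite [g _]gb ?mulr0 //; lia.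
Qed.

Definition lmul (f g : laurent) : laurent.
Proof.
exists (lmul_coef f g); apply/asboolP.
have [[a fa] [b gb]] := (laurentP f, laurentP g).
by exists (a + b); apply: below_mul.
Defined.

Fact lmulC : commutative lmul.
Proof.
move=> f g; apply: laurent_ext => n /=; rewrite /lmul_coef.
rewrite (reindex_fsbigT (fun i => n - i)).
  by apply: eq_fsbigr => i _; rewrite mulrC opprB addrC subrK.
by exists (fun i => n - i) => i /=; rewrite ?inE; lia.
Qed.

Let trunc (a : int) (f : int -> k) (m : nat) : {poly k} :=
  \poly_(i < m) f (a + i%:Z).

Lemma lmul_trunc a b (f g : int -> k) (m n : nat) : below a f -> below b g ->
  (m < n)%N ->
  lmul_coef f g (a + b + m%:Z) = (trunc a f n * trunc b g n)`_m.
Proof.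
move=> fa gb mn; rewrite (lmul_coefE _ fa gb) coefM.
apply: eq_bigr => i _; have := ltn_ord i => im.
by rewrite !coef_poly !ifT //; lia.
Qed.

Lemma coefM_eq (P Q Q' : {poly k}) m :
  (forall i, (i <= m)%N -> Q`_i = Q'`_i) -> (P * Q)`_m = (P * Q')`_m.
Proof.
by move=> QQ'; rewrite !coefM; apply: eq_bigr => i _; rewrite QQ' ?leq_subr.
Qed.

Fact lmulA : associative lmul.
Proof.
move=> f g h; apply: laurent_ext => n.
have [[a fa] [b gb] [c hc]] := And3 (laurentP f) (laurentP g) (laurentP h).
have fg := below_mul fa gb; have gh := below_mul gb hc.
case: (ltP n (a + b + c)) => [nlt | nge].
  rewrite [RHS](below_mul fg hc) //= [LHS](below_mul fa gh) //.
  by rewrite addrA.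
have [m ->] := int_split nge.
rewrite /= (lmul_trunc fg hc (ltnSn m)).
rewrite -[a + b + c]addrA (lmul_trunc fa gh (ltnSn m)).
rewrite (@coefM_eq _ _ (trunc b g m.+1 * trunc c h m.+1)).
  rewrite mulrA ![_ * trunc c h _]mulrC; apply: coefM_eq => i im.
  by rewrite coef_poly ifT // (@lmul_trunc a b f g i m.+1 fa gb).
by move=> i im; rewrite coef_poly ifT // (@lmul_trunc b c g h i m.+1 gb hc).
Qed.

(* The power series [\sum_n u n * x^n]. *)
Definition lser_coef (u : nat -> k) (n : int) : k := if n is Posz m then u m else 0.

Lemma below_lser u : below 0 (lser_coef u).
Proof. by case. Qed.

Definition lser (u : nat -> k) : laurent.
Proof. by exists (lser_coef u); apply/asboolP; exists 0; apply: below_lser. Defined.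

Definition lone : laurent := lser (fun n => (n == 0)%:R).

Fact lmul1r : left_id lone lmul.
Proof.
move=> f; apply: laurent_ext => n /=; rewrite /lmul_coef.
have := @fsbigE _ _ +%R _ [set: int] [:: 0]
  (fun i => lser_coef (fun m => (m == 0)%:R) i * f (n - i)).
rewrite /= => ->//; last by case=> [[|m]|m]; rewrite ?inE //= mul0r.
by rewrite big_cons big_nil in_setT subr0 addr0 mul1r.
Qed.

Fact lmulDl : left_distributive lmul +%R.
Proof.
move=> f g h; apply: laurent_ext => n.
have [[a fa] [b gb] [c hc]] := And3 (laurentP f) (laurentP g) (laurentP h).
set m := Num.min a b; have {fa}fm : below m f by apply: below_le fa; rewrite ge_min lexx.
have {gb}gm : below m g by apply: below_le gb; rewrite ge_min lexx orbT.
have fgm : below m (f + g) by move=> i im; rewrite lcoefD fm // gm // addr0.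
rewrite lcoefD; case: (ltP n (m + c)) => [nlt | nge].
  by rewrite [LHS](below_mul fgm hc) //= (below_mul fm hc) // (below_mul gm hc) ?addr0.
have [j ->] := int_split nge.
rewrite /= (lmul_coefE _ fgm hc) (lmul_coefE _ fm hc) (lmul_coefE _ gm hc).
by rewrite -big_split; apply: eq_bigr => i _; rewrite lcoefD mulrDl.
Qed.

Fact lone_neq0 : lone != 0.
Proof. by apply/eqP => /(congr1 (fun f : laurent => f 0))/eqP; rewrite oner_eq0. Qed.

HB.instance Definition _ :=
  GRing.Zmodule_isComNzRing.Build laurent lmulA lmulC lmul1r lmulDl lone_neq0.

Lemma lcoefM (f g : laurent) n : (f * g) n = \sum_(i \in [set: int]) f i * g (n - i).
Proof. by []. Qed.

Definition lscale (c : k) (f : laurent) : laurent.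
Proof.
exists (fun n => c * f n); apply/asboolP; have [a fa] := laurentP f.
by exists a => n na; rewrite fa ?mulr0.
Defined.

Fact lscaleA a b f : lscale a (lscale b f) = lscale (a * b) f.
Proof. by apply: laurent_ext => n /=; rewrite mulrA. Qed.
Fact lscale1 : left_id 1 lscale.
Proof. by move=> f; apply: laurent_ext => n /=; rewrite mul1r. Qed.
Fact lscaleDr : right_distributive lscale +%R.
Proof. by move=> c f g; apply: laurent_ext => n; rewrite [LHS]/= mulrDr. Qed.
Fact lscaleDl f : {morph lscale^~ f : a b / a + b}.
Proof. by move=> a b; apply: laurent_ext => n; rewrite [LHS]/= mulrDl. Qed.
HB.instance Definition _ :=
  GRing.Zmodule_isLmodule.Build k laurent lscaleA lscale1 lscaleDr lscaleDl.

Fact lscalerAl (c : k) (f g : laurent) : c *: (f * g) = (c *: f) * g.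
Proof.
apply: laurent_ext => n.
have [[a fa] [b gb]] := (laurentP f, laurentP g).
have cfa : below a (c *: f) by move=> i ia; rewrite [LHS]/= fa ?mulr0.
rewrite [LHS]/=; case: (ltP n (a + b)) => [nlt | nge].
  by rewrite [RHS](below_mul cfa gb) //= (below_mul fa gb) ?mulr0.
have [j ->] := int_split nge.
rewrite [RHS]/= (lmul_coefE _ cfa gb) (lmul_coefE _ fa gb) mulr_sumr.
by apply: eq_bigr => i _; rewrite mulrA.
Qed.
HB.instance Definition _ := GRing.Lmodule_isLalgebra.Build k laurent lscalerAl.
HB.instance Definition _ := GRing.Lalgebra_isComAlgebra.Build k laurent.

Definition lX : laurent := lser (fun n => (n == 1)%:R).

Definition lpoly (p : {poly k}) : laurent := lser (fun n => p`_n).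

(* [ord f >= m], where [ord 0 = +oo]. *)
Definition ord_ge (m : int) (f : laurent) : Prop := below m f.

Definition lderiv (f : laurent) : laurent.
Proof.
exists (fun n => f (n + 1) *~ (n + 1)); apply/asboolP.
have [a fa] := laurentP f; exists (a - 1) => n; rewrite ltrBrDr => na.
by rewrite fa ?mul0rz.
Defined.

End Laurent.

(* [Subquotient V act num den] stands for the k[G]-module num / den, where
   G is all of gT and num, den are subspaces of V. *)
Record subquotient (k : fieldType) (gT : finGroupType) := Subquotient {
  sq_space : lmodType k;
  sq_act : gT -> sq_space -> sq_space;
  sq_num : set sq_space;
  sq_den : set sq_space }.

Definition submodule (k : fieldType) (gT : finGroupType) (V : lmodType k)
    (act : gT -> V -> V) (S : set V) : Prop :=
  [/\ S 0,
      forall (a : k) u v, S u -> S v -> S (a *: u + v)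
    & forall g u, S u -> S (act g u)].

Definition subquotient_wf (k : fieldType) (gT : finGroupType)
    (M : subquotient k gT) : Prop :=
  [/\ (forall g (a : k) u v, @sq_act _ _ M g (a *: u + v) =
         a *: sq_act g u + sq_act g v),
      (forall u, @sq_act _ _ M 1%g u = u)
      /\ (forall g h u, @sq_act _ _ M (g * h)%g u = sq_act g (sq_act h u)),
      submodule (@sq_act _ _ M) (sq_num (s:=M)),
      submodule (@sq_act _ _ M) (sq_den (s:=M))
    & sq_den (s:=M) `<=` sq_num (s:=M)].

(* An isomorphism of k[G]-modules num M / den M -> num N / den N, given by
   lifts f u of the images of the classes of u. *)
Definition kG_iso (k : fieldType) (gT : finGroupType)
    (M N : subquotient k gT) : Prop :=
  [/\ subquotient_wf M, subquotient_wf N &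
  exists f : sq_space M -> sq_space N,
  [/\ forall u, sq_num u -> sq_num (f u),
      forall (a : k) u v, sq_num u -> sq_num v ->
        sq_den (f (a *: u + v) - (a *: f u + f v)),
      forall g u, sq_num u -> sq_den (f (sq_act g u) - sq_act g (f u)),
      forall u, sq_num u -> (sq_den (f u) <-> sq_den u)
    & forall w, sq_num w -> exists2 u, sq_num u & sq_den (f u - w)]].

Section CommutativeAlgebra.
Variables (gT : finGroupType) (S : comPzRingType).

Record ring_action := RingAction {
  ract :> gT -> {rmorphism S -> S};
  ract1 : forall u, ract 1%g u = u;
  ractM : forall g h u, ract (g * h)%g u = ract g (ract h u) }.

Definition integral_closure (A : set S) : set S :=
  [set u | exists n (a : 'I_n -> S),
     (forall i, A (a i)) /\ u ^+ n + \sum_(i < n) a i * u ^+ i = 0].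

(* B/A is a Galois extension of commutative rings with group G in the sense
   of Chase, Harrison and Rosenberg; equivalently, Spec B -> Spec A is an
   etale G-torsor. *)
Definition galois_over (act : ring_action) (A B : set S) : Prop :=
  [/\ forall g b, B b -> B (act g b),
      forall b, A b <-> B b /\ (forall g, act g b = b)
    & exists n (u v : 'I_n -> S), [/\ forall i, B (u i), forall i, B (v i)
        & forall g, \sum_i u i * act g (v i) = (g == 1%g)%:R]].

Definition free_basis (A M : set S) n (e : 'I_n -> S) : Prop :=
  (forall i, M (e i)) /\
  forall m, M m -> exists! a : 'I_n -> S,
    (forall i, A (a i)) /\ m = \sum_i a i * e i.

(* The trace of a Galois extension S/A, as galTrace in galois.v. *)
Definition galois_trace (act : ring_action) (u : S) : S := \sum_(g : gT) act g u.

End CommutativeAlgebra.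

(* The algebra [prod_i k((t_i))], the index i ranging over 'I_r.+1; the first
   component has index ord0. *)
Notation lprod k r := ('I_r.+1 -> laurent k).

Definition power_series (k : fieldType) : set (laurent k) := [set f | ord_ge 0 f].
Arguments power_series : clear implicits.

Definition lprod_ge (k : fieldType) (r : nat) (m : int) : set (lprod k r) :=
  [set f | forall i, ord_ge m (f i)].
Arguments lprod_ge {k r} m.

(* A G-Galois etale algebra [prod_i k((t_i))] over k((x)), embedded by
   [loc_incl], such that [prod_i k[[t_i]]] is the integral closure of k[[x]]. *)
Record local_galois (k : fieldType) (gT : finGroupType) (r : nat) := LocalGalois {
  loc_incl : {rmorphism laurent k -> lprod k r};
  loc_act : ring_action gT (lprod k r);
  loc_inclZ : forall (c : k) f, loc_incl (c *: f) = c *: loc_incl f;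
  loc_galois : galois_over loc_act (range loc_incl) [set: lprod k r];
  loc_integral :
    integral_closure (loc_incl @` power_series k) = lprod_ge 0 }.

Section Local.
Variables (k : fieldType) (gT : finGroupType) (r : nat) (B : local_galois k gT r).

(* The group G_j of the i-th maximal ideal m_i, for j >= 0; the condition
   g^*(b) = b mod m_i^(j+1) for all b forces g to stabilize m_i. *)
Definition ram_group (i : 'I_r.+1) (j : nat) : {set gT} :=
  finset (fun g => `[< forall b : lprod k r, lprod_ge 0 b ->
    ord_ge j.+1%:Z ((loc_act B g b - b) i) >]).

Definition d_prime : nat :=
  \big[addn/0%N]_(j \in [set j : nat | (1 <= j)%N])
    (#|ram_group ord0 j| - 1)%N.

Definition magical (z : lprod k r) : Prop :=
  lprod_ge (- d_prime%:Z) z /\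
  exists a b : laurent k, [/\ power_series k a, power_series k b, a * b = 1
    & galois_trace (loc_act B) z = loc_incl B a].

Definition dual_element (z zv : lprod k r) : Prop :=
  forall g1 g2 : gT,
    galois_trace (loc_act B) (loc_act B g1 z * loc_act B g2 zv) = (g1 == g2)%:R.

(* [h : lprod k r] also stands for the differential (h_i dt_i)_i. *)

Definition lprod_d (f : lprod k r) : lprod k r := fun i => lderiv (f i).

(* g^*(h dt) = g^*(h) d(g^*(t)) *)
Definition omega_act (g : gT) (h : lprod k r) : lprod k r :=
  loc_act B g h * lprod_d (loc_act B g (fun=> lX k)).

(* (1/x) k[[x]] dx inside the differentials of lprod *)
Definition omega_A_log : set (lprod k r) :=
  [set loc_incl B f * lprod_d (loc_incl B (lX k)) | f in [set f | ord_ge (-1) f]].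

Definition omega_B_log : set (lprod k r) := lprod_ge (-1).

Definition max_A : set (lprod k r) := loc_incl B @` [set f | ord_ge 1 f].

Definition max_B : set (lprod k r) := lprod_ge 1.

(* The sum of the g^*(z) M; it is direct when z has a dual element, since then
   the g^*(z) are linearly independent over k((x)). *)
Definition conj_sum (z : lprod k r) (M : set (lprod k r)) : set (lprod k r) :=
  [set u | exists2 m : gT -> lprod k r, (forall g, M (m g))
         & u = \sum_(g : gT) loc_act B g z * m g].

Definition local_H0 (z : lprod k r) : subquotient k gT :=
  Subquotient omega_act omega_B_log (conj_sum z omega_A_log).

Definition local_H1 (zv : lprod k r) : subquotient k gT :=
  Subquotient (fun g => loc_act B g : lprod k r -> lprod k r)
    (conj_sum zv max_A) max_B.

Definition local_HdR (z zv : lprod k r) : subquotient k gT :=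
  @Subquotient k gT (lprod k r * lprod k r)%type
    (fun g w => (omega_act g w.1, loc_act B g w.2))
    [set w | conj_sum zv max_A w.2 /\ omega_B_log (w.1 - lprod_d w.2)]
    [set w | conj_sum z omega_A_log w.1 /\ max_B w.2].

End Local.

Notation ratfun k := {fraction {poly k}}.

Section RationalFunctions.
Variable k : fieldType.

Definition rat_poly (p : {poly k}) : ratfun k := FracField.tofrac p.

Definition rat_x : ratfun k := rat_poly 'X.

Definition rat_const (c : k) : ratfun k := rat_poly c%:P.

(* The functions regular on P^1 \ {oo}, on P^1 \ {0'} and on their
   intersection, where oo is the point x = 0 and 0' the zero of 1/x. *)
Definition reg_affine : set (ratfun k) :=
  [set (map_poly rat_const p).[rat_x^-1] | p in [set: {poly k}]].

Definition reg_infty : set (ratfun k) := range rat_poly.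

Definition reg_overlap : set (ratfun k) :=
  [set f | exists p n, f = rat_poly p / rat_x ^+ n].

Definition local_ring_infty : set (ratfun k) :=
  [set f | exists2 pq, pq.2.[0] != 0 & f = rat_poly pq.1 / rat_poly pq.2].

End RationalFunctions.

Arguments reg_affine k : clear implicits.
Arguments reg_infty k : clear implicits.
Arguments reg_overlap k : clear implicits.
Arguments local_ring_infty k : clear implicits.

(* A G-cover X -> P^1 with X a smooth projective, possibly disconnected curve,
   is the normalization of P^1 in the ring [cov_fun] of rational functions of
   X, a G-Galois algebra over k(x).  The rational differentials of X are the
   f dx with f in [cov_fun]; they are represented by f, and [cov_d f] is
   df/dx. *)
Record p1_cover (k : fieldType) (gT : finGroupType) := P1Cover {
  cov_fun : comAlgType k;
  cov_incl : {rmorphism ratfun k -> cov_fun};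
  cov_act : ring_action gT cov_fun;
  cov_d : {linear cov_fun -> cov_fun};
  cov_inclA : forall c : k, cov_incl (rat_const c) = c%:A;
  cov_galois : galois_over cov_act (range cov_incl) [set: cov_fun];
  cov_dM : forall f h, cov_d (f * h) = f * cov_d h + h * cov_d f;
  cov_dx : cov_d (cov_incl (rat_x k)) = 1 }.

Section Cover.
Variables (k : fieldType) (gT : finGroupType) (X : p1_cover k gT).
Local Notation L := (cov_fun X).

(* Sections of O_X and Omega_X on the inverse image of Spec A in X; Kaehler
   differentials of the smooth algebra [sections A] are torsion free, hence
   embed into the rational differentials. *)
Definition sections (A : set (ratfun k)) : set L :=
  integral_closure (cov_incl X @` A).

Definition omega_sections (A : set (ratfun k)) : set L :=
  [set w | exists n (f h : 'I_n -> L), [/\ forall i, sections A (f i),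
     forall i, sections A (h i) & w = \sum_i f i * cov_d X (h i)]].

Definition unramified_off_infty : Prop :=
  galois_over (cov_act X) (cov_incl X @` reg_affine k) (sections (reg_affine k)).

(* Cech cohomology for the affine open cover of X by the inverse images U and V
   of P^1 \ {oo} and P^1 \ {0'}. As x is G-invariant, g^*(f dx) = g^*(f) dx. *)

Local Notation OU := (sections (reg_affine k)).
Local Notation OV := (sections (reg_infty k)).
Local Notation OUV := (sections (reg_overlap k)).
Local Notation WU := (omega_sections (reg_affine k)).
Local Notation WV := (omega_sections (reg_infty k)).

Definition H0_Omega : subquotient k gT :=
  @Subquotient k gT L (fun g => cov_act X g) (WU `&` WV) [set 0].

Definition H1_O : subquotient k gT :=
  @Subquotient k gT L (fun g => cov_act X g) OUV
    [set f | exists fU fV, [/\ OU fU, OV fV & f = fU - fV]].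

(* First hypercohomology of O_X -> Omega_X: cocycles (w_U, w_V, f) with
   w_U - w_V = df, modulo the (d f_U, d f_V, f_U - f_V). *)
Definition H1_dR : subquotient k gT :=
  @Subquotient k gT (L * L * L)%type
    (fun g c => (cov_act X g c.1.1, cov_act X g c.1.2, cov_act X g c.2))
    [set c | [/\ WU c.1.1, WV c.1.2, OUV c.2 & c.1.1 - c.1.2 = cov_d X c.2]]
    [set c | exists fU fV,
       [/\ OU fU, OV fV & c = (cov_d X fU, cov_d X fV, fU - fV)]].

(* [loc] is the completion at oo. The isomorphism between the base change to
   k[[x]] of the stalk at oo of pi_* O_X, which is free over the local ring of
   P^1 at oo, and prod_i k[[t_i]] is expressed with bases. *)
Definition hkg_cover (r : nat) (B : local_galois k gT r) : Prop :=
  unramified_off_infty /\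
  exists loc : {rmorphism L -> lprod k r},
  [/\ forall p : {poly k}, loc (cov_incl X (rat_poly p)) = loc_incl B (lpoly p),
      forall g f, loc (cov_act X g f) = loc_act B g (loc f)
    & exists n (e : 'I_n -> L),
        free_basis (cov_incl X @` local_ring_infty k)
                   (sections (local_ring_infty k)) e
     /\ free_basis (loc_incl B @` power_series k) (lprod_ge 0) (loc \o e)].

End Cover.

(* Main.v *)
From HB Require Import structures.
Require Import Defs.
From mathcomp Require Import all_boot all_order all_algebra.
From mathcomp Require Import all_fingroup all_solvable.

Set Implicit Arguments.
Unset Strict Implicit.
Unset Printing Implicit Defensive.

Import GRing.Theory.

Local Open Scope ring_scope.

(** Let O be the ring of functions on X away from oo, embedded in L; its G-invariants
    are k[1/x].  A nonzero G-stable subspace of a p-group representation has nonzero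
    invariants.  For an element z of unit trace this gives the splitting
      L = (direct sum of the g z m_A) + O, with intersection zero:
    the invariants k((x)) = m_A + k[1/x] split, and invariant classes lift because O
    has an element of trace one.  Multiplication by dx/x^2 turns this into
    Omega_L = (direct sum of the g z Omega_A^log) + (differentials regular off oo),
    and the same holds for the dual of z.

    Hilbert's formula, obtained from Lagrange interpolation at the conjugates of t,
    gives ord (dx/dt) = d' + #G_0 - 1.  This is what places the translates of
    z Omega_A^log in Omega_B^log, and m_B in the span of the translates of zv m_A.
    Since G_0 is normal, the splitting argument, applied to m_B and the G_0-invariants
    of L, shows that the idempotents of L lie in O.  Hence the residue theorem holds on
    each component, where oo has a single preimage, and logarithmic poles at oo of
    forms regular elsewhere are not poles.

    The cohomology of X is computed from the cover by the affine part and a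
    neighbourhood of oo; density of the functions on X in L replaces the second
    chart by the completion.  The projections along O and along its differentials are
    then the isomorphisms. *)

Module HKGCohomology.

From mathcomp Require Import zify ring.
From mathcomp Require Import boolp classical_sets functions cardinality fsbigop.

Import Order.TTheory Num.Theory.

Local Open Scope classical_set_scope.
Local Open Scope ring_scope.

(** * Invariants of p-groups *)

Section PGroupInvariants.
Variables (k : fieldType) (p : nat) (gT : finGroupType) (V : lmodType k).
Variable act : gT -> V -> V.
Hypothesis chark : p \in [pchar k].
Hypothesis pG : (p.-group [set: gT]%SET)%g.
Hypothesis actL : forall g (a : k) u v, act g (a *: u + v) = a *: act g u + act g v.
Hypothesis act1 : forall u, act 1%g u = u.
Hypothesis actM : forall g h u, act (g * h)%g u = act g (act h u).

Lemma lin_actB g u v : act g (u - v) = act g u - act g v.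
Proof. by rewrite -scaleN1r addrC actL scaleN1r addrC. Qed.

Lemma submoduleD (S : set V) u v : submodule act S -> S u -> S v -> S (u + v).
Proof. by move=> [_ SD _] /SD/[apply] => /(_ 1); rewrite scale1r. Qed.

Lemma submoduleZ (S : set V) a u : submodule act S -> S u -> S (a *: u).
Proof. by move=> [S0 SD _] Su; have := SD a _ _ Su S0; rewrite addr0. Qed.

Lemma submoduleB (S : set V) u v : submodule act S -> S u -> S v -> S (u - v).
Proof.
by move=> Sm Su Sv; apply: submoduleD => //; rewrite -scaleN1r; apply: submoduleZ.
Qed.

Let ev (s : gT) (q : {poly k}) (v : V) := \sum_(i < size q) q`_i *: act (s ^+ i)%g v.

Lemma evE s (q : {poly k}) v n : (size q <= n)%N ->
  \sum_(i < n) q`_i *: act (s ^+ i)%g v = ev s q v.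
Proof.
move=> qn; rewrite /ev -!(big_mkord xpredT (fun i => q`_i *: act (s ^+ i)%g v)).
rewrite (big_cat_nat (n := size q)) //= addrC big_nat_cond big1 ?add0r //.
by move=> i /andP[/andP[qi _] _]; rewrite nth_default // scale0r.
Qed.

Lemma ev_mulXsub1 s (q : {poly k}) v : ev s (q * ('X - 1))%R v = ev s q (act s v - v).
Proof.
have sz : (size (q * ('X - 1))%R <= (size q).+1)%N.
  by apply: leq_trans (size_polyMleq _ _) _; rewrite -(polyC1 k) size_XsubC addn2.
rewrite -(@evE s _ v _ sz) /ev.
transitivity (\sum_(i < (size q).+1) (q * 'X)`_i *: act (s ^+ i)%g v
   - \sum_(i < (size q).+1) q`_i *: act (s ^+ i)%g v).
  by rewrite -sumrB; apply: eq_bigr => i _; rewrite mulrBr mulr1 coefB scalerBl.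
rewrite big_ord_recl coefMX /= scale0r add0r big_ord_recr /=.
rewrite [q`_(size q)]nth_default // scale0r addr0 -sumrB; apply: eq_bigr => i _.
by rewrite coefMX /= lin_actB scalerBr -actM expgSr.
Qed.

Lemma iter_act_sub1 s n v : iter n (fun u => act s u - u) v = ev s (('X - 1) ^+ n) v.
Proof.
elim: n v => [|n IH] v; last by rewrite iterSr IH exprSr ev_mulXsub1.
by rewrite expr0 /ev size_poly1 big_ord1 coef1 scale1r expg0 act1.
Qed.

Lemma iter_act_sub1_p_elt s : iter #[s]%g (fun u => act s u - u) =1 fun=> 0.
Proof.
move=> v; rewrite iter_act_sub1.
have pX : p \in [pchar {poly k}] by rewrite pchar_poly.
have ps : [pchar {poly k}].-nat #[s]%g.
  by rewrite (eq_pnat _ (pcharf_eq pX)); apply: (mem_p_elt pG); rewrite inE.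
rewrite exprDn_pchar // exprNn_pchar // expr1n.
have sz : (size ('X^(#[s]%g) - 1 : {poly k})%R <= #[s]%g.+1)%N.
  by rewrite -(polyC1 k) size_XnsubC.
rewrite -(@evE _ _ _ _ sz) big_ord_recr /= coefB coefXn eqxx coef1.
case: #[s]%g (order_gt0 s) (expg_order s) => // n _ sn.
rewrite subr0 scale1r sn act1 big_ord_recl coefB coefXn coef1 /= sub0r expg0 act1.
rewrite scaleN1r big1 ?addr0 ?addNr // => i _.
by rewrite coefB coefXn coef1 /= eqSS (ltn_eqF (ltn_ord i)) subrr scale0r.
Qed.

(* A maximal subgroup H fixing some class outside W is everything: an element s
   normalizing H acts on the H-fixed classes, and s - 1 is nilpotent there since
   (s - 1)^(p^n) = s^(p^n) - 1. *)
Lemma pgroup_invariants_sub (V0 W : set V) :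
    submodule act V0 -> submodule act W ->
    (forall u, V0 u -> (forall g, W (act g u - u)) -> W u) ->
  V0 `<=` W.
Proof.
move=> V0m Wm V0W v V0v; apply: contrapT => nWv.
have [[V00 _ V0a] [W0 _ Wa]] := (V0m, Wm).
pose fixes (H : {set gT}) u := forall h, h \in H -> W (act h u - u).
pose good (H : {group gT}) := `[< exists u, [/\ V0 u, ~ W u & fixes H u] >].
have good1 : good 1%G.
  apply/asboolP; exists v; split=> // h /set1P ->.
  by rewrite act1 subrr.
have [H /maxgroupP[/asboolP[u [V0u nWu Hu]] Hmax] _] := maxgroup_exists good1.
have [HG | nHG] := eqVneq (H : {set gT}) [set: gT]%SET.
  by apply: nWu; apply: V0W => // g; apply: Hu; rewrite HG inE.
have HpG : H \proper [set: gT]%SET by rewrite finset.properEneq nHG finset.subsetT.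
have /properP[_ [s /setIP[_ sN] sH]] := nilpotent_proper_norm (pgroup_nil pG) HpG.
pose T w := act s w - w.
have TH n : V0 (iter n T u) /\ fixes H (iter n T u).
  elim: n => [|n [V0n Hn]] //=; split; first by apply: (submoduleB V0m) => //; apply: V0a.
  move=> h hH; rewrite /T; set w := iter n T u in V0n Hn *.
  have -> : act h (act s w - w) - (act s w - w) = act s (act (h ^ s)%g w - w) - (act h w - w).
    by rewrite !lin_actB -!actM conjgE !mulgA mulgV mul1g !opprB addrACA
      [RHS]addrACA [X in _ + X = _]addrC.
  apply: (submoduleB Wm); last exact: Hn.
  by apply: Wa; apply: Hn; rewrite memJ_norm.
have exj : exists j, `[< W (iter j T u) >].
  by exists #[s]%g; apply/asboolP; rewrite iter_act_sub1_p_elt.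
have [[|j] /asboolP Wj jmin] := ex_minnP exj; first by apply: nWu.
have nWj : ~ W (iter j T u) by move=> /asboolP/jmin; rewrite ltnn.
set w := iter j T u in nWj; have [V0w Hw] := TH j.
pose K := [set g | `[< W (act g w - w) >]]%SET.
have gK : group_set K.
  apply/group_setP; split=> [|g h]; rewrite !inE.
    by rewrite act1 subrr.
  move=> gw hw.
  have -> : act (g * h)%g w - w = act g (act h w - w) + (act g w - w).
    by rewrite lin_actB actM addrA subrK.
  by apply: (submoduleD Wm) => //; apply: Wa.
have HK : H \subset Group gK.
  by apply/fintype.subsetP => h /Hw hw; rewrite !inE.
have goodK : good (Group gK).
  by apply/asboolP; exists w; split=> // h; rewrite !inE.
have := Hmax _ goodK HK => /= KH.
by move/negP: sH; apply; rewrite -KH !inE.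
Qed.

End PGroupInvariants.

(** * Traces and dual bases *)

Definition subring_set (S : pzRingType) (B : set S) : Prop :=
  [/\ B 1, forall u v, B u -> B v -> B (u - v) & forall u v, B u -> B v -> B (u * v)].

Section SubringSet.
Variables (S : pzRingType) (B : set S).
Hypothesis Br : subring_set B.

Lemma subring_set1 : B 1. Proof. by case: Br. Qed.
Lemma subring_setB u v : B u -> B v -> B (u - v).
Proof. by case: Br => _ BB _; apply: BB. Qed.
Lemma subring_setM u v : B u -> B v -> B (u * v).
Proof. by case: Br => _ _ BM; apply: BM. Qed.
Lemma subring_set0 : B 0.
Proof. by rewrite -(subrr 1); apply: subring_setB; apply: subring_set1. Qed.
Lemma subring_setN u : B u -> B (- u).
Proof. by move=> Bu; rewrite -sub0r; apply: subring_setB => //; apply: subring_set0. Qed.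
Lemma subring_setD u v : B u -> B v -> B (u + v).
Proof. by move=> Bu Bv; rewrite -[v]opprK; apply: subring_setB => //; apply: subring_setN. Qed.
Lemma subring_set_sum (I : Type) (s : seq I) (P : pred I) (F : I -> S) :
  (forall i, P i -> B (F i)) -> B (\sum_(i <- s | P i) F i).
Proof.
by move=> BF; elim/big_ind: _ => //; [apply: subring_set0 | apply: subring_setD].
Qed.
Lemma subring_set_prod (I : Type) (s : seq I) (P : pred I) (F : I -> S) :
  (forall i, P i -> B (F i)) -> B (\prod_(i <- s | P i) F i).
Proof.
by move=> BF; elim/big_ind: _ => //; [apply: subring_set1 | apply: subring_setM].
Qed.
Lemma subring_setX u n : B u -> B (u ^+ n).
Proof.
move=> Bu; elim: n => [|n IH]; first by rewrite expr0; apply: subring_set1.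
by rewrite exprS; apply: subring_setM.
Qed.

End SubringSet.

Section GaloisTrace.
Variables (gT : finGroupType) (S : comPzRingType) (act : ring_action gT S).
Local Notation tr := (galois_trace act).

Lemma ractK g u : act g^-1%g (act g u) = u.
Proof. by rewrite -ractM mulVg ract1. Qed.

Lemma ractKV g u : act g (act g^-1%g u) = u.
Proof. by rewrite -ractM mulgV ract1. Qed.

Lemma galois_traceD u v : tr (u + v) = tr u + tr v.
Proof. by rewrite /galois_trace -big_split; apply: eq_bigr => g _; rewrite rmorphD. Qed.

Lemma galois_trace0 : tr 0 = 0.
Proof. by rewrite /galois_trace big1 // => g _; rewrite rmorph0. Qed.

Lemma galois_trace_sum (I : Type) (s : seq I) (P : pred I) (F : I -> S) :
  tr (\sum_(i <- s | P i) F i) = \sum_(i <- s | P i) tr (F i).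
Proof. exact: (big_morph tr galois_traceD galois_trace0). Qed.

Lemma galois_traceN u : tr (- u) = - tr u.
Proof. by rewrite /galois_trace -sumrN; apply: eq_bigr => g _; rewrite rmorphN. Qed.

Lemma galois_traceB u v : tr (u - v) = tr u - tr v.
Proof. by rewrite galois_traceD galois_traceN. Qed.

Lemma ract_trace g u : act g (tr u) = tr u.
Proof.
rewrite /galois_trace rmorph_sum (reindex_inj (mulgI g^-1%g)) /=.
by apply: eq_bigr => h _; rewrite -ractM mulgA mulgV mul1g.
Qed.

Lemma galois_trace_act g u : tr (act g u) = tr u.
Proof.
rewrite /galois_trace [RHS](reindex_inj (mulIg g)) /=.
by apply: eq_bigr => h _; rewrite ractM.
Qed.

Lemma galois_traceZ c u : (forall g, act g c = c) -> tr (c * u) = c * tr u.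
Proof.
by move=> cG; rewrite /galois_trace mulr_sumr; apply: eq_bigr => g _; rewrite rmorphM /= cG.
Qed.

Section DualBases.
Variables (n : nat) (u v : 'I_n -> S).
Hypothesis uv : forall g, \sum_i u i * act g (v i) = (g == 1%g)%:R.

Lemma galois_expand_l w : w = \sum_i u i * tr (v i * w).
Proof.
transitivity (\sum_(g : gT) (g == 1%g)%:R * act g w).
  rewrite (bigD1 1%g) //= eqxx mul1r ract1 big1 ?addr0 // => g /negPf->.
  by rewrite mul0r.
transitivity (\sum_g \sum_i u i * act g (v i * w)).
  apply: eq_bigr => g _; rewrite -uv mulr_suml; apply: eq_bigr => i _.
  by rewrite rmorphM mulrA.
by rewrite exchange_big; apply: eq_bigr => i _; rewrite mulr_sumr.
Qed.

Lemma galois_dual_sym g : \sum_i v i * act g (u i) = (g == 1%g)%:R.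
Proof.
transitivity (act g (\sum_i u i * act g^-1%g (v i))).
  by rewrite rmorph_sum; apply: eq_bigr => i _ /=; rewrite rmorphM /= ractKV mulrC.
by rewrite uv rmorph_nat invg_eq1.
Qed.

Lemma derivation_formula (T : comPzRingType) (phi : {rmorphism S -> T}) (D : S -> T) a :
    (forall x y, D (x + y) = D x + D y) ->
    (forall x y, D (x * y) = phi x * D y + phi y * D x) ->
  D a = \sum_i \sum_j phi (u j * v i) * D (tr (v j * (a * u i))).
Proof.
move=> DD DM.
have D0 : D 0 = 0 by apply: (addrI (D 0)); rewrite -DD !addr0.
have Dsum := big_morph D DD D0.
have uv1 : \sum_i u i * v i = 1.
  by have := uv 1%g; rewrite eqxx mulr1n => <-; apply: eq_bigr => i _; rewrite ract1.
have vE w : w = \sum_i v i * tr (u i * w).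
  transitivity (\sum_(g : gT) (g == 1%g)%:R * act g w).
    rewrite (bigD1 1%g) //= eqxx mul1r ract1 big1 ?addr0 // => g /negPf->.
    by rewrite mul0r.
  transitivity (\sum_g \sum_i v i * act g (u i * w)).
    apply: eq_bigr => g _; rewrite -galois_dual_sym mulr_suml; apply: eq_bigr => i _.
    by rewrite rmorphM mulrA.
  by rewrite exchange_big; apply: eq_bigr => i _; rewrite mulr_sumr.
have Dau i : D (a * u i) = \sum_j (phi (u j) * D (tr (v j * (a * u i)))
    + phi (tr (v j * (a * u i))) * D (u j)).
  by rewrite {1}(galois_expand_l (a * u i)) Dsum; apply: eq_bigr => j _; rewrite DM.
transitivity (\sum_i phi (v i) * D (a * u i) - \sum_i phi (v i) * (phi a * D (u i))).
  rewrite -sumrB -[LHS]mul1r -(rmorph1 phi) -uv1 rmorph_sum mulr_suml.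
  apply: eq_bigr => i _; rewrite DM -mulrBr [_ + _ * D a]addrC addrK.
  by rewrite /= rmorphM mulrCA mulrA.
have -> : \sum_i phi (v i) * D (a * u i) =
    \sum_i \sum_j phi (u j * v i) * D (tr (v j * (a * u i)))
    + \sum_j phi (v j * a) * D (u j).
  transitivity (\sum_i (\sum_j phi (u j * v i) * D (tr (v j * (a * u i)))
      + \sum_j phi (v i * tr (v j * (a * u i))) * D (u j))).
    apply: eq_bigr => i _; rewrite Dau mulr_sumr -big_split; apply: eq_bigr => j _.
    by rewrite /= mulrDr !rmorphM /= !mulrA [phi (v i) * phi (u j)]mulrC.
  rewrite big_split /=; congr (_ + _); rewrite exchange_big; apply: eq_bigr => j _.
  rewrite -mulr_suml -rmorph_sum; congr (phi _ * _).
  rewrite [RHS]vE; apply: eq_bigr => i _; congr (_ * tr _).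
  by rewrite mulrA mulrC.
rewrite -addrA -sumrB [X in _ + X]big1 ?addr0 // => i _.
by rewrite rmorphM mulrA subrr.
Qed.

End DualBases.

(* The trace ideal T satisfies B = T B, since u_i = sum_j u_j tr (v_j u_i); by the
   determinant trick it contains 1. *)
Lemma galois_trace_one (A B : set S) : subring_set B -> galois_over act A B ->
  exists2 theta, B theta & tr theta = 1.
Proof.
move=> Br [actB _ [n [u [v [Bu Bv uv]]]]].
pose inR c := B c /\ forall g, act g c = c.
have R1 : inR 1 by split=> [|g]; rewrite ?rmorph1 //; apply: subring_set1.
have RB c d : inR c -> inR d -> inR (c - d).
  move=> [Bc cG] [Bd dG]; split=> [|g]; first exact: subring_setB.
  by rewrite rmorphB /= cG dG.
have RM c d : inR c -> inR d -> inR (c * d).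
  move=> [Bc cG] [Bd dG]; split=> [|g]; first exact: subring_setM.
  by rewrite rmorphM /= cG dG.
pose inT c := exists2 b, B b & c = tr b.
have T0 : inT 0 by exists 0; rewrite ?galois_trace0 //; apply: subring_set0.
have TD c d : inT c -> inT d -> inT (c + d).
  by move=> [b Bb ->] [b' Bb' ->]; exists (b + b'); rewrite ?galois_traceD //;
    apply: subring_setD.
have TM c d : inR c -> inT d -> inT (c * d).
  move=> [Bc cG] [b Bb ->]; exists (c * b); first exact: subring_setM.
  by rewrite galois_traceZ.
have RT c : inT c -> inR c.
  move=> [b Bb ->]; split=> [|g]; last exact: ract_trace.
  by apply: subring_set_sum => // g _; apply: actB.
pose M : 'M[S]_n := \matrix_(i, j) tr (v j * u i).
have TA i j : inT (M i j) by rewrite mxE; exists (v j * u i) => //; apply: subring_setM.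
have R0 : inR 0 by apply: RT.
have RN c : inR c -> inR (- c) by move=> Rc; rewrite -sub0r; apply: RB.
have RD c d : inR c -> inR d -> inR (c + d).
  by move=> Rc Rd; rewrite -[d]opprK; apply: RB => //; apply: RN.
have d0 : \det (1%:M - M) = 0.
  have MU : (1%:M - M) *m \col_i u i = 0.
    apply/matrixP => i j; rewrite mulmxBl mul1mx !mxE {1}(galois_expand_l uv (u i)).
    by rewrite -sumrB big1 // => l _; rewrite !mxE mulrC subrr.
  have dU i : \det (1%:M - M) * u i = 0.
    have := congr1 (fun N : 'cV[S]_n => N i 0) (congr1 (mulmx (\adj (1%:M - M))) MU).
    by rewrite mulmxA mul_adj_mx mul_scalar_mx mulmx0 !mxE.
  have uv1 : \sum_i u i * v i = 1.
    by have := uv 1%g; rewrite eqxx mulr1n => <-; apply: eq_bigr => i _; rewrite ract1.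
  by rewrite -[LHS]mulr1 -[X in _ * X]uv1 mulr_sumr big1 // => i _; rewrite mulrA dU mul0r.
suff [b Bb db] : inT (1 - \det (1%:M - M)) by exists b => //; rewrite -db d0 subr0.
have TN c : inT c -> inT (- c).
  by move=> Tc; rewrite -mulN1r; apply: TM => //; apply: RN.
rewrite /determinant (bigD1 (1%g : 'S_n)) //= opprD addrA; apply: (TD); last first.
  apply/TN; apply: (big_ind inT) => [//|c d|s s1]; first exact: TD.
  have [i si] : exists i, s i != i.
    apply/existsP; apply: contraR s1; rewrite negb_exists => /forallP s1.
    by apply/eqP/permP => i; apply/eqP; rewrite perm1 -[_ == _]negbK.
  apply: (TM); first by elim: (odd_perm s); rewrite ?expr0 ?expr1 //; apply: RN.
  rewrite (bigD1 i) //= mulrC; apply: (TM).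
    apply: (big_ind inR) => [//|c d|j _]; first exact: RM.
    rewrite !mxE.
    by apply: RB; [case: eqP => // _; apply: RT | apply: RT; have := TA j (s j); rewrite mxE].
  by rewrite !mxE eq_sym (negPf si) sub0r; apply: TN; have := TA i (s i); rewrite mxE.
rewrite odd_perm1 expr0 mul1r.
suff [] : inR (\prod_i (1%:M - M) i ((1%g : 'S_n) i)) /\
  inT (1 - \prod_i (1%:M - M) i ((1%g : 'S_n) i)) by [].
elim/big_ind: _ => [|c d [Rc Tc] [Rd Td]|i _]; first by rewrite subrr.
  split; first exact: RM.
  have -> : 1 - c * d = (1 - c) + c * (1 - d) by rewrite mulrBr mulr1 addrA subrK.
  by apply: TD => //; apply: TM.
rewrite perm1 [(1%:M - M) i i]mxE [in X in X + _]mxE eqxx.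
have TMi : inT (M i i) by [].
rewrite [(- M) i i]mxE; split; first by apply: RB => //; apply: RT.
by rewrite opprB addrCA subrr addr0.
Qed.

End GaloisTrace.

(** * Laurent series *)

Section LaurentOrder.
Variable k : fieldType.
Implicit Types (f g h : laurent k) (a b m n : int).

Lemma lcoefB f g n : (f - g) n = f n - g n. Proof. by []. Qed.
Lemma lcoefN f n : (- f) n = - f n. Proof. by []. Qed.
Lemma lcoefZ c f n : (c *: f) n = c * f n. Proof. by []. Qed.
Lemma lcoef_lser u n : lser u n = lser_coef u n :> k. Proof. by []. Qed.
Lemma lcoef_lderiv f n : lderiv f n = f (n + 1) *~ (n + 1). Proof. by []. Qed.

Lemma ord_ge0 m : ord_ge m (0 : laurent k). Proof. by move=> n. Qed.
Lemma ord_geD m f g : ord_ge m f -> ord_ge m g -> ord_ge m (f + g).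
Proof. by move=> fm gm n nm; rewrite lcoefD fm // gm // addr0. Qed.
Lemma ord_geN m f : ord_ge m f -> ord_ge m (- f).
Proof. by move=> fm n nm; rewrite lcoefN fm // oppr0. Qed.
Lemma ord_geB m f g : ord_ge m f -> ord_ge m g -> ord_ge m (f - g).
Proof. by move=> fm gm; apply: ord_geD => //; apply: ord_geN. Qed.
Lemma ord_geZ m c f : ord_ge m f -> ord_ge m (c *: f).
Proof. by move=> fm n nm; rewrite lcoefZ fm // mulr0. Qed.
Lemma ord_ge_le m n f : n <= m -> ord_ge m f -> ord_ge n f.
Proof. exact: below_le. Qed.
Lemma ord_geM a b f g : ord_ge a f -> ord_ge b g -> ord_ge (a + b) (f * g).
Proof. exact: below_mul. Qed.
Lemma ord_ge_sum m (I : Type) (s : seq I) (P : pred I) (F : I -> laurent k) :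
  (forall i, P i -> ord_ge m (F i)) -> ord_ge m (\sum_(i <- s | P i) F i).
Proof.
by move=> mF; apply: (big_ind (ord_ge m)) => //; apply: ord_geD.
Qed.
Lemma ord_lser (u : nat -> k) : ord_ge 0 (lser u).
Proof. exact: below_lser. Qed.
Arguments ord_lser : clear implicits.
Lemma ord_ge1 : ord_ge 0 (1 : laurent k).
Proof. exact: ord_lser. Qed.

Lemma ord_geS m f : ord_ge m f -> f m = 0 -> ord_ge (m + 1) f.
Proof.
move=> fm f0 n nm; have [->//|nm'] := eqVneq n m; apply: fm; lia.
Qed.

Lemma ord_ge_eq0 f : (forall m : nat, ord_ge m%:Z f) -> f = 0.
Proof. by move=> fm; apply: laurent_ext => n; apply: (fm `|n|.+1); lia. Qed.

Lemma lcoefM_lead a b f g : ord_ge a f -> ord_ge b g -> (f * g) (a + b) = f a * g b.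
Proof.
move=> fa gb; have := lmul_coefE 0 fa gb; rewrite !addr0 big_ord1 /= => ->.
by rewrite !addr0.
Qed.

Lemma laurent_lead f : f != 0 -> exists2 m, ord_ge m f & f m != 0.
Proof.
move=> f0; have [a fa] := laurentP f.
have exn : exists n : nat, f (a + n%:Z) != 0.
  apply: contrapT => nex; move/eqP: f0; apply; apply: laurent_ext => n.
  have [na|an] := ltP n a; first exact: fa.
  have [j ->] := int_split an; apply: contrapT => /eqP fj; apply: nex; by exists j.
have [n fn nmin] := ex_minnP exn; exists (a + n%:Z) => // i ni.
have [ia|ai] := ltP i a; first exact: fa.
have [j ij] := int_split ai; apply: contrapT; rewrite ij => /eqP/nmin.
by move=> nj; move: ni; rewrite ij; lia.
Qed.

Lemma lmon_subproof a : (fun n : int => (n == a)%:R : k) \in @laurent_pred k.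
Proof. by apply/asboolP; exists a => n na; rewrite lt_eqF. Qed.
Definition lmon a : laurent k := Laurent (lmon_subproof a).

Lemma lcoef_lmon a n : lmon a n = (n == a)%:R. Proof. by []. Qed.

Lemma ord_lmon a : ord_ge a (lmon a).
Proof. by move=> n na; rewrite lcoef_lmon lt_eqF. Qed.

Arguments ord_lmon : clear implicits.

Lemma lcoef_lmonM a f n : (lmon a * f) n = f (n - a).
Proof.
have [b fb] := laurentP f; have [nab|abn] := ltP n (a + b).
  by rewrite (ord_geM (ord_lmon a) fb) ?fb //; lia.
have [j nj] := int_split abn.
rewrite nj -[LHS]/(lmul_coef _ _ _) (lmul_coefE _ (ord_lmon a) fb) big_ord_recl big1.
  by rewrite addr0 lcoef_lmon addr0 eqxx mul1r subn0; congr (f _); lia.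
move=> i _; rewrite lcoef_lmon /=; case: eqP => [|_]; last by rewrite mul0r.
by rewrite /bump /=; lia.
Qed.

Lemma lmonM a b : lmon a * lmon b = lmon (a + b).
Proof.
by apply: laurent_ext => n; rewrite lcoef_lmonM !lcoef_lmon; congr (nat_of_bool _)%:R; lia.
Qed.

Lemma lmon0 : lmon 0 = 1.
Proof. by apply: laurent_ext => -[[|n]|n]. Qed.

Lemma lmonK a f : lmon a * (lmon (- a) * f) = f.
Proof. by rewrite mulrA lmonM subrr lmon0 mul1r. Qed.

Lemma lmonNK a f : lmon (- a) * (lmon a * f) = f.
Proof. by rewrite mulrA lmonM addNr lmon0 mul1r. Qed.

Lemma lX_mon : lX k = lmon 1.
Proof. by apply: laurent_ext => -[n|n]. Qed.

Lemma lmonX a (n : nat) : lmon a ^+ n = lmon (a * n%:Z).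
Proof.
elim: n => [|n IH]; first by rewrite expr0 mulr0 lmon0.
by rewrite exprS IH lmonM; congr lmon; lia.
Qed.

Lemma lXX (n : nat) : lX k ^+ n = lmon n%:Z.
Proof. by rewrite lX_mon lmonX mul1r. Qed.

Lemma ord_ge_lmonM m a f : ord_ge m f -> ord_ge (a + m) (lmon a * f).
Proof. exact: ord_geM (ord_lmon a). Qed.

Arguments ord_ge_lmonM m a f : clear implicits.
Arguments ord_ge_lmonM [m] a [f].

Lemma ord_ge_lmonP m f : ord_ge m f <-> ord_ge 0 (lmon (- m) * f).
Proof.
split=> fm; first by have := ord_ge_lmonM (- m) fm; rewrite addNr.
by have := ord_ge_lmonM m fm; rewrite lmonK addr0.
Qed.

Fixpoint lser_inv_seq (u : nat -> k) (n : nat) : seq k :=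
  if n is n'.+1 then
    let s := lser_inv_seq u n' in
    rcons s ((u 0%N)^-1 * ((n' == 0%N)%:R - \sum_(i < n') u (n' - i)%N * s`_i))
  else [::].

Lemma size_lser_inv_seq u (n : nat) : size (lser_inv_seq u n) = n.
Proof. by elim: n => //= n IH; rewrite size_rcons IH. Qed.

Lemma nth_lser_inv_seq u (n m : nat) : (n < m)%N ->
  (lser_inv_seq u m)`_n = (lser_inv_seq u n.+1)`_n.
Proof.
elim: m => // m IH; rewrite ltnS leq_eqVlt => /predU1P[->//|nm].
by rewrite [LHS]/= nth_rcons size_lser_inv_seq nm IH.
Qed.

Lemma lser_inv u : u 0%N != 0 ->
  lser u * lser (fun i => (lser_inv_seq u i.+1)`_i) = 1.
Proof.
move=> u0; apply: laurent_ext => n; have [n0|n0] := ltP n 0.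
  by rewrite (ord_geM (ord_lser u) (ord_lser _)) //; case: n n0.
have [j] := int_split n0; rewrite add0r => ->.
have := lmul_coefE j (ord_lser u)
  (ord_lser (fun i => (lser_inv_seq u i.+1)`_i)).
rewrite !add0r => E; rewrite [LHS]E => {E}.
rewrite (reindex_inj rev_ord_inj) big_ord_recr /= subSS subnn.
rewrite nth_rcons size_lser_inv_seq ltnn subn0 eqxx mulrA mulfV // mul1r.
rewrite addrC -addrA [X in _ + X](_ : _ = 0) ?addr0 // addrC.
apply/eqP; rewrite subr_eq0; apply/eqP; apply: eq_bigr => i _.
have ij := ltn_ord i; rewrite subSS (subKn (ltnW ij)); congr (_ * _).
by rewrite (nth_lser_inv_seq u ij).
Qed.

Lemma laurent_mulV f : f != 0 -> exists g, g * f = 1.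
Proof.
move=> /laurent_lead[m fm f0].
pose u (i : nat) := f (m + i%:Z).
have fu : lmon (- m) * f = lser u.
  apply: laurent_ext => n; rewrite lcoef_lmonM opprK addrC.
  by case: n => [n|n] //; rewrite fm //= /lser_coef //; lia.
have u0 : u 0%N != 0 by rewrite /u addr0.
exists (lmon (- m) * lser (fun i => (lser_inv_seq u i.+1)`_i)).
by rewrite mulrAC fu lser_inv.
Qed.

Definition laurent_inv f : laurent k :=
  if pselect (f != 0) is left f0 then sval (cid (laurent_mulV f0)) else 0.

Fact laurent_mulVf f : f != 0 -> laurent_inv f * f = 1.
Proof.
by rewrite /laurent_inv; case: pselect => // f0 _; case: cid.
Qed.

Fact laurent_inv0 : laurent_inv 0 = 0.
Proof. by rewrite /laurent_inv; case: pselect => // n0; case/eqP: (n0). Qed.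

End LaurentOrder.

Arguments ord_lmon {k} a.
Arguments ord_ge_lmonM {k} [m] a [f].
Arguments ord_ge1 : clear implicits.

HB.instance Definition _ (k : fieldType) :=
  GRing.ComNzRing_isField.Build (laurent k) (@laurent_mulVf k) (@laurent_inv0 k).

Section LaurentField.
Variable k : fieldType.
Implicit Types (f g h : laurent k) (a b m n : int).

Lemma lmon_neq0 a : lmon k a != 0.
Proof.
by apply/eqP => /(congr1 (fun f : laurent k => f a))/eqP; rewrite lcoef_lmon eqxx oner_eq0.
Qed.

Lemma ord_geV m f : ord_ge m f -> f m != 0 -> ord_ge (- m) f^-1.
Proof.
move=> fm f0; have fn0 : f != 0 by apply: contraNneq f0 => ->.
have [a fa fa0] := laurent_lead (invr_neq0 fn0).
have := lcoefM_lead fm fa; rewrite mulfV // => E.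
have : f m * f^-1 a != 0 by rewrite mulf_neq0.
rewrite -E -[1]lmon0 lcoef_lmon; have [ma _|_] := eqVneq (m + a) 0; last by rewrite eqxx.
by apply: ord_ge_le fa; lia.
Qed.

Lemma lcoefV m f : ord_ge m f -> f m != 0 -> f^-1 (- m) = (f m)^-1.
Proof.
move=> fm f0; have fn0 : f != 0 by apply: contraNneq f0 => ->.
have := lcoefM_lead fm (ord_geV fm f0); rewrite mulfV // subrr => E.
by apply: (mulfI f0); rewrite mulfV // -E.
Qed.

Lemma ord_geX m f (n : nat) : ord_ge m f -> ord_ge (m * n%:Z) (f ^+ n).
Proof.
move=> fm; elim: n => [|n IH]; first by rewrite mulr0 expr0; apply: ord_ge1.
by have := ord_geM fm IH; rewrite -exprS; apply: ord_ge_le; lia.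
Qed.

Lemma ord_ge_prod (I : finType) (P : pred I) (m : I -> nat) (F : I -> laurent k) :
  (forall i, P i -> ord_ge (m i)%:Z (F i)) ->
  ord_ge (\sum_(i | P i) m i)%N%:Z (\prod_(i | P i) F i).
Proof.
move=> mF; apply: (big_ind2 (fun (n : nat) f => ord_ge n%:Z f)) => //.
  exact: ord_ge1.
by move=> n f n' f' fn fn'; rewrite PoszD; apply: ord_geM.
Qed.

Lemma lcoef_prod_lead (I : finType) (P : pred I) (m : I -> nat) (F : I -> laurent k) :
  (forall i, P i -> ord_ge (m i)%:Z (F i)) ->
  (\prod_(i | P i) F i) (\sum_(i | P i) m i)%N%:Z = \prod_(i | P i) F i (m i)%:Z.
Proof.
move=> mF.
suff [] : ord_ge (\sum_(i | P i) m i)%N%:Z (\prod_(i | P i) F i) /\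
  (\prod_(i | P i) F i) (\sum_(i | P i) m i)%N%:Z = \prod_(i | P i) F i (m i)%:Z by [].
apply: (big_ind3 (fun (n : nat) f (c : k) => ord_ge n%:Z f /\ f n%:Z = c)).
- by split; [apply: ord_ge1 | ].
- move=> n f c n' f' c' [fn <-] [fn' <-]; rewrite PoszD; split; first exact: ord_geM.
  exact: lcoefM_lead.
- by move=> i Pi; split => //; apply: mF.
Qed.

Lemma lpolyD (p q : {poly k}) : lpoly (p + q) = lpoly p + lpoly q.
Proof.
by apply: laurent_ext => -[n|n]; rewrite lcoefD !lcoef_lser /= ?coefD ?addr0.
Qed.

Lemma lpolyZ c (p : {poly k}) : lpoly (c *: p) = c *: lpoly p.
Proof.
by apply: laurent_ext => -[n|n]; rewrite lcoefZ !lcoef_lser /= ?coefZ ?mulr0.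
Qed.

Lemma lpolyM (p q : {poly k}) : lpoly (p * q) = lpoly p * lpoly q.
Proof.
apply: laurent_ext => n; have [n0|n0] := ltP n 0.
  by rewrite (ord_geM (ord_lser _) (ord_lser _)) //; case: n n0.
have [j] := int_split n0; rewrite add0r => ->.
have := lmul_coefE j (ord_lser (nth 0 p)) (ord_lser (nth 0 q)).
rewrite !add0r => E; rewrite [RHS]E lcoef_lser /= coefM.
by apply: eq_bigr => i _; rewrite ?add0r.
Qed.

Lemma lpoly1 : lpoly 1 = 1 :> laurent k.
Proof. by apply: laurent_ext => -[n|n]; rewrite lcoef_lser //= coef1. Qed.

Lemma lpolyB (p q : {poly k}) : lpoly (p - q) = lpoly p - lpoly q.
Proof. by rewrite lpolyD -scaleN1r lpolyZ scaleN1r. Qed.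

Lemma lpolyX : lpoly 'X = lX k.
Proof. by apply: laurent_ext => -[n|n]; rewrite !lcoef_lser //= coefX. Qed.

HB.instance Definition _ := GRing.isZmodMorphism.Build _ _ (@lpoly k) lpolyB.
HB.instance Definition _ := GRing.isMonoidMorphism.Build _ _ (@lpoly k) (lpoly1, lpolyM).

Lemma ord_lpoly (p : {poly k}) : ord_ge 0 (lpoly p).
Proof. exact: ord_lser. Qed.

Lemma lpoly_inj : injective (@lpoly k).
Proof.
by move=> p q pq; apply/polyP => i; have := congr1 (fun f : laurent k => f i%:Z) pq.
Qed.

Lemma lpoly_truncate f (N : nat) : ord_ge 0 f ->
  exists p : {poly k}, ord_ge N%:Z (f - lpoly p).
Proof.
move=> f0; exists (\poly_(i < N) f i%:Z) => -[n|n] nN.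
  by rewrite lcoefB lcoef_lser /= coef_poly ifT ?subrr //; lia.
by rewrite lcoefB lcoef_lser /= f0 // subrr.
Qed.

Lemma lderivD f g : lderiv (f + g) = lderiv f + lderiv g.
Proof. by apply: laurent_ext => n; rewrite lcoefD !lcoef_lderiv lcoefD mulrzDl. Qed.

Lemma lderivZ c f : lderiv (c *: f) = c *: lderiv f.
Proof. by apply: laurent_ext => n; rewrite lcoefZ !lcoef_lderiv lcoefZ mulrzAr. Qed.

Lemma lderivM f g : lderiv (f * g) = f * lderiv g + g * lderiv f.
Proof.
have [[a fa] [b gb]] := (laurentP f, laurentP g).
have ord_lderiv (h : laurent k) m : below m h -> below (m - 1) (lderiv h).
  by move=> hm n; rewrite ltrBrDr => nm; rewrite lcoef_lderiv hm ?mul0rz.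
have [fa' gb'] := (ord_lderiv _ _ fa, ord_lderiv _ _ gb).
apply: laurent_ext => n; rewrite lcoefD lcoef_lderiv [g * _]mulrC.
have [nab|abn] := ltP n (a + b - 1).
  rewrite (ord_geM fa gb) ?(ord_geM fa gb') ?(ord_geM fa' gb) ?mul0rz ?addr0 //; lia.
have [j nj] := int_split abn.
have -> : n + 1 = a + b + j%:Z by lia.
rewrite -[(f * g) _]/(lmul_coef _ _ _) (lmul_coefE _ fa gb).
have {1}-> : n = a + (b - 1) + j%:Z by lia.
rewrite -[(f * _) _]/(lmul_coef _ _ _) (lmul_coefE _ fa gb').
have -> : n = a - 1 + b + j%:Z by lia.
rewrite -[(lderiv f * _) _]/(lmul_coef _ _ _) (lmul_coefE _ fa' gb).
rewrite -mulrzl mulr_sumr -big_split /=; apply: eq_bigr => i _; have ij := ltn_ord i.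
have -> : a - 1 + i%:Z + 1 = a + i%:Z by lia.
have -> : b - 1 + (j - i)%N%:Z + 1 = b + (j - i)%N%:Z by lia.
by rewrite mulrzl mulrzAr mulrzAl -mulrzDr; congr (_ *~ _); lia.
Qed.

Lemma ord_lderiv m f : ord_ge m f -> ord_ge (m - 1) (lderiv f).
Proof. by move=> fm n; rewrite ltrBrDr => nm; rewrite lcoef_lderiv fm ?mul0rz. Qed.

Lemma ord_lderiv0 f : ord_ge 0 f -> ord_ge 0 (lderiv f).
Proof.
move=> f0 n n0; rewrite lcoef_lderiv; have [->|n1] := eqVneq n (- 1).
  by rewrite addNr mulr0z.
by rewrite f0 ?mul0rz //; lia.
Qed.

Lemma lderiv_lX : lderiv (lX k) = 1.
Proof.
apply: laurent_ext => n; rewrite lcoef_lderiv lX_mon -lmon0 !lcoef_lmon.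
by have [->|n0] := eqVneq n 0; [rewrite add0r eqxx | rewrite (_ : _ == _ = false) ?mul0rz //; lia].
Qed.

Lemma lderiv1 : lderiv 1 = 0 :> laurent k.
Proof. by apply: (addrI (lderiv 1)); rewrite addr0 -{3}[1]mulr1 lderivM !mul1r. Qed.

Lemma lderivN1 f : lderiv f (- 1) = 0.
Proof. by rewrite lcoef_lderiv addNr mulr0z. Qed.

Lemma lderivB f g : lderiv (f - g) = lderiv f - lderiv g.
Proof. by rewrite lderivD -[- g]scaleN1r lderivZ scaleN1r. Qed.

Lemma lderiv_lpoly (p : {poly k}) : lderiv (lpoly p) = lpoly p^`().
Proof.
apply: laurent_ext => -[n|n]; rewrite lcoef_lderiv !lcoef_lser.
  by rewrite (_ : Posz n + 1 = n.+1%:Z) ?[LHS]/= ?[RHS]/= ?coef_deriv -?pmulrn //; lia.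
case: n => [|n]; first by rewrite (_ : Negz 0 + 1 = 0) ?mulr0z.
by rewrite (_ : Negz n.+1 + 1 = Negz n) ?mul0rz //; lia.
Qed.

Definition lint : {pred laurent k} := fun f => `[< ord_ge 0 f >].

Lemma lintP f : reflect (ord_ge 0 f) (f \in lint).
Proof. exact: asboolP. Qed.

Fact lint_subring : subring_closed lint.
Proof.
split=> [|f g /lintP f0 /lintP g0|f g /lintP f0 /lintP g0]; apply/lintP.
- exact: ord_ge1.
- exact: ord_geB.
- by have := ord_geM f0 g0; rewrite addr0.
Qed.
HB.instance Definition _ := GRing.isSubringClosed.Build (laurent k) lint lint_subring.

End LaurentField.

(** * Automorphisms of k((t)) *)

Section MonicDivision.
Variables (R : comNzRingType) (S : subringClosed R).

Lemma polyOver_monic_divide (f q : {poly R}) :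
    f \is monic -> f \is a polyOver S -> q \is a polyOver S ->
  exists s t, [/\ s \is a polyOver S, t \is a polyOver S, (size t < size f)%N
    & q = s * f + t].
Proof.
move=> fm fS; have f0 := monic_neq0 fm; have sf : (0 < size f)%N by rewrite size_poly_gt0.
elim/poly_ind: q => [_|q c IH qcS].
  by exists 0, 0; rewrite !rpred0 size_poly0 mul0r addr0.
have qS : q \is a polyOver S.
  by apply/polyOverP => i; move/polyOverP/(_ i.+1): qcS; rewrite coefD coefMX coefC addr0.
have cS : c \in S by move/polyOverP/(_ 0%N): qcS; rewrite coefD coefMX coefC add0r.
have [s [t [sS tS st ->]]] := IH qS.
pose t1 := t * 'X + c%:P; have t1S : t1 \is a polyOver S.
  by rewrite rpredD ?polyOverC // rpredM // polyOverX.
have st1 : (size t1 <= size f)%N.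
  rewrite size_MXaddC; case: ifP => // _; exact: st.
pose b := t1`_(size f).-1; have bS : b \in S by move/polyOverP: t1S; apply.
exists (s * 'X + b%:P), (t1 - b%:P * f).
split; first by rewrite rpredD ?polyOverC // rpredM // polyOverX.
- by rewrite rpredB // rpredM // polyOverC.
- rewrite -[X in (_ < X)%N](prednK sf) ltnS; apply/leq_sizeP => j.
  rewrite leq_eqVlt => /predU1P[<-|fj].
    by rewrite coefB coefCM -/(lead_coef f) (monicP fm) mulr1 subrr.
  rewrite coefB coefCM !nth_default ?mulr0 ?subr0 //; last by rewrite (leq_trans st1) // -(prednK sf).
  by rewrite -(prednK sf).
- by rewrite /t1; ring.
Qed.

End MonicDivision.

Lemma lpoly_horner (k : fieldType) (p : {poly k}) :
  lpoly p = (map_poly (in_alg (laurent k)) p).[lX k].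
Proof.
elim/poly_ind: p => [|p c IH]; first by rewrite rmorph0 map_poly0 horner0.
rewrite rmorphD rmorphM /= lpolyX IH rmorphD rmorphM /= map_polyX map_polyC /=.
by rewrite hornerMXaddC -alg_polyC lpolyZ lpoly1.
Qed.

Section LaurentAutomorphisms.
Variables (k : fieldType) (gT : finGroupType) (D : {group gT}).
Variable theta : gT -> {rmorphism laurent k -> laurent k}.
Hypothesis thetaZ : forall g c w, theta g (c *: w) = c *: theta g w.
Hypothesis theta1 : forall w, theta 1%g w = w.
Hypothesis thetaM : {in D &, forall g h w, theta (g * h)%g w = theta g (theta h w)}.
Hypothesis theta_ord : forall g m w, g \in D -> ord_ge m w -> ord_ge m (theta g w).
Hypothesis theta_inj : forall g, g \in D -> theta g (lX k) = lX k -> g = 1%g.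
Local Notation t := (lX k).
Local Notation node g := (theta g t).

Let thetaK g w : g \in D -> theta g^-1%g (theta g w) = w.
Proof. by move=> gD; rewrite -thetaM ?groupV // mulVg theta1. Qed.

Lemma theta_ordE g m w : g \in D -> ord_ge m (theta g w) <-> ord_ge m w.
Proof.
move=> gD; split; last exact: theta_ord.
by move=> /(theta_ord (groupVr gD)); rewrite thetaK.
Qed.

Lemma theta_lead g m w : g \in D -> ord_ge m w -> w m != 0 -> theta g w m != 0.
Proof.
move=> gD wm; apply: contraNneq => gw0; apply/eqP.
have : ord_ge (m + 1) (theta g w) by apply: ord_geS => //; apply: theta_ord.
by move/(theta_ordE _ _ gD); apply; lia.
Qed.

Lemma theta_lpoly g p : theta g (lpoly p) = (map_poly (in_alg (laurent k)) p).[node g].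
Proof.
rewrite lpoly_horner -horner_map /= -map_poly_comp; congr (_.[_]).
by apply: eq_map_poly => c /=; rewrite thetaZ rmorph1.
Qed.

Fact ram_index_subproof g :
  exists m : nat, g \in D -> g != 1%g -> ord_ge m%:Z (node g - t) /\ (node g - t) m%:Z != 0.
Proof.
have [gD|] := boolP (g \in D); last by exists 0%N.
have [|g1] := eqVneq g 1%g; first by exists 0%N.
have : node g - t != 0 by rewrite subr_eq0; apply: contra g1 => /eqP/theta_inj ->.
case/laurent_lead => m gm gm0; exists `|m|%N => _ _.
suff -> : `|m|%N%:Z = m by [].
have [//|m0] := lerP 0 m; first by lia.
have t0 : ord_ge 0 t by rewrite lX_mon; apply: ord_ge_le (ord_lmon 1).
by case/eqP: gm0; apply: (ord_geB (theta_ord gD t0) t0).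
Qed.

Definition ram_index g : nat := sval (cid (ram_index_subproof g)).

Lemma ram_indexP g : g \in D -> g != 1%g ->
  ord_ge (ram_index g)%:Z (node g - t) /\ (node g - t) (ram_index g)%:Z != 0.
Proof. by rewrite /ram_index; case: cid => m /=; apply. Qed.

Lemma ram_index_le g (m : nat) : g \in D -> g != 1%g ->
  ord_ge m%:Z (node g - t) <-> (m <= ram_index g)%N.
Proof.
move=> gD /(ram_indexP gD)[gm gm0]; split=> [gm'|mg]; last first.
  by apply: ord_ge_le gm; lia.
by rewrite leqNgt; apply: contraNN gm0 => mg; apply/eqP/gm'; lia.
Qed.

Definition diff_exp : nat := \sum_(g in D | g != 1%g) ram_index g.

Lemma node_neq g h : g \in D -> h \in D -> g != h -> node g != node h.
Proof.
move=> gD hD; apply: contraNneq => gh; apply/eqP.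
have : node (g^-1 * h)%g = t by rewrite thetaM ?groupV // -gh thetaK.
by move/theta_inj; rewrite groupM ?groupV // => /(_ isT) /(congr1 (mulg g));
  rewrite mulKVg mulg1.
Qed.

Definition node_diff g := \prod_(h in D | h != g) (node g - node h).

Lemma node_diff_neq0 g : g \in D -> node_diff g != 0.
Proof.
move=> gD; apply/prodf_neq0 => h /andP[hD hg]; rewrite subr_eq0.
by apply: node_neq => //; rewrite eq_sym.
Qed.

Lemma node_diffE g : g \in D -> node_diff g = theta g (node_diff 1%g).
Proof.
move=> gD; rewrite /node_diff rmorph_prod (reindex_inj (mulgI g)) /=.
apply: eq_big => [h|h /andP[]]; first by rewrite groupMl // -{2}[g]mulg1 (inj_eq (mulgI g)).
by rewrite groupMl // => hD _; rewrite rmorphB /= theta1 thetaM.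
Qed.

Lemma ord_node_diff1 : ord_ge diff_exp%:Z (node_diff 1%g) /\
  node_diff 1%g diff_exp%:Z != 0.
Proof.
rewrite /node_diff /diff_exp; split.
  apply: ord_ge_prod => h /andP[hD h1]; have [h0 _] := ram_indexP hD h1.
  by rewrite theta1 -opprB; apply: ord_geN.
rewrite lcoef_prod_lead => [|h /andP[hD h1]]; last first.
  by have [h0 _] := ram_indexP hD h1; rewrite theta1 -opprB; apply: ord_geN.
apply/prodf_neq0 => h /andP[hD h1]; have [_ h0] := ram_indexP hD h1.
by rewrite theta1 -opprB lcoefN oppr_eq0.
Qed.

Lemma ord_node_diffV g : g \in D -> ord_ge (- diff_exp%:Z) (node_diff g)^-1.
Proof.
move=> gD; have [d0 d1] := ord_node_diff1; rewrite node_diffE //.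
by apply: ord_geV; [apply: theta_ord | apply: theta_lead].
Qed.

Definition node_poly g : {poly laurent k} := \prod_(h in D | h != g) ('X - (node h)%:P).

Lemma size_node_poly g : g \in D -> size (node_poly g) = #|D|.
Proof.
move=> gD; rewrite /node_poly -big_filter size_prod_XsubC size_filter -sum1_count.
by rewrite -sum1_card [RHS](bigD1 g) //= add1n.
Qed.

Lemma node_poly_monic g : node_poly g \is monic.
Proof. exact: monic_prod_XsubC. Qed.

Lemma node_poly_over g : node_poly g \is a polyOver (@lint k).
Proof.
apply: rpred_prod => h /andP[hD _]; rewrite polyOverXsubC; apply/lintP.
by apply: theta_ord => //; rewrite lX_mon; apply: ord_ge_le (ord_lmon 1).
Qed.

Lemma node_poly_horner g h : g \in D -> h \in D ->
  (node_poly g).[node h] = node_diff g *+ (h == g).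
Proof.
move=> gD hD; rewrite /node_poly horner_prod; have [->|hg] := eqVneq h g.
  by apply: eq_bigr => h' _; rewrite !hornerE.
by rewrite (bigD1 h) /= ?hD ?hg // !hornerE subrr mul0r.
Qed.

Lemma node_interpolation (q : {poly laurent k}) : (size q <= #|D|)%N ->
  q = \sum_(g in D) (q.[node g] / node_diff g) *: node_poly g.
Proof.
move=> sq; apply/eqP; rewrite -subr_eq0; apply/eqP.
pose s := [seq node g | g <- enum D].
apply: (@roots_geq_poly_eq0 _ _ s).
- apply/allP => _ /mapP[h hD ->]; rewrite mem_enum in hD.
  rewrite /root hornerD hornerN horner_sum (bigD1 h) //= big1 ?addr0.
    by rewrite hornerZ node_poly_horner // eqxx mulr1n divfK ?node_diff_neq0 // subrr.
  by move=> g /andP[gD gh]; rewrite hornerZ node_poly_horner // eq_sym (negPf gh) mulr0.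
- rewrite map_inj_in_uniq ?enum_uniq // => g h; rewrite !mem_enum => gD hD.
  by move=> gh; apply/eqP; apply: contraLR (introT eqP gh) => gnh; apply: node_neq.
- rewrite size_map -cardE; apply: leq_trans (size_polyD _ _) _.
  rewrite geq_max sq size_polyN; apply: leq_trans (size_sum _ _ _) _; apply/bigmax_leqP => g gD.
  by apply: leq_trans (size_scale_leq _ _) _; rewrite size_node_poly.
Qed.

Definition min_poly_t : {poly laurent k} := \prod_(g in D) ('X - (node g)%:P).

Lemma min_poly_t_root g : g \in D -> min_poly_t.[node g] = 0.
Proof. by move=> gD; rewrite /min_poly_t horner_prod (bigD1 g) //= !hornerE subrr mul0r. Qed.

Lemma min_poly_tE : min_poly_t = ('X - t%:P) * node_poly 1%g.
Proof. by rewrite /min_poly_t (bigD1 1%g) ?group1 //= theta1. Qed.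

Lemma min_poly_t_divide (q : {poly laurent k}) : q \is a polyOver (@lint k) ->
  exists s u, [/\ s \is a polyOver (@lint k), u \is a polyOver (@lint k),
    (size u <= #|D|)%N & q = s * min_poly_t + u].
Proof.
have fm : min_poly_t \is monic by apply: monic_prod_XsubC.
have fo : min_poly_t \is a polyOver (@lint k).
  rewrite min_poly_tE rpredM ?node_poly_over // polyOverXsubC; apply/lintP.
  by rewrite lX_mon; apply: ord_ge_le (ord_lmon 1).
have sf : size min_poly_t = #|D|.+1.
  by rewrite min_poly_tE size_Mmonic ?polyXsubC_eq0 ?node_poly_monic // size_XsubC
    size_node_poly.
by move=> /(polyOver_monic_divide fm fo)[s [u [? ? su ?]]]; exists s, u; split=> //;
  rewrite sf in su.
Qed.

Lemma const_poly_over (p : {poly k}) :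
  map_poly (in_alg (laurent k)) p \is a polyOver (@lint k).
Proof.
apply/polyOverP => i; rewrite coef_map /=; apply/lintP.
by apply: ord_geZ; apply: ord_ge1.
Qed.

Lemma ord_horner (q : {poly laurent k}) m w : (forall i, ord_ge m q`_i) -> ord_ge 0 w ->
  ord_ge m q.[w].
Proof.
move=> qm w0; rewrite horner_coef; apply: ord_ge_sum => i _.
by have := ord_geM (qm i) (ord_geX (n := i) w0); rewrite mul0r addr0.
Qed.

Lemma ord_t0 : ord_ge 0 t.
Proof. by rewrite lX_mon; apply: ord_ge_le (ord_lmon 1). Qed.

(* Modulo the minimal polynomial, sum_g q(g t) / f'(g t) is the coefficient of
   degree #|D| - 1 of the Lagrange interpolation of q. *)
Lemma ord_theta_trace u : ord_ge (- diff_exp%:Z) u ->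
  ord_ge 0 (\sum_(g in D) theta g u).
Proof.
move=> ud; have [d0 d1] := ord_node_diff1.
have w0 : ord_ge 0 (u * node_diff 1%g) by have := ord_geM ud d0; rewrite addNr.
have [p pd] := lpoly_truncate diff_exp w0; set w := _ - _ in pd.
pose P := map_poly (in_alg (laurent k)) p.
have [s [R [sS RS sR PE]]] := min_poly_t_divide (const_poly_over p).
have uE g : g \in D -> theta g u = R.[node g] / node_diff g + theta g w / node_diff g.
  move=> gD; have := rmorphM (theta g) u (node_diff 1%g); rewrite -node_diffE // => uE.
  rewrite -mulrDl -[LHS](mulfK (node_diff_neq0 gD)) -uE; congr (_ / _).
  rewrite -[u * _](subrK (lpoly p)) -/w rmorphD addrC; congr (_ + _).
  by rewrite theta_lpoly PE hornerD hornerM min_poly_t_root // mulr0 add0r.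
rewrite (eq_bigr _ uE) big_split /=; apply: ord_geD; last first.
  apply: ord_ge_sum => g gD.
  by have := ord_geM (theta_ord gD pd) (ord_node_diffV gD); rewrite subrr.
have -> : \sum_(g in D) R.[node g] / node_diff g = R`_(#|D|.-1).
  rewrite {2}(node_interpolation sR) coef_sum; apply: eq_bigr => g gD.
  rewrite coefZ -(size_node_poly gD) -/(lead_coef _) (monicP (node_poly_monic g)).
  by rewrite mulr1.
by apply/lintP; move/polyOverP: RS; apply.
Qed.

Lemma ord_node_interp g i : g \in D ->
  ord_ge (- diff_exp%:Z) ((node_diff g)^-1 *: node_poly g)`_i.
Proof.
move=> gD; rewrite coefZ; have /polyOverP/(_ i)/lintP := node_poly_over g.
by move=> /(ord_geM (ord_node_diffV gD)); rewrite addr0.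
Qed.

(* The expansion of x in t has all g t as solutions of x(T) = x(t), so that
   the minimal polynomial of t divides x(T) - x(t). *)
Lemma ord_lderiv_fixed x : ord_ge 0 x -> (forall g, g \in D -> theta g x = x) ->
  ord_ge diff_exp%:Z (lderiv x).
Proof.
move=> x0 xD; have [d0 _] := ord_node_diff1.
set d := diff_exp in d0 *.
have [p pd] := lpoly_truncate (d + d + 1)%N x0; set w := _ - _ in pd.
have xE : x = lpoly p + w by rewrite addrC subrK.
pose P := map_poly (in_alg (laurent k)) p.
have QS : P - (P.[t])%:P \is a polyOver (@lint k).
  rewrite rpredB ?const_poly_over // polyOverC; apply/lintP/ord_horner; last exact: ord_t0.
  by move=> i; have /polyOverP/(_ i)/lintP := const_poly_over p.
have [s [R [sS RS sR PE]]] := min_poly_t_divide QS.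
have Rg g : g \in D -> ord_ge (d + d + 1)%N%:Z R.[node g].
  move=> gD; have : (P - (P.[t])%:P).[node g] = w - theta g w.
    rewrite hornerD hornerN hornerC -theta_lpoly -lpoly_horner.
    have E : theta g (lpoly p) + theta g w = lpoly p + w by rewrite -rmorphD -xE xD.
    have -> : theta g (lpoly p) = lpoly p + w - theta g w by rewrite -E addrK.
    by rewrite addrAC [lpoly p + w]addrC addrK.
  rewrite PE hornerD hornerM min_poly_t_root // mulr0 add0r => ->.
  by apply: ord_geB => //; apply: theta_ord.
rewrite xE lderivD; apply: ord_geD; last by apply: ord_ge_le (ord_lderiv pd); lia.
rewrite lderiv_lpoly lpoly_horner -deriv_map.
have -> : P^`() = s^`() * min_poly_t + s * min_poly_t^`() + R^`().
  by rewrite -derivM -derivD -PE derivB derivC subr0.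
have ft : min_poly_t.[t] = 0 by rewrite -[t]theta1 min_poly_t_root ?group1.
have ft' : min_poly_t^`().[t] = node_diff 1%g.
  rewrite min_poly_tE derivM derivXsubC mul1r !hornerE subrr mul0r addr0.
  by rewrite -[t]theta1 node_poly_horner ?group1 // eqxx.
rewrite !hornerE ft mulr0 add0r ft'; apply: ord_geD.
  rewrite -[d%:Z]add0r; apply: ord_geM => //; apply: ord_horner ord_t0.
  by move=> i; move/polyOverP/(_ i)/lintP: sS.
have -> : R^`() = \sum_(g in D) R.[node g] *: ((node_diff g)^-1 *: node_poly g)^`().
  rewrite {1}(node_interpolation sR) raddf_sum; apply: eq_bigr => g _ /=.
  by rewrite -scalerA derivZ.
rewrite horner_sum; apply: ord_ge_sum => g gD; rewrite hornerZ.
have : ord_ge (- d%:Z) ((node_diff g)^-1 *: node_poly g)^`().[t].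
  apply: ord_horner ord_t0 => i; rewrite coef_deriv -scaler_nat; apply: ord_geZ.
  exact: ord_node_interp.
by move/(ord_geM (Rg g gD)); apply: ord_ge_le; lia.
Qed.

Lemma theta_dual_basis : exists v : 'I_#|D| -> laurent k,
  (forall j, ord_ge (- diff_exp%:Z) (v j)) /\
  forall g, g \in D -> \sum_(j < #|D|) t ^+ j * theta g (v j) = (g == 1%g)%:R.
Proof.
exists (fun j => ((node_diff 1%g)^-1 *: node_poly 1%g)`_j); split=> [j|g gD].
  exact: ord_node_interp.
have mE : map_poly (theta g) (node_poly 1%g) = node_poly g.
  rewrite /node_poly rmorph_prod [RHS](reindex_inj (mulgI g)) /=.
  apply: eq_big => [h|h /andP[hD _]].
    by rewrite groupMl // -{2}[g]mulg1 (inj_eq (mulgI g)).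
  by rewrite rmorphB /= map_polyX map_polyC /= thetaM.
have -> : \sum_(j < #|D|) t ^+ j * theta g ((node_diff 1%g)^-1 *: node_poly 1%g)`_j
    = ((node_diff g)^-1 *: node_poly g).[t].
  rewrite hornerZ (@horner_coef_wide _ #|D|) ?size_node_poly // mulr_sumr.
  apply: eq_bigr => j _; rewrite -mE coef_map /= coefZ rmorphM fmorphV /= -node_diffE //.
  by rewrite mulrCA [t ^+ j * _]mulrC.
rewrite hornerZ -{1}[t]theta1 node_poly_horner ?group1 //.
rewrite [in LHS]eq_sym; case: eqP => _; last by rewrite mulr0.
by rewrite mulVf // node_diff_neq0.
Qed.

Lemma ord_node_norm : ord_ge #|D|%:Z (\prod_(g in D) node g) /\
  (\prod_(g in D) node g) #|D|%:Z != 0.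
Proof.
have n1 g : g \in D -> ord_ge 1 (node g) /\ node g 1 != 0.
  move=> gD; have t1 : ord_ge 1 t by rewrite lX_mon; apply: ord_lmon.
  split; first exact: theta_ord.
  by apply: theta_lead => //; rewrite lX_mon lcoef_lmon oner_eq0.
rewrite -sum1_card; split; first by apply: ord_ge_prod => g /n1[].
rewrite lcoef_prod_lead => [|g /n1[]//].
by apply/prodf_neq0 => g /n1[].
Qed.

End LaurentAutomorphisms.

(** * Components and ramification *)

Lemma integral_closure_morph (S S' : comPzRingType) (phi : {rmorphism S -> S'})
    (A : set S) (A' : set S') u :
    (forall a, A a -> A' (phi a)) -> integral_closure A u ->
  integral_closure A' (phi u).
Proof.
move=> AA' [n [a [aA au]]]; exists n, (fun i => phi (a i)); split=> [i|]; first exact: AA'.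
rewrite -[RHS](rmorph0 phi) -au rmorphD rmorphXn rmorph_sum; congr (_ + _).
by apply: eq_bigr => i _; rewrite rmorphM rmorphXn.
Qed.

Lemma integral_closure_self (S : comPzRingType) (A : set S) u :
  subring_set A -> A u -> integral_closure A u.
Proof.
move=> Ar Au; exists 1%N, (fun=> - u); split=> [_|]; first exact: subring_setN.
by rewrite expr1 big_ord1 expr0 mulr1 subrr.
Qed.

Section LocalComponents.
Variables (k : fieldType) (r : nat).
Local Notation V := (lprod k r).
Implicit Types (f h : V) (i j : 'I_r.+1) (w : laurent k) (m : int).

Lemma lprod_sumE (I : Type) (s : seq I) (P : pred I) (F : I -> V) i :
  (\sum_(a <- s | P a) F a) i = \sum_(a <- s | P a) F a i.
Proof. by elim/big_rec2: _ => // a x y _ <-. Qed.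

Lemma lprod_prodE (I : Type) (s : seq I) (P : pred I) (F : I -> V) i :
  (\prod_(a <- s | P a) F a) i = \prod_(a <- s | P a) F a i.
Proof. by elim/big_rec2: _ => // a x y _ <-. Qed.

Lemma lprodXE f n i : (f ^+ n) i = f i ^+ n.
Proof. by elim: n => [|n IH]; rewrite ?expr0 // !exprS -IH. Qed.

Definition comp i w : V := fun j => if j == i then w else 0.
Definition diag w : V := fun=> w.
Local Notation idem i := (comp i 1).

Lemma compE i w : comp i w i = w.
Proof. by rewrite /comp eqxx. Qed.

Lemma comp_mul f i w : f * comp i w = comp i (f i * w).
Proof.
apply/funext => j; rewrite -[LHS]/(f j * comp i w j) /comp.
by case: eqP => [->//|_]; rewrite mulr0.
Qed.

Lemma comp_sum f : \sum_i comp i (f i) = f.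
Proof.
apply/funext => j; rewrite lprod_sumE (bigD1 j) //= compE big1 ?addr0 // => i ij.
by rewrite /comp eq_sym (negPf ij).
Qed.

Lemma idem_sum : \sum_i idem i = 1 :> V.
Proof. exact: comp_sum 1. Qed.

Lemma mul_idem f : f = \sum_i f * idem i.
Proof. by rewrite -mulr_sumr idem_sum mulr1. Qed.

Lemma diag_is_zmod_morphism : zmod_morphism diag. Proof. by []. Qed.
Lemma diag_is_monoid_morphism : monoid_morphism diag. Proof. by []. Qed.
HB.instance Definition _ :=
  GRing.isZmodMorphism.Build (laurent k) V diag diag_is_zmod_morphism.
HB.instance Definition _ :=
  GRing.isMonoidMorphism.Build (laurent k) V diag diag_is_monoid_morphism.

Lemma lprod_scalerAl (c : k) f h : c *: (f * h) = (c *: f) * h.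
Proof. by apply/funext => i; apply: scalerAl. Qed.

Lemma lprod_scalerAr (c : k) f h : c *: (f * h) = f * (c *: h).
Proof. by apply/funext => i; apply: scalerAr. Qed.

Lemma diagZ c w : diag (c *: w) = c *: diag w. Proof. by []. Qed.

Lemma comp_diag i w : comp i w = idem i * diag w.
Proof. by rewrite mulrC comp_mul mulr1. Qed.

Lemma idemM i j : idem i * idem j = if i == j then idem i else 0 :> V.
Proof.
rewrite comp_mul mulr1 /comp; apply/funext => l.
by have [->|ij] := eqVneq i j; case: eqP.
Qed.

Lemma lprod_geD m f h : lprod_ge m f -> lprod_ge m h -> lprod_ge m (f + h).
Proof. by move=> fm hm i; apply: ord_geD. Qed.
Lemma lprod_geN m f : lprod_ge m f -> lprod_ge m (- f).
Proof. by move=> fm i; apply: ord_geN. Qed.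
Lemma lprod_geB m f h : lprod_ge m f -> lprod_ge m h -> lprod_ge m (f - h).
Proof. by move=> fm hm i; apply: ord_geB. Qed.
Lemma lprod_geZ m c f : lprod_ge m f -> lprod_ge m (c *: f).
Proof. by move=> fm i; apply: ord_geZ. Qed.
Lemma lprod_ge0 m : lprod_ge m (0 : V).
Proof. by move=> i; apply: ord_ge0. Qed.
Lemma lprod_ge1 : lprod_ge 0 (1 : V).
Proof. by move=> i; apply: ord_ge1. Qed.
Lemma lprod_geM a b f h : lprod_ge a f -> lprod_ge b h -> lprod_ge (a + b) (f * h).
Proof. by move=> fm hm i; apply: ord_geM. Qed.
Lemma lprod_ge_le m n f : n <= m -> lprod_ge m f -> lprod_ge n f.
Proof. by move=> nm fm i; apply: ord_ge_le (fm i). Qed.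
Lemma lprod_ge_sum m (I : Type) (s : seq I) (P : pred I) (F : I -> V) :
  (forall a, P a -> lprod_ge m (F a)) -> lprod_ge m (\sum_(a <- s | P a) F a).
Proof. by move=> mF i; rewrite lprod_sumE; apply: ord_ge_sum => a /mF. Qed.
Lemma lprod_ge_comp m i w : ord_ge m w -> lprod_ge m (comp i w).
Proof. by move=> wm j; rewrite /comp; case: eqP => // _; apply: ord_ge0. Qed.
Lemma lprod_ge_diag m w : ord_ge m w -> lprod_ge m (diag w).
Proof. by move=> wm j. Qed.
Lemma lprod_ge_eq0 f : (forall m : nat, lprod_ge m%:Z f) -> f = 0.
Proof. by move=> fm; apply/funext => i; apply: ord_ge_eq0 => m; apply: fm. Qed.

Lemma lprod_geX m f (n : nat) : lprod_ge m f -> lprod_ge (m * n%:Z) (f ^+ n).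
Proof. by move=> fm i; rewrite lprodXE; apply: ord_geX. Qed.

Lemma lprod_ge_diagP m f : lprod_ge m f <-> lprod_ge 0 (diag (lmon k (- m)) * f).
Proof.
by split=> fm i; [apply: (iffLR (@ord_ge_lmonP k m (f i)) (fm i)) |
  apply: (iffRL (@ord_ge_lmonP k m (f i)) (fm i))].
Qed.

Lemma lprod_ge_ex f : exists m : nat, lprod_ge (- m%:Z) f.
Proof.
have [m fm] := choice (fun i => laurentP (f i)).
exists (\sum_i `|m i|)%N => i; apply: ord_ge_le (fm i).
by rewrite (bigD1 i) //=; lia.
Qed.

Lemma lprod_dD f h : lprod_d (f + h) = lprod_d f + lprod_d h.
Proof. by apply/funext => i; apply: lderivD. Qed.
Lemma lprod_dB f h : lprod_d (f - h) = lprod_d f - lprod_d h.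
Proof. by apply/funext => i; apply: lderivB. Qed.
Lemma lprod_dZ c f : lprod_d (c *: f) = c *: lprod_d f.
Proof. by apply/funext => i; apply: lderivZ. Qed.
Lemma lprod_dM f h : lprod_d (f * h) = f * lprod_d h + h * lprod_d f.
Proof. by apply/funext => i; apply: lderivM. Qed.
Lemma lprod_ge_d m f : lprod_ge m f -> lprod_ge (m - 1) (lprod_d f).
Proof. by move=> fm i; apply: ord_lderiv. Qed.
Lemma lprod_ge_d0 f : lprod_ge 0 f -> lprod_ge 0 (lprod_d f).
Proof. by move=> fm i; apply: ord_lderiv0. Qed.
Lemma lprod_d_lX : lprod_d (diag (lX k)) = 1.
Proof. by apply/funext => i; apply: lderiv_lX. Qed.

Lemma derivation_dense_eq0 (S : comPzRingType) (phi : {rmorphism S -> V}) (delta : S -> V)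
    (S0 : set S) (pi : S) (rho : V) (c : int) :
    (forall u v, delta (u + v) = delta u + delta v) ->
    (forall u v, delta (u * v) = phi u * delta v + phi v * delta u) ->
    (forall u, S0 u -> lprod_ge c (delta u)) ->
    lprod_ge 1 (phi pi) -> delta pi = 0 -> phi pi * rho = 1 ->
    (forall (N : nat) u, S0 u -> exists q u',
       [/\ S0 u', delta q = 0 & u = q + pi ^+ N * u']) ->
    (forall u, exists N : nat, S0 (pi ^+ N * u)) ->
  forall u, delta u = 0.
Proof.
move=> dD dM dc pi1 dpi pirho S0dense S0pi u.
have d1 : delta 1 = 0.
  by apply: (addrI (delta 1)); rewrite addr0 -{3}[1]mulr1 dM rmorph1 !mul1r.
have dpiX N : delta (pi ^+ N) = 0.
  by elim: N => [|N IH]; rewrite ?expr0 // exprS dM IH dpi !mulr0 addr0.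
have dS0 v : S0 v -> delta v = 0.
  move=> S0v; apply: lprod_ge_eq0 => m.
  have [q [v' [S0v' dq ->]]] := S0dense (m + `|c|)%N v S0v.
  rewrite dD dq add0r dM dpiX mulr0 addr0 rmorphXn.
  apply: lprod_ge_le (lprod_geM (lprod_geX pi1) (dc _ S0v')).
  by rewrite mul1r; lia.
have [N S0u] := S0pi u.
have := dS0 _ S0u; rewrite dM dpiX mulr0 addr0 rmorphXn => E.
rewrite -[delta u]mul1r -(expr1n _ N) -pirho exprMn mulrAC mulrC.
by rewrite E mulr0.
Qed.

End LocalComponents.

Notation idem i := (comp i 1).
Arguments diag {k} r w.

Section LocalGalois.
Variables (k : fieldType) (gT : finGroupType) (r : nat) (B : local_galois k gT r).
Local Notation V := (lprod k r).
Local Notation act := (loc_act B).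
Local Notation incl := (loc_incl B).
Implicit Types (f h u v : V) (i j : 'I_r.+1) (w : laurent k) (m : int) (g : gT).

Lemma incl_inj : injective incl.
Proof.
move=> a b ab; apply/eqP; rewrite -subr_eq0; apply: contraT => /mulfV E.
have : incl 1 = 0 by rewrite -E rmorphM rmorphB ab subrr mul0r.
rewrite rmorph1 => /(congr1 (fun f : V => f ord0)) E1.
by case/eqP: (oner_neq0 (laurent k)); exact: E1.
Qed.

Lemma act_incl g w : act g (incl w) = incl w.
Proof. by have [_ /(_ (incl w))[+ _] _] := loc_galois B; case=> //; exists w. Qed.

Lemma act_invariant f : (forall g, act g f = f) -> exists w, f = incl w.
Proof.
move=> fG; have [_ /(_ f)[_ H] _] := loc_galois B.
by have [|w _ wf] := H; [split | exists w].
Qed.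

Lemma actZ g (c : k) f : act g (c *: f) = c *: act g f.
Proof.
have E h : c *: h = incl (c *: 1) * h.
  by rewrite loc_inclZ rmorph1; apply/funext => i; rewrite -[RHS]scalerAl mul1r.
by rewrite !E rmorphM /= act_incl.
Qed.

Lemma act_inj g : injective (act g).
Proof. exact: can_inj (ractK act g). Qed.

Lemma tr_incl f : exists w, galois_trace act f = incl w.
Proof. by apply: act_invariant => g; apply: ract_trace. Qed.

Fact loc_perm_subproof g i : exists j, act g (idem i) = idem j.
Proof.
have bool_idem (e : V) : e * e = e -> forall l, e l = 0 \/ e l = 1.
  move=> ee l; have : e l * (e l - 1) = 0.
    by rewrite mulrBr mulr1 -{3}ee subrr.
  by move/eqP; rewrite mulf_eq0 subr_eq0 => /orP[/eqP|/eqP]; [left | right].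
have idem_neq0 l : idem l != 0 :> V.
  by apply/eqP => /(congr1 (fun f : V => f l))/eqP; rewrite compE oner_eq0.
set e := act g (idem i); have ee : e * e = e by rewrite -rmorphM idemM eqxx.
have [j ej] : exists j, e j = 1.
  apply: contrapT => nj; have /eqP := idem_neq0 i; apply.
  apply: (@act_inj g); rewrite rmorph0; apply/funext => l.
  by case: (bool_idem e ee l) => // el; case: nj; exists l.
exists j; set f := act g^-1%g (idem j).
have ff : f * f = f by rewrite -rmorphM idemM eqxx.
have fi : f * idem i = f.
  by rewrite -[idem i](ractK act g) -rmorphM -/e mulrC comp_mul mulr1 ej.
have fE : f = comp i (f i) by rewrite -{1}fi comp_mul mulr1.
have fi1 : f i = 1.
  case: (bool_idem f ff i) => // fi0; have /eqP := idem_neq0 j; case.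
  by rewrite -[idem j](ractKV act g) -/f fE fi0 (_ : comp i 0 = 0) ?rmorph0 //;
    apply/funext => l; rewrite /comp; case: ifP.
by rewrite /e -(ractKV act g (idem j)) -/f fE fi1.
Qed.

End LocalGalois.
Section LocalAction.
Variables (k : fieldType) (gT : finGroupType) (r : nat) (B : local_galois k gT r).
Local Notation V := (lprod k r).
Local Notation act := (loc_act B).
Local Notation incl := (loc_incl B).
Local Notation t := (lX k).
Implicit Types (f u v : V) (i j : 'I_r.+1) (w : laurent k) (m : int) (g h : gT).

Definition loc_perm g i : 'I_r.+1 := sval (cid (loc_perm_subproof B g i)).

Lemma act_idem g i : act g (idem i) = idem (loc_perm g i).
Proof. by rewrite /loc_perm; case: cid. Qed.

Lemma idem_inj : injective (fun i => idem i : V).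
Proof.
move=> i j /(congr1 (fun f : V => f i)); rewrite compE /comp.
by case: eqP => // _ /eqP; rewrite oner_eq0.
Qed.

Lemma loc_perm1 i : loc_perm 1%g i = i.
Proof. by apply: idem_inj; rewrite /= -act_idem ract1. Qed.

Lemma loc_permM g h i : loc_perm (g * h)%g i = loc_perm g (loc_perm h i).
Proof. by apply: idem_inj; rewrite /= -!act_idem ractM. Qed.

Lemma loc_permK g i : loc_perm g^-1%g (loc_perm g i) = i.
Proof. by rewrite -loc_permM mulVg loc_perm1. Qed.

Lemma act_comp g f i : act g (comp i (f i)) = comp (loc_perm g i) (act g f (loc_perm g i)).
Proof.
by rewrite -[f i]mulr1 -comp_mul rmorphM /= act_idem comp_mul mulr1.
Qed.

Lemma act_local g f u i : f i = u i -> act g f (loc_perm g i) = act g u (loc_perm g i).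
Proof. by move=> fh; rewrite -[LHS](compE (loc_perm g i)) -act_comp fh act_comp compE. Qed.

Lemma power_series_subring : subring_set (power_series k).
Proof.
split; [exact: ord_ge1 | exact: ord_geB |].
by move=> a b a0 b0; have := ord_geM a0 b0; rewrite addr0.
Qed.

Lemma incl_subring (A : set (laurent k)) : subring_set A -> subring_set (incl @` A).
Proof.
case=> A1 AB AM; split; first by exists 1; rewrite ?rmorph1.
  by move=> _ _ [a Aa <-] [b Ab <-]; exists (a - b); rewrite ?rmorphB //; apply: AB.
by move=> _ _ [a Aa <-] [b Ab <-]; exists (a * b); rewrite ?rmorphM //; apply: AM.
Qed.

Lemma incl_ge0 w : ord_ge 0 w -> lprod_ge 0 (incl w).
Proof.
move=> w0; rewrite -(loc_integral B); apply: integral_closure_self; last by exists w.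
exact/incl_subring/power_series_subring.
Qed.

Lemma act_ge0 g f : lprod_ge 0 f -> lprod_ge 0 (act g f).
Proof.
rewrite -(loc_integral B); apply: integral_closure_morph => _ [w w0 <-].
by exists w => //; rewrite act_incl.
Qed.

Lemma act_diag_lmon g : lprod_ge 1 (act g (diag r t)).
Proof.
set f := act g (diag r t).
have f0 : lprod_ge 0 f.
  by apply: act_ge0; apply: lprod_ge_diag; rewrite lX_mon; apply: ord_ge_le (ord_lmon 1).
move=> i; apply: (ord_geS (f0 i)); apply: contrapT => /eqP fi0.
pose h := comp i (f i)^-1.
have h0 : lprod_ge 0 h by apply: lprod_ge_comp; have := ord_geV (f0 i) fi0; rewrite oppr0.
have fi : f i != 0 by apply: contraNneq fi0 => ->.
have fh : f * h = idem i by rewrite comp_mul mulfV.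
have := act_idem g^-1%g i; rewrite -fh rmorphM /= /f ractK; set j := loc_perm _ _ => E.
have t1 : lprod_ge 1 (diag r t) by apply: lprod_ge_diag; rewrite lX_mon; apply: ord_lmon.
have := lprod_geM t1 (act_ge0 g^-1%g h0); rewrite E => /(_ j 0 isT).
rewrite compE -[1]lmon0 lcoef_lmon eqxx => /eqP.
by rewrite oner_eq0.
Qed.

Lemma lprod_ge_nat (n : nat) f : lprod_ge n%:Z f ->
  exists2 f0, lprod_ge 0 f0 & f = diag r t ^+ n * f0.
Proof.
move=> fn; exists (diag r (lmon k (- n%:Z)) * f); first exact: (iffLR (lprod_ge_diagP _ _)).
by rewrite -rmorphXn /= lXX mulrA -rmorphM /= lmonM subrr lmon0 rmorph1 mul1r.
Qed.

Lemma act_ge_nat g (n : nat) f : lprod_ge n%:Z f -> lprod_ge n%:Z (act g f).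
Proof.
case/lprod_ge_nat => f0 f00 ->; rewrite rmorphM rmorphXn.
have := lprod_geM (lprod_geX (n := n) (act_diag_lmon g)) (act_ge0 g f00).
by rewrite mul1r addr0.
Qed.

Lemma act_ge g m f : lprod_ge m f -> lprod_ge m (act g f).
Proof.
have [m0|m0] := lerP 0 m.
  by have [n] := int_split m0; rewrite add0r => ->; apply: act_ge_nat.
move=> fm i; set a := act g f i; have [->|] := eqVneq a 0; first exact: ord_ge0.
case/laurent_lead => l al al0; have [ml|lm] := lerP m l; first exact: ord_ge_le al.
have [n nl] : exists n : nat, - l = n%:Z by exists `|l|%N; lia.
have un : lprod_ge n%:Z (comp i (lmon k n%:Z) : V) by apply/lprod_ge_comp/ord_lmon.
have := lprod_geM fm (act_ge_nat g^-1%g un).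
have [n' n'E] : exists n' : nat, m + n%:Z = n'.+1%:Z by exists `|(m + n%:Z - 1)%R|%N; lia.
rewrite n'E => /(act_ge_nat g); rewrite rmorphM /= ractKV comp_mul -/a.
move=> /(_ i 0 isT); rewrite compE mulrC lcoef_lmonM sub0r -nl opprK => /eqP.
by rewrite (negPf al0).
Qed.

Lemma act_ord g m f i : ord_ge m (f i) -> ord_ge m (act g f (loc_perm g i)).
Proof.
move=> fm; rewrite -(compE (loc_perm g i) (act g f _)) -act_comp.
exact/act_ge/lprod_ge_comp.
Qed.

Lemma act_lead g m f i : ord_ge m (f i) -> f i m != 0 ->
  act g f (loc_perm g i) m != 0.
Proof.
move=> fm; apply: contraNneq => gf0; apply/eqP.
have : ord_ge (m + 1) (act g f (loc_perm g i)) by apply: ord_geS => //; apply: act_ord.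
by move=> /(act_ord g^-1%g); rewrite ractK loc_permK; apply; lia.
Qed.

Lemma diag_dense (N : nat) f : lprod_ge 0 f ->
  exists (p : 'I_r.+1 -> {poly k}) f',
    lprod_ge 0 f' /\ f = \sum_i idem i * diag r (lpoly (p i)) + diag r t ^+ N * f'.
Proof.
move=> f0; have [p pf] := choice (fun i => lpoly_truncate N (f0 i)).
have E : f - (fun i => lpoly (p i)) = diag r t ^+ N * (diag r (lmon k (- N%:Z)) * (f - (fun i => lpoly (p i)))).
  by rewrite -rmorphXn /= lXX mulrA -rmorphM /= lmonM subrr lmon0 rmorph1 mul1r.
exists p, (diag r (lmon k (- N%:Z)) * (f - (fun i => lpoly (p i)))); split.
  by apply: (iffLR (lprod_ge_diagP _ _)) => i; apply: pf.
rewrite -E (eq_bigr (fun i => comp i (lpoly (p i)))) => [|i _]; last by rewrite -comp_diag.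
by rewrite comp_sum addrC subrK.
Qed.

Lemma diag_poly_ind (P : V -> Prop) : P 1 -> (forall f u, P f -> P u -> P (f + u)) ->
  (forall c f, P f -> P (c *: f)) -> (forall f, P f -> P (f * diag r t)) ->
  forall p, P (diag r (lpoly p)).
Proof.
move=> P1 PD PZ PX; elim/poly_ind => [|p c IH].
  by rewrite !rmorph0 -(scale0r (1 : V)); apply: PZ.
rewrite !rmorphD !rmorphM /= lpolyX; apply: PD; first exact: PX.
by rewrite -alg_polyC lpolyZ lpoly1 diagZ rmorph1; apply: PZ.
Qed.

Lemma diag_t_unit : diag r t * diag r (lmon k (- 1)) = 1.
Proof. by rewrite -rmorphM /= lX_mon lmonM subrr lmon0 rmorph1. Qed.

Lemma derivation_lprod_eq0 (phi : {rmorphism V -> V}) (delta : V -> V) (c : int) :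
    (forall u v, delta (u + v) = delta u + delta v) ->
    (forall u v, delta (u * v) = phi u * delta v + phi v * delta u) ->
    (forall (a : k) u, delta (a *: u) = a *: delta u) ->
    (forall u, lprod_ge 0 u -> lprod_ge c (delta u)) ->
    lprod_ge 1 (phi (diag r t)) -> delta (diag r t) = 0 ->
  forall u, delta u = 0.
Proof.
move=> dD dM dZ dc phit dt.
have d1 : delta 1 = 0.
  by apply: (addrI (delta 1)); rewrite addr0 -{3}[1]mulr1 dM rmorph1 !mul1r.
have d0 : delta 0 = 0 by rewrite -(scale0r (1 : V)) dZ !scale0r.
have didem i : delta (idem i) = 0.
  have := dM (idem i) (idem i); rewrite idemM eqxx => E.
  have : phi (idem i) * delta (idem i) = 0.
    apply: (addrI (phi (idem i) * delta (idem i))); rewrite addr0 -{1}mulrDr -mulr2n.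
    have := congr1 (fun f => phi (idem i) * f) E; rewrite mulrDr !mulrA -rmorphM idemM eqxx.
    by rewrite -mulr2n mulrDr.
  by move=> E0; rewrite E E0 addr0.
apply: (@derivation_dense_eq0 k r V phi delta (lprod_ge 0) (diag r t)
  (phi (diag r (lmon k (- 1)))) c) => //.
- by rewrite -rmorphM diag_t_unit rmorph1.
- move=> N u /(diag_dense N)[p [u' [u'0 uE]]].
  exists (\sum_i idem i * diag r (lpoly (p i))), u'; split => //.
  elim/big_ind: _ => // [a b da db|i _]; first by rewrite dD da db addr0.
  rewrite dM didem mulr0 addr0.
  apply: (diag_poly_ind (P := fun f => phi (idem i) * delta f = 0)).
  + by rewrite d1 mulr0.
  + by move=> f v df dv; rewrite dD mulrDr df dv addr0.
  + by move=> a f df; rewrite dZ -lprod_scalerAr df scaler0.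
  + by move=> f df; rewrite dM dt mulr0 add0r mulrCA df mulr0.
- move=> u; have [N uN] := lprod_ge_ex u; exists N.
  have tN : lprod_ge N%:Z (diag r t ^+ N).
    by rewrite -rmorphXn /= lXX; apply/lprod_ge_diag/ord_lmon.
  by have := lprod_geM tN uN; rewrite subrr.
Qed.

Lemma derivation_incl_eq0 (delta : laurent k -> V) (c : int) :
    (forall w w', delta (w + w') = delta w + delta w') ->
    (forall w w', delta (w * w') = incl w * delta w' + incl w' * delta w) ->
    (forall (a : k) w, delta (a *: w) = a *: delta w) ->
    (forall w, ord_ge 0 w -> lprod_ge c (delta w)) ->
    lprod_ge 1 (incl t) -> delta t = 0 ->
  forall w, delta w = 0.
Proof.
move=> dD dM dZ dc inclt dt.
have d1 : delta 1 = 0.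
  by apply: (addrI (delta 1)); rewrite addr0 -{3}[1]mulr1 dM rmorph1 !mul1r.
apply: (@derivation_dense_eq0 k r (laurent k) incl delta (power_series k) t
  (incl (lmon k (- 1))) c) => //.
- by rewrite -rmorphM lX_mon lmonM subrr lmon0 rmorph1.
- move=> N u u0; have [p pu] := lpoly_truncate N u0.
  exists (lpoly p), (lmon k (- N%:Z) * (u - lpoly p)); split.
  + exact: (iffLR (ord_ge_lmonP _ _)).
  + elim/poly_ind: p {pu} => [|p a IH]; first by rewrite rmorph0 -(scale0r 1) dZ !scale0r.
    rewrite rmorphD rmorphM /= lpolyX dD dM IH dt !mulr0 !add0r.
    by rewrite -alg_polyC lpolyZ lpoly1 dZ d1 scaler0.
  + by rewrite lXX lmonK addrC subrK.
- move=> u; have [m um] := laurentP u; exists `|m|%N; rewrite lXX.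
  by apply: ord_ge_le (ord_geM (ord_lmon _) um); lia.
Qed.

Lemma chain_rule g u : lprod_d (act g u) = act g (lprod_d u) * lprod_d (act g (diag r t)).
Proof.
apply/eqP; rewrite -subr_eq0; apply/eqP; move: u.
apply: (derivation_lprod_eq0 (phi := act g) (c := 0)).
- by move=> u v; rewrite rmorphD !lprod_dD rmorphD mulrDl opprD addrACA.
- move=> u v; rewrite rmorphM !lprod_dM rmorphD !rmorphM /= mulrDl !mulrBr !mulrA.
  by rewrite opprD addrACA.
- by move=> a u; rewrite actZ !lprod_dZ actZ -lprod_scalerAl scalerBr.
- move=> u u0; apply: lprod_geB; first exact/lprod_ge_d0/act_ge.
  rewrite -[0]addr0; apply: lprod_geM; first exact/act_ge/lprod_ge_d0.
  by apply/lprod_ge_d0/(lprod_ge_le _ (act_diag_lmon g)).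
- exact: act_diag_lmon.
- by rewrite lprod_d_lX rmorph1 mul1r subrr.
Qed.

Lemma loc_perm_trans i j : exists g, loc_perm g i = j.
Proof.
pose s : V := \sum_(l in [set loc_perm g i | g in [set: gT]]%SET) idem l.
have sl l : s l = (l \in [set loc_perm g i | g in [set: gT]]%SET)%:R.
  rewrite /s lprod_sumE; case: (boolP (l \in _)) => [ls|nls].
    rewrite (bigD1 l) //= compE big1 ?addr0 // => l' /andP[_ ll'].
    by rewrite /comp eq_sym (negPf ll').
  rewrite big1 // => l' l's; rewrite /comp; case: eqP => // ll'.
  by move: nls; rewrite ll' l's.
have [w sw] : exists w, s = incl w.
  apply: act_invariant => g; rewrite rmorph_sum /=.
  rewrite [RHS](reindex_inj (h := loc_perm g)) /=; last exact: can_inj (loc_permK g).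
  apply: eq_big => [l|l _]; last exact: act_idem.
  apply/imsetP/imsetP => -[h _ lE].
    by exists (g * h)%g; rewrite ?inE // loc_permM lE.
  by exists (g^-1 * h)%g; rewrite ?inE // loc_permM -lE loc_permK.
have ww : w * (w - 1) = 0.
  apply: (@incl_inj _ _ _ B); rewrite rmorphM rmorphB rmorph1 rmorph0 -sw.
  apply/funext => l; rewrite -[LHS]/(s l * (s l - 1)) sl.
  by case: (_ \in _); rewrite ?subrr ?mulr0 ?mul0r.
have si : s i = 1.
  rewrite sl (_ : i \in _) //; apply/imsetP; exists 1%g; rewrite ?inE //.
  by rewrite loc_perm1.
have w1 : w = 1.
  move/eqP: ww; rewrite mulf_eq0 subr_eq0 => /orP[/eqP w0|/eqP//].
  by move/eqP: si; rewrite sw w0 rmorph0 eq_sym oner_eq0.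
have /eqP : s j = 1 by rewrite sw w1 rmorph1.
rewrite sl; case: imsetP => [[g _ ->] _|_]; first by exists g.
by rewrite eq_sym oner_eq0.
Qed.

End LocalAction.

Section Ramification.
Variables (k : fieldType) (gT : finGroupType) (r : nat) (B : local_galois k gT r).
Local Notation V := (lprod k r).
Local Notation act := (loc_act B).
Local Notation t := (lX k).
Local Notation sigma := (loc_perm B).
Implicit Types (f u v : V) (i j : 'I_r.+1) (w : laurent k) (m : int) (g h : gT).

Lemma lprod_ge_t m f : lprod_ge m f -> lprod_ge (m + 1) (f * diag r t).
Proof.
by move=> fm; apply: lprod_geM => //; apply/lprod_ge_diag; rewrite lX_mon; apply: ord_lmon.
Qed.

Lemma ram_groupP i (n : nat) g :
  g \in ram_group B i n <->
  sigma g i = i /\ ord_ge n.+1%:Z ((act g (diag r t) - diag r t) i).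
Proof.
rewrite /ram_group inE; split=> [/asboolP gn|[gi gt]].
  split; last first.
    by apply: gn; apply: lprod_ge_diag; rewrite lX_mon; apply: ord_ge_le (ord_lmon 1).
  have : ((comp (sigma g i) 1 : V) i - (comp i 1 : V) i) 0 = 0.
    by have := gn (idem i) (lprod_ge_comp i (ord_ge1 k)); rewrite act_idem => /(_ 0 isT).
  rewrite compE /comp eq_sym; case: eqP => // _; rewrite sub0r -lmon0 lcoefN lcoef_lmon eqxx.
  by move/eqP; rewrite oppr_eq0 oner_eq0.
have gtN : ord_ge n.+1%:Z (act g (diag r t) i - t) by [].
apply/asboolP => b /(diag_dense n.+1)[p [b' [b'0 ->]]].
pose q := diag r (lpoly (p i)) + diag r t ^+ n.+1 * b'.
have qi : (\sum_i idem i * diag r (lpoly (p i)) + diag r t ^+ n.+1 * b') i = q i.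
  congr (_ + _); rewrite -(eq_bigr _ (fun j _ => comp_diag j (lpoly (p j)))).
  by rewrite (comp_sum (fun j => lpoly (p j))).
have -> : forall f, (act g f - f) i = act g f (sigma g i) - f i by rewrite gi.
rewrite (act_local B g qi) qi gi /q rmorphD.
have -> : forall a b c d : V, (a + b) i - (c + d) i = (a - c) i + (b i - d i).
  by move=> a1 a2 a3 a4; rewrite -[LHS]/(a1 i + a2 i - (a3 i + a4 i)) opprD; exact: addrACA.
have tN : lprod_ge n.+1%:Z (diag r t ^+ n.+1 * b').
  rewrite -rmorphXn /= lXX.
  by have := lprod_geM (lprod_ge_diag (r := r) (ord_lmon n.+1)) b'0; rewrite addr0.
apply: ord_geD; last by apply: ord_geB; [apply: act_ge | apply: tN].
suff [] : ord_ge n.+1%:Z ((act g (diag r (lpoly (p i))) - diag r (lpoly (p i))) i) /\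
  lprod_ge 0 (diag r (lpoly (p i))) by [].
apply: (diag_poly_ind (P := fun f => ord_ge n.+1%:Z ((act g f - f) i) /\ lprod_ge 0 f)).
- by rewrite rmorph1 subrr; split; [apply: ord_ge0 | apply: lprod_ge1].
- move=> f u [fi f0] [ui u0]; split; last exact: lprod_geD.
  by rewrite rmorphD opprD addrACA; apply: ord_geD.
- move=> c f [fi f0]; split; last exact: lprod_geZ.
  by rewrite actZ -scalerBr; apply: ord_geZ.
- move=> f [fi f0]; split; last by apply: lprod_ge_le (lprod_ge_t f0).
  rewrite rmorphM (_ : _ - _ = act g f * (act g (diag r t) - diag r t)
    + (act g f - f) * diag r t); last first.
    by rewrite mulrBr mulrBl addrA subrK.
  apply: ord_geD; first by rewrite -[n.+1%:Z]add0r; apply: ord_geM => //; apply: act_ge.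
  by apply: ord_ge_le (ord_geM fi (ord_t0 k)); lia.
Qed.

End Ramification.
Section Decomposition.
Variables (k : fieldType) (gT : finGroupType) (r : nat) (B : local_galois k gT r).
Local Notation V := (lprod k r).
Local Notation act := (loc_act B).
Local Notation t := (lX k).
Local Notation sigma := (loc_perm B).
Implicit Types (f u v : V) (i j : 'I_r.+1) (w : laurent k) (m : int) (g h : gT).

Definition decomp : {set gT} := finset (fun g => sigma g ord0 == ord0).

Lemma decompP g : reflect (sigma g ord0 = ord0) (g \in decomp).
Proof. by rewrite inE; apply: eqP. Qed.

Fact decomp_group_set : group_set decomp.
Proof.
apply/group_setP; split=> [|g h /decompP g0 /decompP h0]; apply/decompP.
  exact: loc_perm1.
by rewrite loc_permM h0 g0.
Qed.
Definition decomp_group : {group gT} := Group decomp_group_set.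

Lemma ram_group0 : ram_group B ord0 0 = decomp.
Proof.
apply/setP => g; apply/idP/decompP => [/ram_groupP[]//|g0]; apply/ram_groupP; split=> //.
have t1 : lprod_ge 1 (diag r t) by apply: lprod_ge_diag; rewrite lX_mon; apply: ord_lmon.
by apply: (lprod_geB (act_diag_lmon B g) t1).
Qed.

Definition theta g w : laurent k := act g (diag r w) ord0.

Fact theta_is_zmod_morphism g : zmod_morphism (theta g).
Proof. by move=> a b; rewrite /theta !rmorphB. Qed.
Fact theta_is_monoid_morphism g : monoid_morphism (theta g).
Proof. by split=> [|a b]; rewrite /theta ?rmorph1 // !rmorphM. Qed.
HB.instance Definition _ g :=
  GRing.isZmodMorphism.Build _ _ (theta g) (theta_is_zmod_morphism g).
HB.instance Definition _ g :=
  GRing.isMonoidMorphism.Build _ _ (theta g) (theta_is_monoid_morphism g).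
Definition thetaR g : {rmorphism laurent k -> laurent k} := theta g.

Lemma act_theta g f : g \in decomp -> act g f ord0 = theta g (f ord0).
Proof.
move=> /decompP g0; have fE : f ord0 = diag r (f ord0) ord0 by [].
by have := act_local B g fE; rewrite g0.
Qed.

Lemma act_theta0 g f : g \notin decomp -> act g (comp ord0 (f ord0)) ord0 = 0.
Proof.
by rewrite inE act_comp /comp eq_sym => /negPf->.
Qed.

Lemma thetaZ g c w : thetaR g (c *: w) = c *: thetaR g w.
Proof. by rewrite /= /theta diagZ actZ. Qed.

Lemma theta1 w : thetaR 1%g w = w.
Proof. by rewrite /= /theta ract1. Qed.

Lemma thetaM : {in decomp_group &, forall g h w,
  thetaR (g * h)%g w = thetaR g (thetaR h w)}.
Proof.
by move=> g h gD hD w; rewrite /= {1}/theta ractM; apply: act_theta.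
Qed.

Lemma theta_ord g m w : g \in decomp_group -> ord_ge m w -> ord_ge m (thetaR g w).
Proof. by move=> _ wm; apply: (act_ge B g (lprod_ge_diag (r := r) wm)). Qed.

Lemma theta_inj g : g \in decomp_group -> thetaR g t = t -> g = 1%g.
Proof.
move=> gD gt.
have w0 w : ord_ge 0 w -> theta g w = w.
  move=> w0; apply/eqP; rewrite -subr_eq0; apply/eqP/ord_ge_eq0 => -[|n].
    by apply: ord_geB => //; apply: theta_ord.
  have : g \in ram_group B ord0 n.
    apply/ram_groupP; split; first exact/decompP.
    rewrite -[(_ - _) _]/(thetaR g t - t) gt subrr; exact: ord_ge0.
  by rewrite inE => /asboolP/(_ (diag r w) (lprod_ge_diag w0)).
have ww w : theta g w = w.
  have [m wm] := laurentP w.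
  have wN : ord_ge 0 (lmon k `|m|%N * w) by apply: ord_ge_le (ord_geM (ord_lmon _) wm); lia.
  have mN : ord_ge 0 (lmon k `|m|%N) by apply: ord_ge_le (ord_lmon _); lia.
  by have := w0 _ wN; rewrite rmorphM /= (w0 _ mN) => /(mulfI (lmon_neq0 _ _)).
have [_ _ [n [u [v [_ _ uv]]]]] := loc_galois B.
have E1 : \sum_i u i ord0 * v i ord0 = 1.
  have /(congr1 (fun f : V => f ord0)) := uv 1%g; rewrite eqxx lprod_sumE => E.
  apply: etrans E; apply: eq_bigr => i _.
  by rewrite ract1.
have /(congr1 (fun f : V => f ord0)) := uv g; rewrite lprod_sumE.
rewrite (eq_bigr (fun l => u l ord0 * v l ord0)) => [|l _]; last first.
  by rewrite -[LHS]/(u l ord0 * act g (v l) ord0) act_theta // ww.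
rewrite E1; case: eqP => // _ E; by case/eqP: (oner_neq0 (laurent k)).
Qed.

Local Notation D := decomp_group.
Local Notation n := #|decomp_group|.
Definition loc_diff : nat := diff_exp theta_ord theta_inj.
Local Notation d := loc_diff.

Lemma d_primeE : (d_prime B + n = d + 1)%N.
Proof.
pose ri g := ram_index theta_ord theta_inj g.
have riP := ram_index_le theta_ord theta_inj.
have ri1 g : g \in D -> g != 1%g -> (0 < ri g)%N.
  move=> gD g1; apply/(riP _ 1%N gD g1); have := act_diag_lmon B g ord0.
  move=> g1'; apply: ord_geB => //; by rewrite lX_mon; apply: ord_lmon.
pose M := (\sum_(g in D | g != 1%g) ri g)%N.
have cardG (j : nat) : (1 <= j)%N ->
    (#|ram_group B ord0 j| - 1 = \sum_(g in D | g != 1%g) (j < ri g))%N.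
  move=> j1; rewrite -sum1_card (bigD1 1%g) /=; last first.
    by apply/ram_groupP; rewrite loc_perm1 ract1 subrr; split=> //; apply: ord_ge0.
  rewrite addKn -big_mkcondr; apply: eq_bigl => g /=.
  rewrite andbAC; have [->|g1] := eqVneq g 1%g; first by rewrite !andbF.
  rewrite !andbT; apply/idP/andP => [/ram_groupP[/decompP gD gj]|[gD gj]].
    by split=> //; apply/(riP _ _ gD g1).
  by apply/ram_groupP; split; [exact/decompP | apply/(riP _ _ gD g1)].
have -> : d_prime B = (\sum_(1 <= j < M.+1) (#|ram_group B ord0 j| - 1))%N.
  rewrite /d_prime (fsbigE _ _ (iota_uniq 1 M)) //.
  - rewrite /index_iota subn1 /= [LHS]big_seq_cond [RHS]big_seq; apply: eq_bigl => j.
    case: (boolP (j \in iota 1 M)) => //=; rewrite mem_iota => /andP[j1 _].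
    by apply/idP; rewrite in_setE.
  - by move=> j /=; rewrite mem_iota => /andP[].
  - move=> j /= j1 jM; rewrite cardG // big1 // => g gP.
    rewrite (_ : (j < ri g)%N = false) //; apply/negbTE; rewrite -leqNgt.
    apply: (@leq_trans M); first by rewrite /M (bigD1 g) //= leq_addr.
    by move: jM; rewrite mem_iota; lia.
have -> : (\sum_(1 <= j < M.+1) (#|ram_group B ord0 j| - 1) =
    \sum_(1 <= j < M.+1) \sum_(g in D | g != 1%g) (j < ri g))%N.
  by apply: eq_big_nat => j /andP[j1 _]; apply: cardG.
rewrite exchange_big /=.
rewrite (eq_bigr (fun g => ri g - 1)%N) => [|g gP]; last first.
  have riM : (ri g <= M)%N by rewrite /M (bigD1 g) //= leq_addr.
  have g1 : (0 < ri g)%N by case/andP: gP => gD g1; apply: ri1.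
  rewrite (big_cat_nat (n := ri g)) //=; last lia.
  rewrite [X in (_ + X)%N]big_nat_cond [X in (_ + X)%N]big1 ?addn0; last first.
    by move=> j; lia.
  rewrite big_nat_cond (eq_bigr (fun=> 1%N)) -?big_nat_cond ?sum_nat_const_nat ?muln1 //.
  by move=> j; lia.
have nE : n = (\sum_(g in D | g != 1%g) 1).+1.
  by rewrite -sum1_card (bigD1 1%g) ?group1 //= add1n.
rewrite nE addnS -big_split /= addn1; congr _.+1.
by apply: eq_bigr => g /andP[gD g1]; rewrite subnK // ri1.
Qed.

End Decomposition.

Section RamificationIndex.
Variables (k : fieldType) (gT : finGroupType) (r : nat) (B : local_galois k gT r).
Local Notation V := (lprod k r).
Local Notation act := (loc_act B).
Local Notation incl := (loc_incl B).
Local Notation t := (lX k).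
Local Notation D := (decomp_group B).
Local Notation n := #|decomp_group B|.
Local Notation d := (loc_diff B).
Implicit Types (f u v : V) (i j : 'I_r.+1) (w : laurent k) (m : int) (g h : gT).

Lemma incl_t_neq0 i : incl t i != 0.
Proof.
have : incl t * incl (lmon k (- 1)) = 1 by rewrite -rmorphM lX_mon lmonM subrr lmon0 rmorph1.
move/(congr1 (fun f : V => f i)) => E; apply: contraPneq E => E.
by rewrite -[_ i]/(incl t i * _) E mul0r => /esym/eqP; rewrite oner_eq0.
Qed.

(* If x had order 0, then 1/x would be integral over k[[x]]. *)
Fact ram_e_subproof : exists e : nat, (0 < e)%N /\
  forall i, ord_ge e%:Z (incl t i) /\ incl t i e%:Z != 0.
Proof.
have [l xl xl0] := laurent_lead (incl_t_neq0 ord0).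
have x0 : lprod_ge 0 (incl t) by apply: incl_ge0; apply: ord_t0.
have l0 : 0 <= l by rewrite leNgt; apply: contraNN xl0 => /(x0 ord0) ->.
have [e] := int_split l0; rewrite add0r => le; rewrite le in xl xl0.
have xe i : ord_ge e%:Z (incl t i) /\ incl t i e%:Z != 0.
  have [g <-] := loc_perm_trans B ord0 i.
  by rewrite -(act_incl B g t); split; [apply: act_ord | apply: act_lead].
exists e; split=> //; rewrite lt0n; apply/eqP => e0; rewrite e0 in xe.
have y0 : lprod_ge 0 (incl (lmon k (- 1))).
  move=> i; have [xi xi0] := xe i; have := ord_geV xi xi0; rewrite oppr0.
  suff -> : (incl t i)^-1 = incl (lmon k (- 1)) i by [].
  apply: (mulfI (incl_t_neq0 i)); rewrite mulfV ?incl_t_neq0 //.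
  by rewrite -[RHS]/((incl t * incl (lmon k (- 1))) i) -rmorphM lX_mon lmonM subrr lmon0 rmorph1.
move: y0; rewrite -(loc_integral B) => -[N [a [aA E]]].
have aA' l' : exists w, ord_ge 0 w /\ a l' = incl w by have [w w0 <-] := aA l'; exists w.
have [b bP] := choice aA'.
have E' : lmon k (- 1) ^+ N + \sum_(i < N) b i * lmon k (- 1) ^+ i = 0.
  apply: (@incl_inj _ _ _ B); rewrite rmorph0 -[RHS]E rmorphD rmorphXn rmorph_sum.
  congr (_ + _); apply: eq_bigr => i _; rewrite rmorphM rmorphXn /=.
  by have [_ ->] := bP i.
have /(congr1 (fun w => w 0)) : 1 + \sum_(i < N) b i * lmon k (N - i)%N%:Z = 0.
  rewrite -[RHS](mulr0 (lmon k N%:Z)) -[X in _ = _ * X]E' mulrDr lmonX lmonM.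
  rewrite mulN1r subrr lmon0 mulr_sumr; congr (_ + _); apply: eq_bigr => i _.
  rewrite mulrCA lmonX lmonM mulN1r; congr (_ * lmon k _).
  by have := ltn_ord i; lia.
rewrite lcoefD -[1]lmon0 lcoef_lmon eqxx.
have : ord_ge 1 (\sum_(i < N) b i * lmon k (N - i)%N%:Z).
  apply: ord_ge_sum => i _; have [b0 _] := bP i.
  by apply: ord_ge_le (ord_geM b0 (ord_lmon _)); have := ltn_ord i; lia.
by move=> -> //; rewrite addr0 => /eqP; rewrite oner_eq0.
Qed.

Definition ram_e : nat := sval (cid ram_e_subproof).
Local Notation e := ram_e.

Lemma ram_e_gt0 : (0 < e)%N.
Proof. by rewrite /ram_e; case: cid => ? /= []. Qed.

Lemma ram_eP i : ord_ge e%:Z (incl t i) /\ incl t i e%:Z != 0.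
Proof. by rewrite /ram_e; case: cid => ? /= []. Qed.

Lemma incl_t_ge : lprod_ge e%:Z (incl t).
Proof. by move=> i; case: (ram_eP i). Qed.

Lemma incl_lmon_ge m : lprod_ge (e%:Z * m) (incl (lmon k m)).
Proof.
have [m0|m0] := lerP 0 m.
  have [l] := int_split m0; rewrite add0r => ->; rewrite -lXX rmorphXn.
  exact/lprod_geX/incl_t_ge.
have [l ml] : exists l : nat, m = - l%:Z by exists `|m|%N; lia.
move=> i; have -> : incl (lmon k m) i = (incl t i ^+ l)^-1.
  apply: (mulfI (expf_neq0 l (incl_t_neq0 i))); rewrite mulfV ?expf_neq0 ?incl_t_neq0 //.
  rewrite -lprodXE -[LHS]/((incl t ^+ l * incl (lmon k m)) i) -rmorphXn -rmorphM /=.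
  by rewrite lXX ml lmonM subrr lmon0 rmorph1.
have [xe xe0] := ram_eP i; rewrite -exprVn.
by have := ord_geX (n := l) (ord_geV xe xe0); apply: ord_ge_le; rewrite ml; lia.
Qed.

Lemma incl_ge m w : ord_ge m w -> lprod_ge (e%:Z * m) (incl w).
Proof.
move=> wm; rewrite -[w](lmonK m) rmorphM -[e%:Z * m]addr0.
by apply: lprod_geM; [apply: incl_lmon_ge | apply/incl_ge0/(iffLR (ord_ge_lmonP _ _))].
Qed.

Lemma incl_ge_inv m w i : ord_ge (e%:Z * (m - 1) + 1) (incl w i) -> ord_ge m w.
Proof.
move=> wm; have [->|w0] := eqVneq w 0; first exact: ord_ge0.
have [l wl wl0] := laurent_lead w0; have [ml|lm] := lerP m l; first exact: ord_ge_le wl.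
have /(_ i) wV := incl_ge (ord_geV wl wl0).
have := ord_geM wm wV; rewrite -[incl w i * _]/((incl w * incl w^-1) i) -rmorphM mulfV //.
have b : 0 < e%:Z * (m - 1) + 1 + e%:Z * - l by have := ram_e_gt0; nia.
rewrite rmorph1 => /(_ 0 b); rewrite -[(1 : V) i]lmon0 lcoef_lmon eqxx => /eqP.
by rewrite oner_eq0.
Qed.

Lemma ram_e_le : (e <= n)%N.
Proof.
pose c : V := comp ord0 t + (1 - idem ord0).
have [w wE] : exists w, \prod_g act g c = incl w.
  apply: act_invariant => g; rewrite rmorph_prod [RHS](reindex_inj (mulgI g)) /=.
  by apply: eq_bigr => h _; rewrite ractM.
have cE g : act g c ord0 = if g \in D then thetaR B g t else 1.
  rewrite rmorphD rmorphB rmorph1 -[LHS]/(act g (comp ord0 t) ord0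
    + (1 - act g (idem ord0) ord0)).
  have [gD|gD] := boolP (g \in D).
    by rewrite !(act_theta _ gD) !compE rmorph1 subrr addr0.
  by rewrite (act_theta0 (diag r t) gD) (act_theta0 1 gD) subr0 add0r.
have [w1 w2] : ord_ge n%:Z (incl w ord0) /\ incl w ord0 n%:Z != 0.
  have -> : incl w ord0 = \prod_(g in D) thetaR B g t.
    by rewrite -wE lprod_prodE (eq_bigr _ (fun g _ => cE g)) -big_mkcond.
  exact: (ord_node_norm (@theta1 _ _ _ B) (@thetaM _ _ _ B) (@theta_ord _ _ _ B)).
have w0 : ord_ge 1 w.
  by apply: (@incl_ge_inv _ _ ord0); apply: ord_ge_le w1; have := cardG_gt0 D; lia.
have /(_ ord0) we := incl_ge w0.
by rewrite leqNgt; apply: contraNN w2 => ne; apply/eqP/we; lia.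
Qed.

Lemma ord_tr_comp u : ord_ge (- d%:Z) (u ord0) ->
  ord_ge 0 (galois_trace act (comp ord0 (u ord0)) ord0).
Proof.
move=> u0; rewrite /galois_trace lprod_sumE (bigID (mem D)) /=.
rewrite [X in _ + X]big1 ?addr0 => [|g gD]; last exact: act_theta0.
rewrite (eq_bigr (fun g => thetaR B g (u ord0))); last first.
  by move=> g gD; rewrite act_theta // compE.
exact: (ord_theta_trace (@thetaZ _ _ _ B) (@theta1 _ _ _ B) (@thetaM _ _ _ B) u0).
Qed.

Lemma tr_integral u : lprod_ge (- d%:Z) u ->
  exists2 w, ord_ge 0 w & galois_trace act u = incl w.
Proof.
move=> ud; have [w wE] := tr_incl B u; exists w => //.
apply: (@incl_ge_inv _ _ ord0); rewrite -wE.
apply: (@ord_ge_le _ 0); first by have := ram_e_gt0; lia.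
rewrite [u]mul_idem galois_trace_sum lprod_sumE; apply: ord_ge_sum => i _.
have [g gi] := loc_perm_trans B i ord0.
rewrite -(galois_trace_act act g) comp_mul mulr1 act_comp gi.
by apply: ord_tr_comp; apply: act_ge.
Qed.

Lemma tr_incl_shift m u : lprod_ge (e%:Z * m - d%:Z) u ->
  exists2 w, ord_ge m w & galois_trace act u = incl w.
Proof.
move=> um; have ud : lprod_ge (- d%:Z) (incl (lmon k (- m)) * u).
  by have := lprod_geM (@incl_lmon_ge (- m)) um; apply: lprod_ge_le; lia.
have [w w0 wE] := tr_integral ud; exists (lmon k m * w).
  by have := ord_ge_lmonM m w0; rewrite addr0.
rewrite rmorphM -wE -galois_traceZ; last by move=> g; rewrite act_incl.
by rewrite mulrA -rmorphM lmonM subrr lmon0 rmorph1 mul1r.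
Qed.

Local Notation xi := (lprod_d (incl t)).

Lemma xi_act g : act g xi * lprod_d (act g (diag r t)) = xi.
Proof. by rewrite -chain_rule act_incl. Qed.

Lemma lprod_d_incl w : lprod_d (incl w) = incl (lderiv w) * xi.
Proof.
apply/eqP; rewrite -subr_eq0; apply/eqP; move: w.
apply: (derivation_incl_eq0 (B := B) (c := 0)).
- by move=> w w'; rewrite rmorphD lprod_dD lderivD rmorphD mulrDl opprD addrACA.
- move=> w w'; rewrite rmorphM lprod_dM lderivM rmorphD !rmorphM /= mulrDl !mulrBr !mulrA.
  by rewrite opprD addrACA.
- by move=> a w; rewrite loc_inclZ lprod_dZ lderivZ loc_inclZ -lprod_scalerAl scalerBr.
- move=> w w0; apply: lprod_geB; first exact/lprod_ge_d0/incl_ge0.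
  rewrite -[0]addr0; apply: lprod_geM; first exact/incl_ge0/ord_lderiv0.
  exact/lprod_ge_d0/incl_ge0/ord_t0.
- by apply: lprod_ge_le incl_t_ge; have := ram_e_gt0; lia.
- by rewrite lderiv_lX rmorph1 mul1r subrr.
Qed.

Lemma xi_ge : lprod_ge d%:Z xi.
Proof.
have x0 := incl_ge0 B (ord_t0 k).
have xi0 : ord_ge d%:Z (xi ord0).
  apply: (ord_lderiv_fixed (@thetaZ _ _ _ B) (@theta1 _ _ _ B) (@thetaM _ _ _ B)).
    exact: x0.
  by move=> g gD /=; rewrite -act_theta // act_incl.
move=> i; have [g <-] := loc_perm_trans B ord0 i; rewrite -(xi_act g) -[d%:Z]addr0.
apply: ord_geM; first exact: act_ord.
by apply: lprod_ge_d0; apply: lprod_ge_le (act_diag_lmon B g).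
Qed.

Lemma lprod_dual_basis : exists (N : nat) (u v : 'I_N -> V),
  [/\ forall a, lprod_ge 0 (u a), forall a, lprod_ge (- d%:Z) (v a)
    & forall g, \sum_a u a * act g (v a) = (g == 1%g)%:R].
Proof.
have [v [vd vE]] := theta_dual_basis (@theta1 _ _ _ B) (@thetaM _ _ _ B)
  (@theta_ord _ _ _ B) (@theta_inj _ _ _ B).
have [s sE] := choice (fun i => loc_perm_trans B ord0 i).
pose U (a : 'I_r.+1 * 'I_n) : V := act (s a.1) (comp ord0 (t ^+ a.2)).
pose W (a : 'I_r.+1 * 'I_n) : V := act (s a.1) (comp ord0 (v a.2)).
exists #|{: 'I_r.+1 * 'I_n}|, (fun a => U (enum_val a)), (fun a => W (enum_val a)).
split=> [a|a|g].
- apply/act_ge/lprod_ge_comp; rewrite lXX; apply: ord_ge_le (ord_lmon _); lia.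
- exact/act_ge/lprod_ge_comp.
rewrite -(reindex (fun a : 'I_#|{: 'I_r.+1 * 'I_n}| => enum_val a)
   (P := xpredT) (F := fun a => U a * act g (W a))) /=; last first.
  by exists enum_rank => a _; [apply: enum_valK | apply: enum_rankK].
rewrite -(pair_bigA _ (fun i b => U (i, b) * act g (W (i, b)))) /=.
have comp0 h : \sum_(j < n) comp ord0 (t ^+ j) * act h (comp ord0 (v j)) =
    (h == 1%g)%:R * idem ord0 :> V.
  rewrite [RHS]comp_mul mulr1.
  transitivity (\sum_(j < n) comp ord0 (t ^+ j * act h (comp ord0 (v j)) ord0) : V).
    by apply: eq_bigr => j _; rewrite mulrC comp_mul mulrC.
  apply/funext => l; rewrite lprod_sumE /comp; case: eqP => [_|_]; last by rewrite big1.
  have [hD|hD] := boolP (h \in D).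
    have := vE h hD; set b := _ == _ => E; rewrite (_ : (b%:R : V) ord0 = b%:R); last by case: b {E}.
    by rewrite -E; apply: eq_bigr => j _; rewrite act_theta // compE.
  rewrite big1 => [|j _]; last by rewrite (act_theta0 (diag r (v j)) hD) mulr0.
  by case: eqP => // h1; case/negP: hD; rewrite h1 group1.
transitivity (\sum_i act (s i) ((g == 1%g)%:R * idem ord0)); last first.
  rewrite -[RHS]mulr1 -[X in _ = _ * X]idem_sum mulr_sumr; apply: eq_bigr => i _.
  by rewrite rmorphM /= rmorph_nat act_idem sE.
apply: eq_bigr => i _.
rewrite -(conjg_eq1 g (s i)) -comp0 rmorph_sum; apply: eq_bigr => j _.
by rewrite rmorphM /U /W /= -!ractM conjgE !mulgA mulgV mul1g.
Qed.

(* 1 = dt/dt expands by the derivation formula into terms of order at least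
   ord (dx/dt) - d. *)
Lemma xi_lead i : xi i d%:Z != 0.
Proof.
have [N [u [v [u0 vd uv]]]] := lprod_dual_basis.
apply/eqP => xid; have xi1 : ord_ge (d%:Z + 1) (xi i) by apply: ord_geS => //; apply: xi_ge.
have := derivation_formula uv (phi := idfun) (diag r t) (@lprod_dD k r) (@lprod_dM k r).
rewrite lprod_d_lX => /(congr1 (fun f : V => f i)).
have : ord_ge 1 ((\sum_a \sum_b idfun (u b * v a) *
  lprod_d (galois_trace act (v b * (diag r t * u a)))) i).
  rewrite lprod_sumE; apply: ord_ge_sum => a _; rewrite lprod_sumE.
  apply: ord_ge_sum => b _ /=.
  have : lprod_ge (- d%:Z) (v b * (diag r t * u a)).
    have := lprod_geM (vd b) (lprod_geM (lprod_ge_diag (r := r) (ord_t0 k)) (u0 a)).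
    by rewrite !addr0.
  case/tr_integral => w w0 ->; rewrite lprod_d_incl.
  have H := ord_geM (u0 b i) (vd a i).
  have := ord_geM H (ord_geM (incl_ge0 B (ord_lderiv0 w0) i) xi1).
  by apply: ord_ge_le; lia.
move=> H E; rewrite -E in H; have := H 0 isT.
by rewrite -[(1 : V) i]lmon0 lcoef_lmon eqxx => /eqP; rewrite oner_eq0.
Qed.

Lemma xi_neq0 i : xi i != 0.
Proof. by apply: contraNneq (xi_lead i) => ->. Qed.

Definition xiV : V := fun i => (xi i)^-1.

Lemma xi_mulV : xi * xiV = 1.
Proof. by apply/funext => i; apply: mulfV; apply: xi_neq0. Qed.

Lemma xiV_ge : lprod_ge (- d%:Z) xiV.
Proof. by move=> i; apply: ord_geV; [apply: xi_ge | apply: xi_lead]. Qed.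

End RamificationIndex.

(** * Magical elements *)

Section DualElement.
Variables (gT : finGroupType) (S : comPzRingType) (act : ring_action gT S).
Local Notation tr := (galois_trace act).
Variables (z zv : S).
Hypothesis dual : forall g1 g2, tr (act g1 z * act g2 zv) = (g1 == g2)%:R.

Lemma dual_expand u : u = \sum_g act g z * tr (act g zv * u).
Proof.
pose P : 'M[S]_#|gT| := \matrix_(i, j) act (enum_val j) (act (enum_val i) z).
pose Q : 'M[S]_#|gT| := \matrix_(i, j) act (enum_val i) (act (enum_val j) zv).
have sumE (F : gT -> S) : \sum_(i < #|gT|) F (enum_val i) = \sum_g F g.
  rewrite [RHS](reindex (fun i : 'I_#|gT| => enum_val i)) //.
  by exists enum_rank => a _; [apply: enum_valK | apply: enum_rankK].
have PQ : P *m Q = 1%:M.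
  apply/matrixP => i j; rewrite !mxE -(inj_eq enum_val_inj) -dual /galois_trace -sumE.
  by apply: eq_bigr => l _; rewrite !mxE rmorphM.
have QP h : \sum_g act h (act g zv) * act g z = (h == 1%g)%:R.
  have := congr1 (fun A : 'M[S]_#|gT| => A (enum_rank h) (enum_rank 1%g)) (mulmx1C PQ).
  rewrite !mxE (inj_eq enum_rank_inj) => <-; rewrite -sumE; apply: eq_bigr => l _.
  by rewrite !mxE !enum_rankK ract1.
transitivity (\sum_h act h u * \sum_g act h (act g zv) * act g z).
  rewrite (bigD1 1%g) //= QP eqxx mulr1 ract1 big1 ?addr0 // => h /negPf h1.
  by rewrite QP h1 mulr0.
under eq_bigr do rewrite mulr_sumr.
rewrite exchange_big; apply: eq_bigr => g _; rewrite mulr_sumr; apply: eq_bigr => h _.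
by rewrite rmorphM mulrCA [RHS]mulrCA [act g z * _]mulrC.
Qed.

Lemma dual_coef (c : gT -> S) h : (forall g g', act g' (c g) = c g) ->
  tr (act h zv * \sum_g act g z * c g) = c h.
Proof.
move=> cG; rewrite mulr_sumr galois_trace_sum (bigD1 h) //= big1 ?addr0 => [|g gh].
  rewrite mulrA [_ * c h]mulrC galois_traceZ; last by move=> g'; apply: cG.
  by rewrite mulrC [_ * act h z]mulrC dual eqxx mul1r.
rewrite mulrA [_ * c g]mulrC galois_traceZ; last by move=> g'; apply: cG.
by rewrite [_ * act g z]mulrC dual (negPf gh) mulr0.
Qed.

Lemma dual_trace : tr z * tr zv = 1.
Proof.
have D g : tr (act g zv * z) = (g == 1%g)%:R.
  by rewrite mulrC -{1}[z](ract1 act) dual eq_sym.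
rewrite mulrC -galois_traceZ; last by move=> g; apply: ract_trace.
have -> : tr zv * z = \sum_g act g zv * z by rewrite mulr_suml.
rewrite galois_trace_sum (bigD1 1%g) //= D eqxx big1 ?addr0 // => g /negPf g1.
by rewrite D g1.
Qed.

Lemma dual_sym g1 g2 : tr (act g1 zv * act g2 z) = (g1 == g2)%:R.
Proof. by rewrite mulrC dual eq_sym. Qed.

End DualElement.

Section MagicalElement.
Variables (k : fieldType) (gT : finGroupType) (r : nat) (B : local_galois k gT r).
Local Notation V := (lprod k r).
Local Notation act := (loc_act B).
Local Notation incl := (loc_incl B).
Local Notation t := (lX k).
Local Notation n := #|decomp_group B|.
Local Notation d := (loc_diff B).
Local Notation d' := (d_prime B).
Local Notation e := (ram_e B).
Local Notation tr := (galois_trace act).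
Implicit Types (f u v : V) (i j : 'I_r.+1) (w : laurent k) (m : int) (g h : gT).

Lemma tr_scale (c : k) u : tr (c *: u) = c *: tr u.
Proof.
by rewrite /galois_trace scaler_sumr; apply: eq_bigr => g _; rewrite actZ.
Qed.

Variables z zv : V.
Hypothesis magz : magical B z.
Hypothesis dualz : dual_element B z zv.

Lemma magical_trace : exists a b, [/\ ord_ge 0 a, ord_ge 0 b, a * b = 1 & tr z = incl a].
Proof. by have [_ [a [b [? ? ? ?]]]] := magz; exists a, b. Qed.

Lemma unit_not_max (a b : laurent k) : ord_ge 0 b -> a * b = 1 -> ~ ord_ge 1 a.
Proof.
move=> b0 ab a1; have := ord_geM a1 b0; rewrite ab => /(_ 0 isT).
by rewrite -lmon0 lcoef_lmon eqxx => /eqP; rewrite oner_eq0.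
Qed.

Lemma magical_ram_e : e = n.
Proof.
apply/eqP; rewrite eqn_leq ram_e_le leqNgt andTb; apply/negP => en.
have [[zd _] dE] := (magz, d_primeE B).
have ed : lprod_ge (e%:Z * 1 - d%:Z) z by apply: lprod_ge_le zd; lia.
have [w w1 wE] := tr_incl_shift ed; have [a [b [a0 b0 ab aE]]] := magical_trace.
apply: (unit_not_max b0 ab); rewrite -(incl_inj (B := B) (_ : incl w = incl a)) //.
by rewrite -wE -aE.
Qed.

Lemma tr_max u : lprod_ge (1 - d'%:Z) u -> exists2 w, ord_ge 1 w & tr u = incl w.
Proof.
move=> u1; apply: tr_incl_shift; apply: lprod_ge_le u1.
by have := d_primeE B; rewrite magical_ram_e; lia.
Qed.

Lemma tr_int u : lprod_ge (- d'%:Z) u -> exists2 w, ord_ge 0 w & tr u = incl w.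
Proof.
move=> u1; apply: tr_integral; apply: lprod_ge_le u1.
by have := d_primeE B; have := cardG_gt0 (decomp_group B); lia.
Qed.

Lemma max_B_sub : @max_B k r `<=` conj_sum B zv (max_A B).
Proof.
move=> u u1; exists (fun g => tr (act g z * u)); last first.
  exact: (dual_expand (dual_sym dualz) u).
move=> g; have [zd _] := magz.
have [w w1 ->] : exists2 w, ord_ge 1 w & tr (act g z * u) = incl w.
  by apply: tr_max; have := lprod_geM (act_ge B g zd) u1; apply: lprod_ge_le; lia.
by exists w.
Qed.

Lemma omega_A_log_sub : conj_sum B z (omega_A_log B) `<=` @omega_B_log k r.
Proof.
move=> _ [m mA ->]; apply: lprod_ge_sum => g _; have [f f1 <-] := mA g.
have [zd _] := magz.
have := lprod_geM (act_ge B g zd) (lprod_geM (@incl_ge _ _ _ B _ _ f1) (@xi_ge _ _ _ B)).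
by apply: lprod_ge_le; have := d_primeE B; rewrite magical_ram_e; lia.
Qed.

(* The trace induces on t^(-d') B / t^(1-d') B = k^r a map onto A / m_A which,
   being G-invariant, is injective on each of the r factors. *)
Lemma tr_unit u i : lprod_ge (- d'%:Z) u -> u i (- d'%:Z) != 0 ->
    (forall j, j != i -> u j = 0) ->
  exists2 a, tr u = incl a & a 0 != 0.
Proof.
move=> ud ui uj; have [zd _] := magz.
have [i0 nz] : exists i0, ~ exists2 w, ord_ge 1 w & tr (comp i0 (z i0)) = incl w.
  apply: contrapT => nex; have [a [b [a0 b0 ab aE]]] := magical_trace.
  have H i0 : exists w, ord_ge 1 w /\ tr (comp i0 (z i0)) = incl w.
    apply: contrapT => nex'; apply: nex; exists i0 => -[w w1 wE].
    by apply: nex'; exists w.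
  have [w wP] := choice H.
  apply: (unit_not_max b0 ab); rewrite (_ : a = \sum_i w i).
    by apply: ord_ge_sum => j _; have [] := wP j.
  apply: (@incl_inj _ _ _ B); rewrite -aE -{1}[z]comp_sum galois_trace_sum rmorph_sum.
  by apply: eq_bigr => j _; have [_ ->] := wP j.
have [g gi] := loc_perm_trans B i0 i.
pose y := act g z i; have yE : act g (comp i0 (z i0)) = comp i y by rewrite act_comp gi.
have ynz : ~ exists2 w, ord_ge 1 w & tr (comp i y) = incl w by rewrite -yE galois_trace_act.
have yd : ord_ge (- d'%:Z) y by apply: act_ge.
have yd0 : y (- d'%:Z) != 0.
  apply: contra_notN ynz => /eqP y0; apply: tr_max; apply: lprod_ge_comp.
  by rewrite addrC; apply: ord_geS.
pose c := u i (- d'%:Z) / y (- d'%:Z).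
have c0 : c != 0 by rewrite mulf_neq0 ?invr_neq0.
have uE : u = comp i (u i).
  by apply/funext => j; rewrite /comp; case: eqP => [->//|/eqP/uj].
have [w w1 wE] : exists2 w, ord_ge 1 w & tr (u - c *: comp i y) = incl w.
  apply: tr_max => j; rewrite uE; have [->|ji] := eqVneq j i; last first.
    rewrite -[X in ord_ge _ X]/(comp i (u i) j - c *: comp i y j) /comp (negPf ji).
    by rewrite scaler0 subr0; apply: ord_ge0.
  rewrite -[X in ord_ge _ X]/(comp i (u i) i - c *: comp i y i) !compE addrC.
  apply: ord_geS; first by apply: ord_geB; [exact: ud | exact: ord_geZ].
  by rewrite lcoefB lcoefZ divfK ?subrr.
have [a a0 aE] : exists2 w, ord_ge 0 w & tr (comp i y) = incl w.
  by apply: tr_int; apply: lprod_ge_comp.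
exists (w + c *: a).
  by rewrite rmorphD /= loc_inclZ -wE -aE -tr_scale -galois_traceD subrK.
rewrite lcoefD w1 // add0r lcoefZ mulf_neq0 //; apply: contra_notN ynz => /eqP a00.
by exists a => //; rewrite -[1]add0r; apply: ord_geS.
Qed.

End MagicalElement.

(** * Splitting off the functions on the affine part *)

Section Splitting.
Variables (k : fieldType) (p : nat) (gT : finGroupType) (r : nat) (B : local_galois k gT r).
Hypothesis chark : p \in [pchar k].
Hypothesis pG : (p.-group [set: gT]%SET)%g.
Local Notation V := (lprod k r).
Local Notation act := (loc_act B).
Local Notation incl := (loc_incl B).
Local Notation t := (lX k).
Local Notation sigma := (loc_perm B).
Local Notation d := (loc_diff B).
Local Notation d' := (d_prime B).
Local Notation e := (ram_e B).
Local Notation xi := (lprod_d (incl t)).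
Local Notation tr := (galois_trace act).
Local Notation acts := (fun g => act g : V -> V).
Implicit Types (f u v : V) (i j : 'I_r.+1) (w : laurent k) (m : int) (g h : gT).

(* The Laurent series which are polynomials in 1/x. *)
Definition lneg : set (laurent k) := [set f | forall m, 0 < m -> f m = 0].

Lemma lneg_split w : exists w1 w2, [/\ ord_ge 1 w1, lneg w2 & w = w1 + w2].
Proof.
pose c (m : int) := if m < 1 then 0 else w m.
have cP : c \in @laurent_pred k by apply/asboolP; exists 1 => m m1; rewrite /c m1.
exists (Laurent cP), (w - Laurent cP); split; last by rewrite addrC subrK.
  by move=> m m1; rewrite /= /c m1.
by move=> m m0; rewrite lcoefB /= /c (_ : m < 1 = false) ?subrr //; lia.
Qed.

Lemma lneg_max w : lneg w -> ord_ge 1 w -> w = 0.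
Proof.
by move=> wn w1; apply: laurent_ext => m; have [m0|m0] := ltP 0 m; [apply: wn | apply: w1; lia].
Qed.

Variable O : set V.
Hypothesis Oring : subring_set O.
Hypothesis Oscale : forall (c : k) u, O u -> O (c *: u).
Hypothesis Oact : forall g u, O u -> O (act g u).
Hypothesis Otheta : exists2 theta, O theta & tr theta = 1.
Hypothesis Oinv : forall u, O u -> (forall g, act g u = u) -> exists2 w, lneg w & u = incl w.
Hypothesis Oneg : forall w, lneg w -> O (incl w).

Section Complement.
Variables (M : set V) (H : {group gT}).
Hypothesis Mmod : submodule acts M.
Hypothesis Hn : (H <| [set: gT]%SET)%g.
Hypothesis MOinv : forall u, M u -> O u -> (forall g, act g u = u) -> u = 0.
Hypothesis Minv : forall u, (forall g, g \in H -> act g u = u) ->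
  (forall g, M (act g u - u)) -> exists a b, [/\ M a, O b & u = a + b].

Let actsL g (a : k) u v : act g (a *: u + v) = a *: act g u + act g v.
Proof. by rewrite rmorphD actZ. Qed.

Let Omod : submodule acts O.
Proof.
split; [exact: subring_set0 | | exact: Oact].
by move=> a u v Ou Ov; apply: subring_setD => //; apply: Oscale.
Qed.

Lemma complement_disjoint u : M u -> O u -> u = 0.
Proof.
move=> Mu Ou; have [[M0 MD Ma] [O0 OD Oa]] := (Mmod, Omod).
have MOm : submodule acts (M `&` O).
  split=> [|a f v [Mf Of] [Mv Ov]|g f [Mf Of]]; split => //.
  - exact: MD. - exact: OD. - exact: Ma. - exact: Oa.
have zm : submodule acts [set 0].
  by split=> // [a f v -> ->|g f ->]; rewrite ?scaler0 ?addr0 ?rmorph0.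
apply: (pgroup_invariants_sub chark pG actsL (ract1 act) (ractM act) MOm zm) => // f [Mf Of] fG.
by apply: MOinv => // g; apply/eqP; rewrite -subr_eq0; apply/eqP/fG.
Qed.

(* The obstruction to lifting an invariant class modulo M + O is a cocycle with
   values in O, which splits since O contains an element of trace 1. *)
Lemma complement_span u : (forall g, g \in H -> act g u = u) ->
  exists a b, [/\ M a, O b & u = a + b].
Proof.
move=> uH; have [[M0 MD Ma] [O0 OD Oa]] := (Mmod, Omod).
have Madd := fun a b => @submoduleD _ _ _ acts M a b Mmod.
have Msub := fun a b => @submoduleB _ _ _ acts M a b Mmod.
pose W : set V := [set f | exists a b, [/\ M a, O b & f = a + b]].
pose V0 : set V := [set f | forall g, g \in H -> act g f = f].
have Wm : submodule acts W.
  split.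
  - by exists 0, 0; rewrite addr0.
  - move=> c _ _ [a [b [aM bO ->]]] [a' [b' [aM' bO' ->]]].
    exists (c *: a + a'), (c *: b + b'); split; [exact: MD | exact: OD |].
    by rewrite scalerDr addrACA.
  - move=> g _ [a [b [aM bO ->]]]; exists (act g a), (act g b).
    by rewrite rmorphD; split; [exact: Ma | exact: Oa |].
have V0m : submodule acts V0.
  split=> [g _|a f v fH vH g gH|g f fH h hH]; first exact: rmorph0.
    by rewrite actsL fH ?vH.
  have hgH : (h ^ g)%g \in H.
    by rewrite memJ_norm //; apply: (fintype.subsetP (normal_norm Hn)); rewrite finset.inE.
  by rewrite -[in RHS](fH _ hgH) -!ractM conjgE mulKVg.
have uniq a b a' b' : M a -> O b -> M a' -> O b' -> a + b = a' + b' -> b = b'.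
  move=> aM bO aM' bO' E; apply/eqP; rewrite -subr_eq0; apply/eqP.
  apply: complement_disjoint; last exact: subring_setB.
  suff -> : b - b' = a' - a by apply: Msub.
  by apply/eqP; rewrite subr_eq addrAC -E addrAC subrr add0r.
apply: (pgroup_invariants_sub chark pG actsL (ract1 act) (ractM act) V0m Wm) uH => c cH cW.
have [a aE] := choice cW; have [b abE] := choice aE => {aE}.
have aM g : M (a g) by have [] := abE g.
have bO g : O (b g) by have [] := abE g.
have E g : act g c - c = a g + b g by have [] := abE g.
have bM g h : b (g * h)%g = act g (b h) + b g.
  apply: (uniq (a (g * h)%g) _ (act g (a h) + a g)) => //.
  - by apply: Madd => //; apply: Ma.
  - by apply: subring_setD => //; apply: Oa.
  - by rewrite addrACA -rmorphD -!E rmorphB ractM addrA subrK.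
have bH g : g \in H -> b g = 0.
  move=> gH; apply: (uniq (a g) _ 0 0) => //.
  by rewrite -E cH // subrr addr0.
have [theta Oth tr1] := Otheta.
pose s := \sum_h b h * act h theta.
have sO : O s by apply: subring_set_sum => // h _; apply: subring_setM => //; apply: Oa.
have sE g : act g s = s - b g.
  have -> : b g = \sum_h b g * act h theta by rewrite -mulr_sumr -/(galois_trace act theta) tr1 mulr1.
  rewrite (reindex_inj (mulgI g)) /= {2}/s (reindex_inj (mulgI g)) /= -sumrB rmorph_sum.
  by apply: eq_bigr => h _; rewrite bM mulrDl addrK rmorphM ractM.
have [|g|a' [b' [aM' bO' E']]] := @Minv (c + s).
- by move=> g gH; rewrite rmorphD cH // sE bH // subr0.
- by rewrite rmorphD sE opprD addrACA E [s - _]addrC addrK addrK.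
exists a', (b' - s); split=> //; first exact: subring_setB.
by rewrite addrA -E' addrK.
Qed.

End Complement.

Section DualSum.
Variables z zv : V.
Hypothesis dualz : dual_element B z zv.
Hypothesis trz : exists a b, [/\ ord_ge 0 a, ord_ge 0 b, a * b = 1 & tr z = incl a].
Local Notation M := (conj_sum B z (max_A B)).

Lemma conj_sumP u : M u <-> forall h, max_A B (tr (act h zv * u)).
Proof.
split=> [[m mM ->] h|uM]; last first.
  by exists (fun g => tr (act g zv * u)) => //; apply: (dual_expand dualz).
rewrite (dual_coef dualz) // => g g'; have [w _ <-] := mM g; exact: act_incl.
Qed.

Lemma max_AD u v : max_A B u -> max_A B v -> max_A B (u + v).
Proof. by move=> [a a1 <-] [b b1 <-]; exists (a + b); rewrite ?rmorphD //; apply: ord_geD. Qed.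

Lemma max_AZ c u : max_A B u -> max_A B (c *: u).
Proof. by move=> [a a1 <-]; exists (c *: a); rewrite ?loc_inclZ //; apply: ord_geZ. Qed.

Lemma conj_sum_act h g u : tr (act h zv * act g u) = tr (act (g^-1 * h)%g zv * u).
Proof.
by rewrite -[in RHS](galois_trace_act act g) rmorphM -ractM mulgA mulgV mul1g.
Qed.

Lemma conj_sum_submodule : submodule acts M.
Proof.
split.
- by apply/conj_sumP => h; rewrite mulr0 galois_trace0; exists 0; rewrite ?rmorph0.
- move=> a u v /conj_sumP uM /conj_sumP vM; apply/conj_sumP => h.
  rewrite mulrDr galois_traceD -lprod_scalerAr tr_scale.
  by apply: max_AD => //; apply: max_AZ.
- by move=> g u /conj_sumP uM; apply/conj_sumP => h; rewrite conj_sum_act.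
Qed.

Lemma conj_sum_invariant u : (forall g, act g u = u) -> M u -> exists2 w, ord_ge 1 w & u = incl w.
Proof.
move=> uG /conj_sumP uM; have [a [b [a0 b0 ab aE]]] := trz.
have [w w1 wE] := uM 1%g.
exists (a * w); first by have := ord_geM a0 w1; rewrite add0r.
have H g : tr (act g zv * u) = tr (act 1%g zv * u) by rewrite -[in LHS](uG g) conj_sum_act mulVg.
rewrite rmorphM wE -aE [LHS](dual_expand dualz u).
by rewrite (eq_bigr _ (fun g _ => congr1 (fun f => act g z * f) (H g))) -mulr_suml.
Qed.

Lemma max_A_conj_sum w : ord_ge 1 w -> M (incl w).
Proof.
move=> w1; have [a [b [a0 b0 ab aE]]] := trz.
exists (fun=> incl (b * w)) => [_|]; first by exists (b * w) => //; have := ord_geM b0 w1; rewrite add0r.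
by rewrite -mulr_suml -/(galois_trace act z) aE -rmorphM mulrA ab mul1r.
Qed.

Lemma conj_sum_disjoint u : M u -> O u -> u = 0.
Proof.
apply: (complement_disjoint conj_sum_submodule) => {}u Mu Ou uG.
have [w wn uw] := Oinv Ou uG; have [w' w1 uw'] := conj_sum_invariant uG Mu.
have ww' : w = w' by apply: (@incl_inj _ _ _ B); rewrite -uw -uw'.
by rewrite uw (lneg_max wn) ?rmorph0 // ww'.
Qed.

Lemma conj_sum_span u : exists a b, [/\ M a, O b & u = a + b].
Proof.
apply: (@complement_span M 1%G conj_sum_submodule) => [||{}u _ uM|g /set1gP ->].
- exact: normal1.
- by move=> v Mv Ov _; apply: conj_sum_disjoint.
- pose c := tr (act 1%g zv * u).
  have cM h : max_A B (tr (act h zv * u) - c).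
    have /conj_sumP/(_ 1%g) := uM h^-1%g.
    by rewrite mulrBr galois_traceB conj_sum_act invgK mulg1.
  have [w cw] := tr_incl B (act 1%g zv * u).
  have [a [b [a0 b0 ab aE]]] := trz.
  have [w1 [w2 [w11 w2n wE]]] := lneg_split (a * w).
  exists (u - tr z * c + incl w1), (incl w2); split; [|exact: Oneg |].
    apply: (submoduleD conj_sum_submodule); last exact: max_A_conj_sum.
    exists (fun h => tr (act h zv * u) - c) => //.
    rewrite {1}(dual_expand dualz u) /galois_trace mulr_suml -sumrB.
    by apply: eq_bigr => h _; rewrite mulrBr.
  by rewrite -addrA -rmorphD -wE rmorphM -cw -aE subrK.
- exact: ract1.
Qed.

End DualSum.

Section Idempotents.
Hypothesis Dn : (decomp_group B <| [set: gT]%SET)%g.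

Lemma max_B_submodule : submodule acts (@max_B k r).
Proof.
split; first exact: lprod_ge0.
- by move=> a u v u1 v1; apply: lprod_geD => //; apply: lprod_geZ.
- by move=> g u; apply: act_ge.
Qed.

Lemma max_B_O_invariant u : max_B u -> O u -> (forall g, act g u = u) -> u = 0.
Proof.
move=> u1 Ou uG; have [w wn uw] := Oinv Ou uG; rewrite uw (lneg_max wn) ?rmorph0 //.
apply: (@incl_ge_inv _ _ _ B 1 w ord0); rewrite -uw; apply: ord_ge_le (u1 ord0).
by rewrite subrr mulr0.
Qed.

Lemma max_B_O u : max_B u -> O u -> u = 0.
Proof. exact: (complement_disjoint max_B_submodule max_B_O_invariant). Qed.

Lemma incl_max_B w : ord_ge 1 w -> max_B (incl w).
Proof. by move=> /(@incl_ge _ _ _ B); apply: lprod_ge_le; have := ram_e_gt0 B; lia. Qed.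

Lemma idem0_split : exists a b, [/\ max_B a, O b & idem ord0 = a + b].
Proof.
apply: (complement_span max_B_submodule Dn max_B_O_invariant); last first.
  by move=> g /decompP g0; rewrite act_idem g0.
move=> u uD uM; pose c : V := comp ord0 (u ord0).
have cD g : g \in decomp_group B -> act g c = c.
  by move=> gD; have /decompP g0 := gD; rewrite /c act_comp g0 uD.
have [s sE] := choice (fun i => loc_perm_trans B ord0 i).
pose kappa := \sum_i act (s i) c.
have kG g : act g kappa = kappa.
  rewrite /kappa rmorph_sum [RHS](reindex_inj (h := sigma g)) /=; last exact: can_inj (loc_permK B g).
  apply: eq_bigr => i _; have sD : ((s (sigma g i))^-1 * (g * s i))%g \in decomp_group B.
    by apply/decompP; rewrite !loc_permM sE -{2}(sE (sigma g i)) loc_permK.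
  by rewrite -[in RHS](cD _ sD) -!ractM mulKVg.
have [w kw] := act_invariant kG.
have [w1 [w2 [w11 w2n wE]]] := lneg_split w.
exists (u - kappa + incl w1), (incl w2); split; last first.
- by rewrite -addrA -rmorphD -wE -kw subrK.
- exact: Oneg.
apply: lprod_geD; last exact: incl_max_B.
move=> i; rewrite -[X in ord_ge _ X]/(u i - kappa i).
have -> : kappa i = act (s i) u i.
  rewrite /kappa lprod_sumE (bigD1 i) //= big1 ?addr0 => [|j ji].
    by rewrite /c act_comp sE compE.
  by rewrite /c act_comp sE /comp eq_sym (negPf ji).
by rewrite -opprB; apply: ord_geN; apply: (uM (s i) i).
Qed.

Lemma O_const u : O u -> lprod_ge 0 u -> forall i, u i = (u i 0) *: 1.
Proof.
move=> Ou u0 i; pose F j := u - (u j 0) *: (1 : V).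
have P0 : \prod_j F j = 0.
  apply: max_B_O; last first.
    apply: subring_set_prod => // j _; apply: subring_setB => //; apply: Oscale.
    exact: subring_set1.
  have F0 j : lprod_ge 0 (F j) by apply: lprod_geB => //; apply/lprod_geZ/lprod_ge1.
  move=> j; rewrite (bigD1 j) //= -[1]addr0; apply: ord_geM.
    rewrite -[1]add0r; apply: ord_geS; first exact: F0.
    by rewrite -[LHS]/(u j 0 - u j 0 * (1 : laurent k) 0) -lmon0 lcoef_lmon eqxx mulr1 subrr.
  rewrite lprod_prodE; apply: (big_ind (ord_ge 0)) => [|a b a0 b0|l _].
  - exact: ord_ge1.
  - by have := ord_geM a0 b0; rewrite addr0.
  - exact: F0.
have /eqP := congr1 (fun f : V => f i) P0; rewrite lprod_prodE prodf_seq_eq0.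
case/hasP => j _ /=; rewrite subr_eq0 => /eqP E.
have {}E : u i = (u j 0) *: (1 : laurent k) := E.
suff -> : u i 0 = u j 0 by [].
by rewrite E lcoefZ -lmon0 lcoef_lmon eqxx mulr1.
Qed.

Lemma O_const_d u : O u -> lprod_ge 0 u -> lprod_d u = 0.
Proof.
move=> Ou u0; apply/funext => i; rewrite /lprod_d (O_const Ou u0) lderivZ lderiv1.
exact: scaler0.
Qed.

Lemma O_idem i : O (idem i).
Proof.
suff O0 : O (idem ord0).
  by have [g <-] := loc_perm_trans B ord0 i; rewrite -act_idem; apply: Oact.
have [a [b [a1 Ob E]]] := idem0_split.
have b0 : lprod_ge 0 b.
  have -> : b = idem ord0 - a by rewrite E addrAC subrr add0r.
  apply: lprod_geB; first exact/lprod_ge_comp/ord_ge1.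
  exact: lprod_ge_le a1.
suff -> : idem ord0 = b by [].
apply/funext => j; rewrite (O_const Ob b0).
have : (idem ord0 : V) j 0 = a j 0 + b j 0 by rewrite E.
rewrite (a1 j) // add0r => <-; rewrite /comp; case: eqP => _; last by rewrite scale0r.
by rewrite -lmon0 lcoef_lmon eqxx scale1r.
Qed.

Lemma integral_split u : lprod_ge 0 u ->
  exists a b, [/\ max_B a, O b, lprod_ge 0 b & u = a + b].
Proof.
move=> u0; pose b : V := \sum_i (u i 0) *: idem i.
have bi i : b i = (u i 0) *: 1.
  rewrite /b lprod_sumE (bigD1 i) //= big1 ?addr0 => [|j ji].
    by rewrite -[LHS]/(u i 0 *: (idem i : V) i) compE.
  by rewrite -[LHS]/(u j 0 *: (idem j : V) i) /comp eq_sym (negPf ji) scaler0.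
have b0 : lprod_ge 0 b by move=> i; rewrite bi; apply/ord_geZ/ord_ge1.
exists (u - b), b; split; rewrite ?subrK //.
  move=> i; rewrite -[1]add0r; apply: ord_geS; first by apply: (lprod_geB u0 b0).
  by rewrite -[LHS]/(u i 0 - b i 0) bi lcoefZ -lmon0 lcoef_lmon eqxx mulr1 subrr.
by apply: subring_set_sum => // i _; apply/Oscale/O_idem.
Qed.

Variable z : V.
Hypothesis magz : magical B z.

Lemma tr_d u : lprod_d (tr u) = tr (lprod_d u * xiV B) * xi.
Proof.
rewrite /galois_trace mulr_suml (big_morph _ (@lprod_dD k r) (_ : lprod_d 0 = 0)); last first.
  by have := lprod_dB (0 : V) 0; rewrite !subrr.
apply: eq_bigr => g _; rewrite chain_rule rmorphM -mulrA; congr (_ * _).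
by rewrite -{1}(xi_act B g) mulrA -rmorphM [_ * xi]mulrC xi_mulV rmorph1 mul1r.
Qed.

(* Multiplying by the idempotent of a component and taking traces moves the residue
   to k((x)), where exact forms and k[1/x] dx/x^2 have none. *)
Lemma residue_zero (w u : V) : O w ->
    omega_B_log (incl (lmon k (- 2)) * w * xi - lprod_d u) ->
  lprod_ge 0 (incl (lmon k (- 2)) * w * xi - lprod_d u).
Proof.
set om := _ - _ => Ow oml i; rewrite -[0](addNr (1 : int)); apply: ord_geS; first exact: oml.
apply: contrapT => /eqP omi.
have eps0 : lprod_d (idem i : V) = 0.
  by apply: O_const_d; [apply: O_idem | apply/lprod_ge_comp/ord_ge1].
pose f := om * idem i * xiV B * incl t.
have fE : f = comp i (om i * xiV B i * incl t i).
  by rewrite /f -!mulrA [idem i * _]mulrC !mulrA comp_mul mulr1.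
have dn := d_primeE B; have en := magical_ram_e magz.
have [te te0] := ram_eP B i.
have fi : ord_ge (- 1 - d%:Z + e%:Z) (om i * xiV B i * incl t i).
  by apply: ord_geM te; apply: ord_geM; [apply: oml | apply: xiV_ge].
have dE : - 1 - d%:Z + e%:Z = - d'%:Z by lia.
have [||j ji|a aE /eqP] := @tr_unit _ _ _ B z magz f i.
- by rewrite fE; apply: lprod_ge_comp; rewrite -dE.
- rewrite fE compE -dE lcoefM_lead //; last by apply: ord_geM; [apply: oml | apply: xiV_ge].
  rewrite mulf_neq0 // lcoefM_lead; [ | apply: oml | apply: xiV_ge].
  by rewrite mulf_neq0 // lcoefV ?invr_neq0 ?xi_lead //; apply: xi_ge.
- by rewrite fE /comp (negPf ji).
have E1 : om * idem i = incl (lmon k (- 2)) * (w * idem i) * xi - lprod_d (u * idem i).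
  by rewrite lprod_dM eps0 mulr0 add0r /om mulrBl; congr (_ - _);
    rewrite ?[idem i * _]mulrC // -!mulrA [xi * _]mulrC.
have E2 : f = incl (lmon k (- 1)) * (w * idem i) - incl t * (lprod_d (u * idem i) * xiV B).
  rewrite /f E1 !mulrBl; congr (_ - _); last by rewrite mulrC.
  move: (w * idem i) => v.
  rewrite -!mulrA [xi * _]mulrA xi_mulV mul1r mulrCA mulrC; congr (_ * _).
  by rewrite -rmorphM lX_mon lmonM.
have [w1 w1n w1E] : exists2 w1, lneg w1 & tr (w * idem i) = incl w1.
  apply: Oinv => [|g]; last exact: ract_trace.
  by apply: subring_set_sum => // g _; apply: Oact; apply: subring_setM => //; apply: O_idem.
have [h hE] := tr_incl B (u * idem i).
have trd : tr (lprod_d (u * idem i) * xiV B) = incl (lderiv h).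
  rewrite -[LHS]mulr1 -(xi_mulV B) mulrA -tr_d hE lprod_d_incl -mulrA xi_mulV.
  exact: mulr1.
have trZ (c : laurent k) (v : V) : tr (incl c * v) = incl c * tr v.
  by apply: galois_traceZ => g; apply: act_incl.
have : a = lmon k (- 1) * w1 - t * lderiv h.
  apply: (@incl_inj _ _ _ B); rewrite -aE E2 galois_traceB rmorphB !rmorphM /=.
  by rewrite !trZ w1E trd.
move=> -> []; rewrite lcoefB lcoef_lmonM lX_mon lcoef_lmonM !sub0r opprK w1n //.
by rewrite lderivN1 subrr.
Qed.

End Idempotents.

End Splitting.

Section LocalModules.
Variables (k : fieldType) (gT : finGroupType) (r : nat) (B : local_galois k gT r).
Local Notation V := (lprod k r).
Local Notation act := (loc_act B).
Local Notation incl := (loc_incl B).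
Local Notation t := (lX k).
Local Notation xi := (lprod_d (incl t)).
Implicit Types (f u v : V) (w : laurent k) (g h : gT).

Lemma omega_actE g u : omega_act B g u = act g u * lprod_d (act g (diag r t)).
Proof. by []. Qed.

Lemma omega_act_lin g (a : k) u v :
  omega_act B g (a *: u + v) = a *: omega_act B g u + omega_act B g v.
Proof. by rewrite !omega_actE rmorphD actZ mulrDl lprod_scalerAl. Qed.

Lemma omega_act1 u : omega_act B 1%g u = u.
Proof. by rewrite omega_actE !ract1 lprod_d_lX mulr1. Qed.

Lemma omega_actM g h u : omega_act B (g * h)%g u = omega_act B g (omega_act B h u).
Proof. by rewrite !omega_actE !ractM chain_rule rmorphM mulrA. Qed.

Lemma omega_act_d g u : omega_act B g (lprod_d u) = lprod_d (act g u).
Proof. by rewrite omega_actE -chain_rule. Qed.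

Lemma omega_act_xi g u : omega_act B g (u * xi) = act g u * xi.
Proof. by rewrite omega_actE rmorphM -mulrA xi_act. Qed.

Lemma omega_act_ge m g u : lprod_ge m u -> lprod_ge m (omega_act B g u).
Proof.
move=> um; rewrite omega_actE -[m]addr0; apply: lprod_geM; first exact: act_ge.
by apply: lprod_ge_d0; apply: lprod_ge_le (act_diag_lmon B g).
Qed.

Lemma omega_actB g u v : omega_act B g (u - v) = omega_act B g u - omega_act B g v.
Proof. by rewrite !omega_actE rmorphB mulrBl. Qed.

Lemma omega_B_log_submodule : submodule (omega_act B) (@omega_B_log k r).
Proof.
split; first exact: lprod_ge0.
- by move=> a u v u1 v1; apply: lprod_geD => //; apply: lprod_geZ.
- by move=> g u; apply: omega_act_ge.
Qed.

Variables z zv : V.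
Hypothesis magz : magical B z.
Hypothesis dualz : dual_element B z zv.

Lemma conj_sum_omegaE u :
  conj_sum B z (omega_A_log B) (incl (lmon k (- 2)) * u * xi) <-> conj_sum B z (max_A B) u.
Proof.
have inclK w : incl (lmon k (- 2)) * incl (lmon k 2 * w) = incl w.
  by rewrite -rmorphM lmonNK.
split=> [[m mA E]|[m mA ->]].
- exists (fun g => incl (lmon k 2) * (m g * xiV B)) => [g|].
    have [f f1 <-] := mA g; exists (lmon k 2 * f).
      by apply: ord_ge_le (ord_geM (ord_lmon 2) f1).
    by rewrite -mulrA xi_mulV mulr1 rmorphM.
  have -> : u = incl (lmon k 2) * (incl (lmon k (- 2)) * u * xi * xiV B).
    by rewrite -[_ * xi * _]mulrA xi_mulV mulr1 mulrA -rmorphM lmonM subrr lmon0 rmorph1 mul1r.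
  rewrite E mulr_suml mulr_sumr; apply: eq_bigr => g _.
  by rewrite -mulrA mulrCA.
- exists (fun g => incl (lmon k (- 2)) * m g * xi) => [g|].
    have [f f1 <-] := mA g; exists (lmon k (- 2) * f).
      by apply: ord_ge_le (ord_geM (ord_lmon (- 2)) f1).
    by rewrite rmorphM.
  rewrite mulr_sumr mulr_suml; apply: eq_bigr => g _.
  by rewrite mulrCA -!mulrA.
Qed.

Lemma omega_form u : exists v, u = incl (lmon k (- 2)) * v * xi.
Proof.
exists (incl (lmon k 2) * u * xiV B).
rewrite mulrA mulrA -rmorphM lmonM addNr lmon0 rmorph1 mul1r.
by rewrite -mulrA [_ * xi]mulrC xi_mulV mulr1.
Qed.

Lemma omega_A_log_submodule : submodule (omega_act B) (conj_sum B z (omega_A_log B)).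
Proof.
have [M0 MD Ma] := conj_sum_submodule dualz.
split.
- have -> : (0 : V) = incl (lmon k (- 2)) * 0 * xi by rewrite mulr0 mul0r.
  exact/conj_sum_omegaE.
- move=> a u v; have [[u' ->] [v' ->]] := (omega_form u, omega_form v).
  move=> /conj_sum_omegaE uM /conj_sum_omegaE vM.
  rewrite lprod_scalerAl -mulrDl lprod_scalerAr -mulrDr.
  by apply/conj_sum_omegaE/MD.
- move=> g u; have [u' ->] := omega_form u => /conj_sum_omegaE uM.
  by rewrite omega_act_xi rmorphM /= act_incl; apply/conj_sum_omegaE/Ma.
Qed.

Lemma local_H0_wf : subquotient_wf (local_H0 B z).
Proof.
split=> /=; [exact: omega_act_lin | | exact: omega_B_log_submodule
  | exact: omega_A_log_submodule | exact: omega_A_log_sub].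
by split; [exact: omega_act1 | exact: omega_actM].
Qed.

Lemma act_lin g (a : k) u v : act g (a *: u + v) = a *: act g u + act g v.
Proof. by rewrite rmorphD actZ. Qed.

Lemma local_H1_wf : subquotient_wf (local_H1 B zv).
Proof.
split=> /=; [exact: act_lin | | exact: (conj_sum_submodule (dual_sym dualz))
  | exact: max_B_submodule | exact: (max_B_sub magz dualz)].
by split; [exact: ract1 | exact: ractM].
Qed.

Lemma local_HdR_wf : subquotient_wf (local_HdR B z zv).
Proof.
have [M0 MD Ma] := conj_sum_submodule (dual_sym dualz).
have [N0 ND Na] := omega_A_log_submodule.
have [O0 OD Oa] := omega_B_log_submodule.
have [m0 mD ma] := max_B_submodule B.
split=> /=.
- by move=> g a [u1 u2] [v1 v2] /=; rewrite omega_act_lin act_lin.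
- split=> [[u1 u2]|g h [u1 u2]] /=; first by rewrite omega_act1 ract1.
  by rewrite omega_actM ractM.
- split=> [|a [u1 u2] [v1 v2] /= [uM uO] [vM vO]|g [u1 u2] /= [uM uO]].
  + split=> //=; rewrite sub0r; apply: lprod_geN.
    by have := lprod_dB (0 : V) 0; rewrite !subrr => ->.
  + split; first exact: MD.
    rewrite lprod_dD lprod_dZ opprD addrACA -scalerBr; exact: OD.
  + by split; [exact: Ma | rewrite -omega_act_d -omega_actB; apply: Oa].
- split=> [|a [u1 u2] [v1 v2] /= [uN um] [vN vm]|g [u1 u2] /= [uN um]] //.
  + by split; [apply: ND | apply: mD].
  + by split; [apply: Na | apply: ma].
- move=> [u1 u2] /= [uN um]; split; first exact: (max_B_sub magz dualz).
  apply: lprod_geB; first exact: (omega_A_log_sub magz).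
  by apply: lprod_ge_le (lprod_ge_d um).
Qed.

End LocalModules.

(** * Integral closure and rational functions *)

Section IntegralClosure.
Variables (S : comNzRingType).
Implicit Types (A : set S) (u : S).

Lemma integral_closure_rangeP (R : comNzRingType) (phi : {rmorphism R -> S}) u :
  integral_closure (range phi) u <-> integralOver phi u.
Proof.
split=> [[n [a [aA E]]]|[q qm /eqP E]].
- have [b bP] : exists b : 'I_n -> R, forall i, phi (b i) = a i.
    have H i : exists c, phi c = a i by have [c _ <-] := aA i; exists c.
    by have [b bP] := choice H; exists b.
  pose s := \poly_(i < n) (if insub i is Some j then b j else 0).
  have sn : (size s < size ('X^n : {poly R}))%N by rewrite size_polyXn ltnS size_poly.
  exists ('X^n + s); first by rewrite monicE lead_coefDl // lead_coefXn.
  rewrite /root rmorphD /= map_polyXn hornerD hornerXn; apply/eqP.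
  rewrite -[RHS]E; congr (_ + _).
  have -> : map_poly phi s = \poly_(i < n) phi (if insub i is Some j then b j else 0).
    by apply/polyP => i; rewrite coef_map /= !coef_poly; case: ifP => // _; apply: rmorph0.
  rewrite horner_poly; apply: eq_bigr => i _.
  by rewrite valK bP.
- exists (size q).-1, (fun i => phi q`_i); split=> [i|]; first by exists q`_i.
  have sq : size (map_poly phi q) = (size q).-1.+1.
    by rewrite size_map_poly_id0 ?(monicP qm) ?rmorph1 ?oner_neq0 // (polySpred (monic_neq0 qm)).
  rewrite -[RHS]E horner_coef sq big_ord_recr /= [RHS]addrC; congr (_ + _).
    by rewrite coef_map /= -/(lead_coef q) (monicP qm) rmorph1 mul1r.
  by apply: eq_bigr => i _; rewrite coef_map.
Qed.

Lemma integral_closure_subring (R : comNzRingType) (phi : {rmorphism R -> S}) :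
  subring_set (integral_closure (range phi)).
Proof.
split; first by apply/integral_closure_rangeP; apply: integral1.
- move=> u v /integral_closure_rangeP ui /integral_closure_rangeP vi.
  by apply/integral_closure_rangeP/integral_sub.
- move=> u v /integral_closure_rangeP ui /integral_closure_rangeP vi.
  by apply/integral_closure_rangeP/integral_mul.
Qed.

Lemma integral_closure_sub A A' u : A `<=` A' -> integral_closure A u -> integral_closure A' u.
Proof. by move=> AA' [n [a [aA E]]]; exists n, a; split=> // i; apply/AA'/aA. Qed.

Lemma integral_closure_scale A A' c u : subring_set A' -> A `<=` A' -> A' c ->
  integral_closure A u -> integral_closure A' (c * u).
Proof.
move=> A'r AA' A'c [n [a [aA E]]]; exists n, (fun i : 'I_n => a i * c ^+ (n - i)); split.
  by move=> i; apply: subring_setM => //; [apply/AA'/aA | apply: subring_setX].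
transitivity (c ^+ n * (u ^+ n + \sum_(i < n) a i * u ^+ i)); last by rewrite E mulr0.
rewrite mulrDr exprMn mulr_sumr; congr (_ + _).
apply: eq_bigr => i _; have -> : c ^+ n = c ^+ (n - i) * c ^+ i by rewrite -exprD subnK // ltnW.
by rewrite exprMn; ring.
Qed.

Lemma integral_closure_localize A A' (T : set S) u : subring_set A ->
    T `<=` A -> T 1 -> (forall s s', T s -> T s' -> T (s * s')) ->
    (forall a, A' a -> exists2 s, T s & A (s * a)) ->
  integral_closure A' u -> exists2 s, T s & integral_closure A (s * u).
Proof.
move=> Ar TA T1 TM AA' [n [a [aA' E]]].
have H i : exists s, T s /\ A (s * a i) by have [s ? ?] := AA' _ (aA' i); exists s.
have [s sP] := choice H; pose c := \prod_i s i.
have Tc : T c.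
  by apply: (big_ind T) => [//|s1 s2|i _]; [exact: TM | have [] := sP i].
exists c => //; exists n, (fun i : 'I_n => c ^+ (n - i) * a i); split.
  move=> i; rewrite -(subnSK (ltn_ord i)) exprSr -mulrA; apply: subring_setM => //.
    by apply: subring_setX => //; apply: TA.
  rewrite /c (bigD1 i) //= mulrC mulrA mulrC; apply: subring_setM => //.
    by apply: subring_set_prod => // j _; apply: TA; have [] := sP j.
  by rewrite mulrC; have [] := sP i.
transitivity (c ^+ n * (u ^+ n + \sum_(i < n) a i * u ^+ i)); last by rewrite E mulr0.
rewrite mulrDr exprMn mulr_sumr; congr (_ + _).
apply: eq_bigr => i _; have -> : c ^+ n = c ^+ (n - i) * c ^+ i by rewrite -exprD subnK // ltnW.
by rewrite exprMn; ring.
Qed.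

Lemma galois_integral (gT : finGroupType) (act : ring_action gT S) u :
  integral_closure [set c | forall g, act g c = c] u.
Proof.
pose q := \prod_g ('X - (act g u)%:P).
have qm : q \is monic by apply: monic_prod_XsubC.
have qG g i : act g q`_i = q`_i.
  rewrite -coef_map; suff -> : map_poly (act g) q = q by [].
  rewrite rmorph_prod [RHS](reindex_inj (mulgI g)) /=.
  by apply: eq_bigr => h _; rewrite rmorphB /= map_polyX map_polyC /= ractM.
exists (size q).-1, (fun i => q`_i); split=> [i|]; first by move=> g; apply: qG.
have qu : q.[u] = 0.
  by rewrite horner_prod (bigD1 1%g) //= ract1 !hornerE subrr mul0r.
rewrite -[RHS]qu horner_coef (polySpred (monic_neq0 qm)) big_ord_recr /= [RHS]addrC.
by congr (_ + _); rewrite -/(lead_coef q) (monicP qm) mul1r.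
Qed.

End IntegralClosure.

Section Fractions.
Local Open Scope quotient_scope.

Lemma fraction_numden (R : idomainType) (f : {fraction R}) : exists a b : R,
  b != 0 /\ f * FracField.tofrac b = FracField.tofrac a.
Proof.
elim/quotW: f => x; exists (\n_x), (\d_x); split; first exact: denom_ratioP.
unlock FracField.tofrac; rewrite -[LHS]FracField.pi_mul; apply/eqmodP.
rewrite /= FracField.equivfE /FracField.mulf.
by rewrite !numden_Ratio ?oner_neq0 ?mulr1 ?mulf_neq0 ?denom_ratioP // mulrC.
Qed.

End Fractions.

HB.instance Definition _ (k : fieldType) := GRing.RMorphism.copy (@rat_poly k)
  (@FracField.tofrac {poly k}).
HB.instance Definition _ (k : fieldType) := GRing.RMorphism.copy (@rat_const k)
  (@FracField.tofrac {poly k} \o polyC).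

Lemma subf_div (F : fieldType) (a b c d : F) : b != 0 -> d != 0 ->
  a / b - c / d = (a * d - c * b) / (b * d).
Proof. by move=> b0 d0; rewrite -mulNr addf_div // mulNr. Qed.

Section RationalFunctionRings.
Variable k : fieldType.
Local Notation x := (rat_x k).

Lemma rat_poly_eq0 (q : {poly k}) : (rat_poly q == 0) = (q == 0).
Proof. exact: tofrac_eq0. Qed.

Lemma rat_x_neq0 : x != 0.
Proof. by rewrite rat_poly_eq0 polyX_eq0. Qed.

Definition rat_aff (q : {poly k}) : ratfun k := (map_poly (@rat_const k) q).[x^-1].
HB.instance Definition _ := GRing.RMorphism.copy rat_aff
  (horner_eval x^-1 \o map_poly (@rat_const k)).

Lemma rat_affX : rat_aff 'X = x^-1.
Proof. by rewrite /rat_aff map_polyX hornerX. Qed.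

Lemma rat_affC c : rat_aff c%:P = rat_const c.
Proof. by rewrite /rat_aff map_polyC hornerC. Qed.

Lemma range_subring (R : pzRingType) (S : pzRingType) (phi : {rmorphism R -> S}) :
  subring_set (range phi).
Proof.
split; first by exists 1; rewrite ?rmorph1.
  by move=> _ _ [a _ <-] [b _ <-]; exists (a - b); rewrite ?rmorphB.
by move=> _ _ [a _ <-] [b _ <-]; exists (a * b); rewrite ?rmorphM.
Qed.

Lemma reg_affineE : reg_affine k = range rat_aff.
Proof. by []. Qed.

Lemma reg_overlap_subring : subring_set (reg_overlap k).
Proof.
have x0 := rat_x_neq0.
split; first by exists 1, 0%N; rewrite rmorph1 expr0 divr1.
- move=> _ _ [p [n ->]] [q [m ->]]; exists (p * 'X^m - q * 'X^n), (n + m)%N.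
  rewrite rmorphB !rmorphM !rmorphXn /= exprD; apply: subf_div; exact: expf_neq0.
- move=> _ _ [p [n ->]] [q [m ->]]; exists (p * q), (n + m)%N.
  by rewrite rmorphM exprD invfM mulrACA.
Qed.

Lemma reg_affine_overlap : reg_affine k `<=` reg_overlap k.
Proof.
move=> _ [q _ <-]; rewrite -/(rat_aff q); elim/poly_ind: q => [|q c [p [n E]]].
  by rewrite rmorph0; exact: subring_set0 reg_overlap_subring.
rewrite rmorphD rmorphM /= E rat_affX rat_affC.
apply: (subring_setD reg_overlap_subring); last by exists c%:P, 0%N; rewrite expr0 divr1.
by exists p, n.+1; rewrite exprSr invfM mulrA.
Qed.

Lemma reg_infty_overlap : reg_infty k `<=` reg_overlap k.
Proof. by move=> _ [p _ <-]; exists p, 0%N; rewrite expr0 divr1. Qed.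

Lemma local_ring_subring : subring_set (local_ring_infty k).
Proof.
have neq0 (q : {poly k}) : q.[0] != 0 -> rat_poly q != 0.
  by rewrite rat_poly_eq0; apply: contraNneq => ->; rewrite horner0.
have h1 : (1 : {poly k}).[0] != 0 by rewrite hornerE oner_neq0.
split; first by exists (1, 1); rewrite //= mulfV ?neq0.
- move=> _ _ [[a b] /= b0 ->] [[c d] /= d0 ->]; exists (a * d - c * b, b * d) => /=.
    by rewrite hornerM mulf_neq0.
  by rewrite rmorphB !rmorphM /=; apply: subf_div; exact: neq0.
- move=> _ _ [[a b] /= b0 ->] [[c d] /= d0 ->]; exists (a * c, b * d) => /=.
    by rewrite hornerM mulf_neq0.
  by rewrite !rmorphM invfM mulrACA.
Qed.

Lemma reg_infty_local : reg_infty k `<=` local_ring_infty k.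
Proof.
move=> _ [p _ <-]; exists (p, 1); first by rewrite hornerE oner_neq0.
by rewrite /= rmorph1 divr1.
Qed.

Definition laff (q : {poly k}) : laurent k := (map_poly (in_alg (laurent k)) q).[lmon k (- 1)].
HB.instance Definition _ := GRing.RMorphism.copy laff
  (horner_eval (lmon k (- 1)) \o map_poly (in_alg (laurent k))).

Lemma laffX : laff 'X = lmon k (- 1).
Proof. by rewrite /laff map_polyX hornerX. Qed.

Lemma laffC c : laff c%:P = c *: 1.
Proof. by rewrite /laff map_polyC hornerC. Qed.

Lemma lneg_laff q : lneg (laff q).
Proof.
elim/poly_ind: q => [|q c IH] m m0; first by rewrite rmorph0.
have E : laff (q * 'X + c%:P) = lmon k (- 1) * laff q + c *: 1.
  by rewrite rmorphD rmorphM /= laffX laffC mulrC.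
rewrite E lcoefD lcoef_lmonM IH; last lia.
by rewrite add0r lcoefZ -lmon0 lcoef_lmon (gt_eqF m0) mulr0.
Qed.

Lemma lneg_laffP (w : laurent k) : lneg w -> exists q, w = laff q.
Proof.
move=> wn; have [a wa] := laurentP w.
have {wa} : ord_ge (- `|a|%N%:Z) w by apply: ord_ge_le wa; lia.
elim: `|a|%N w wn => [|N IH] w wn wN.
  exists (w 0)%:P; rewrite laffC; apply: laurent_ext => m; rewrite lcoefZ -lmon0 lcoef_lmon.
  have [->|m0] := eqVneq m 0; first by rewrite mulr1.
  rewrite mulr0; have [m1|m1] := ltP m 0; first by apply: wN; rewrite oppr0.
  by apply: wn; lia.
pose c := w (- N.+1%:Z); pose w' := w - c *: lmon k (- N.+1%:Z).
have [||q qE] := IH w'.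
- move=> m m0; rewrite lcoefB lcoefZ lcoef_lmon wn // (_ : _ == _ = false) ?mulr0 ?subrr //.
  lia.
- have : ord_ge (- N.+1%:Z + 1) w'.
    apply: ord_geS; first by apply: ord_geB => //; apply/ord_geZ/ord_lmon.
    by rewrite lcoefB lcoefZ lcoef_lmon eqxx mulr1 subrr.
  by apply: ord_ge_le; lia.
exists (q + c%:P * 'X^(N.+1)).
rewrite rmorphD rmorphM rmorphXn /= -qE laffX laffC lmonX -scalerAl mul1r mulN1r.
by rewrite /w' subrK.
Qed.

End RationalFunctionRings.

(** * The cover and its completion at infinity *)

Section CoverSections.
Variables (k : fieldType) (gT : finGroupType) (X : p1_cover k gT).
Local Notation L := (cov_fun X).
Local Notation ci := (cov_incl X).
Local Notation ca := (cov_act X).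
Local Notation cd := (cov_d X).
Local Notation x := (ci (rat_x k)).
Local Notation y := (ci (rat_x k)^-1).
Local Notation OU := (@sections k gT X (reg_affine k)).
Local Notation OV := (@sections k gT X (reg_infty k)).
Local Notation OUV := (@sections k gT X (reg_overlap k)).
Local Notation WU := (@omega_sections k gT X (reg_affine k)).
Local Notation WV := (@omega_sections k gT X (reg_infty k)).
Implicit Types (f u v : L) (g h : gT).

Lemma ci_xy : x * y = 1.
Proof. by rewrite -rmorphM mulfV ?rat_x_neq0 // rmorph1. Qed.

Lemma ca_ci g a : ca g (ci a) = ci a.
Proof. by have [_ /(_ (ci a))[+ _] _] := cov_galois X; case=> //; exists a. Qed.

Lemma ca_invariant f : (forall g, ca g f = f) -> exists a, f = ci a.
Proof.
move=> fG; have [_ /(_ f)[_ H] _] := cov_galois X.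
by have [|a _ af] := H; [split | exists a].
Qed.

Lemma covZ (c : k) f : c *: f = ci (rat_const c) * f.
Proof. by rewrite cov_inclA mulr_algl. Qed.

Lemma caZ g (c : k) f : ca g (c *: f) = c *: ca g f.
Proof. by rewrite !covZ rmorphM /= ca_ci. Qed.

Lemma image_range (T1 T2 T3 : Type) (h1 : T2 -> T3) (h2 : T1 -> T2) :
  h1 @` range h2 = range (h1 \o h2).
Proof.
by apply/seteqP; split=> [_ [_ [a _ <-] <-]|_ [a _ <-]]; [exists a | exists (h2 a) => //; exists a].
Qed.

Lemma image_subring (A : set (ratfun k)) : subring_set A -> subring_set (ci @` A).
Proof.
case=> A1 AB AM; split; first by exists 1; rewrite ?rmorph1.
  by move=> _ _ [a Aa <-] [b Ab <-]; exists (a - b); rewrite ?rmorphB //; apply: AB.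
by move=> _ _ [a Aa <-] [b Ab <-]; exists (a * b); rewrite ?rmorphM //; apply: AM.
Qed.

Lemma OU_subring : subring_set OU.
Proof.
by rewrite /sections reg_affineE image_range; apply: (integral_closure_subring (ci \o @rat_aff k)).
Qed.

Lemma OV_subring : subring_set OV.
Proof.
by rewrite /sections image_range; apply: (integral_closure_subring (ci \o @rat_poly k)).
Qed.

Lemma reg_affine_subring : subring_set (reg_affine k).
Proof. exact: (range_subring (@rat_aff k)). Qed.

Lemma reg_infty_subring : subring_set (reg_infty k).
Proof. exact: (range_subring (@rat_poly k)). Qed.

Lemma sections_const (A : set (ratfun k)) a : subring_set A -> A a -> @sections k gT X A (ci a).
Proof.
by move=> Ar Aa; apply: integral_closure_self; [apply: image_subring | exists a].
Qed.

Lemma OU_aff q : OU (ci (rat_aff q)).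
Proof. by apply: sections_const; [exact: reg_affine_subring | exists q]. Qed.

Lemma OV_poly q : OV (ci (rat_poly q)).
Proof. by apply: sections_const; [exact: reg_infty_subring | exists q]. Qed.

Lemma OU_scale (c : k) f : OU f -> OU (c *: f).
Proof.
by move=> Of; rewrite covZ -rat_affC; apply: (subring_setM OU_subring) => //; apply: OU_aff.
Qed.

Lemma OV_scale (c : k) f : OV f -> OV (c *: f).
Proof. by move=> Of; rewrite covZ; apply: (subring_setM OV_subring) => //; apply: OV_poly. Qed.

Lemma sections_act (A : set (ratfun k)) g f : @sections k gT X A f -> @sections k gT X A (ca g f).
Proof. by apply: integral_closure_morph => _ [a Aa <-]; exists a; rewrite ?ca_ci. Qed.

Lemma sections_sub (A A' : set (ratfun k)) : A `<=` A' -> @sections k gT X A `<=` @sections k gT X A'.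
Proof.
by move=> AA' f; apply: integral_closure_sub => _ [a Aa <-]; exists a => //; apply: AA'.
Qed.

Lemma ci_rat_xX n : ci (rat_poly 'X^n) = x ^+ n.
Proof. by rewrite !rmorphXn. Qed.

Lemma OUV_P f : OUV f <-> exists N, OV (x ^+ N * f).
Proof.
split=> [OUVf|[N Of]].
  have [|||||_ [N ->]] := @integral_closure_localize L (ci @` reg_infty k) (ci @` reg_overlap k)
    [set s | exists N, s = x ^+ N] f _ _ _ _ _ OUVf; last by exists N.
  - exact/image_subring/reg_infty_subring.
  - by move=> _ [N ->]; exists (rat_poly 'X^N); [exists 'X^N | rewrite ci_rat_xX].
  - by exists 0%N; rewrite expr0.
  - by move=> _ _ [N ->] [M ->]; exists (N + M)%N; rewrite exprD.
  - move=> _ [_ [p [N ->]] <-]; exists (x ^+ N); first by exists N.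
    exists (rat_poly p); first by exists p.
    by rewrite -rmorphXn -rmorphM mulrC divfK // expf_neq0 // rat_x_neq0.
have -> : f = ci ((rat_x k)^-1 ^+ N) * (x ^+ N * f).
  by rewrite mulrA rmorphXn -exprMn [y * x]mulrC ci_xy expr1n mul1r.
apply: integral_closure_scale Of.
- exact/image_subring/reg_overlap_subring.
- by move=> _ [a [p _ <-] <-]; exists (rat_poly p) => //; apply: reg_infty_overlap; exists p.
- by exists ((rat_x k)^-1 ^+ N) => //; exists 1, N; rewrite rmorph1 mul1r exprVn.
Qed.

Lemma OUV_submodule : submodule (fun g => ca g : L -> L) OUV.
Proof.
split; last exact: sections_act.
- by apply/OUV_P; exists 0%N; rewrite mulr0; apply: subring_set0 OV_subring.
- move=> c u v /OUV_P[N uN] /OUV_P[M vM]; apply/OUV_P; exists (N + M)%N.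
  rewrite mulrDr -scalerAr; apply: (subring_setD OV_subring).
    apply: OV_scale; rewrite exprD mulrAC.
    by apply: (subring_setM OV_subring) => //; rewrite -ci_rat_xX; apply: OV_poly.
  by rewrite exprD -mulrA; apply: (subring_setM OV_subring) => //; rewrite -ci_rat_xX;
    apply: OV_poly.
Qed.

Lemma cov_d1 : cd 1 = 0.
Proof. by apply: (addrI (cd 1)); rewrite addr0 -{3}[1]mulr1 cov_dM !mul1r. Qed.

Lemma cov_d_const c : cd (ci (rat_const c)) = 0.
Proof. by rewrite cov_inclA linearZ /= cov_d1 scaler0. Qed.

Lemma cov_d_poly q : cd (ci (rat_poly q)) = ci (rat_poly q^`()).
Proof.
elim/poly_ind: q => [|q c IH]; first by rewrite deriv0 !rmorph0 linear0.
rewrite !rmorphD !rmorphM /= linearD /= cov_dM -!/(rat_x k) -/(rat_const c) cov_dx cov_d_const.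
rewrite addr0 IH derivMXaddC !rmorphD !rmorphM /= -/(rat_x k) mulr1; congr (_ + _).
by rewrite mulrC.
Qed.

Lemma cov_d_aff q : cd (ci (rat_aff q)) = - (y ^+ 2 * ci (rat_aff q^`())).
Proof.
have dy : cd y = - y ^+ 2.
  have := congr1 cd ci_xy; rewrite cov_dM cov_dx cov_d1 mulr1 => /eqP.
  rewrite addr_eq0 => /eqP E; rewrite -[LHS]mul1r -ci_xy mulrAC E mulNr expr2; congr (- (_ * _)).
elim/poly_ind: q => [|q c IH]; first by rewrite deriv0 !rmorph0 linear0 mulr0 oppr0.
rewrite !rmorphD !rmorphM /= linearD /= cov_dM rat_affX rat_affC dy IH cov_d_const addr0.
by rewrite derivMXaddC !rmorphD !rmorphM /= rat_affX; ring.
Qed.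

Lemma cov_d_ci a : exists b, cd (ci a) = ci b.
Proof.
have [p [q [q0 E]]] := fraction_numden a; rewrite -!/(rat_poly _) in E.
have qn0 : rat_poly q != 0 by rewrite rat_poly_eq0.
exists ((rat_poly q)^-1 * (rat_poly p^`() - a * rat_poly q^`())).
have : cd (ci a * ci (rat_poly q)) = cd (ci (rat_poly p)) by rewrite -rmorphM /= E.
rewrite cov_dM !cov_d_poly => /eqP; rewrite addrC eq_sym -subr_eq => /eqP E'.
rewrite rmorphM rmorphB [in RHS]rmorphM /= E' mulrA -rmorphM mulVf //.
by rewrite rmorph1 mul1r.
Qed.

Lemma cov_d_act g f : cd (ca g f) = ca g (cd f).
Proof.
have [_ _ [n [u [v [_ _ uv]]]]] := cov_galois X.
rewrite (derivation_formula uv (phi := ca g) (D := fun a => cd (ca g a))); first last.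
- by move=> a b; rewrite rmorphM cov_dM.
- by move=> a b; rewrite rmorphD linearD.
rewrite [RHS](derivation_formula uv (phi := ca g) (D := fun a => ca g (cd a))); first last.
- by move=> a b; rewrite cov_dM rmorphD !rmorphM.
- by move=> a b; rewrite linearD rmorphD.
apply: eq_bigr => i _; apply: eq_bigr => j _; congr (_ * _).
have [a ->] : exists a, galois_trace ca (v j * (f * u i)) = ci a.
  by apply: ca_invariant => h; apply: ract_trace.
by rewrite ca_ci; have [b ->] := cov_d_ci a; rewrite ca_ci.
Qed.

Lemma omega_sections0 A : @omega_sections k gT X A 0.
Proof. by exists 0%N, (fun=> 0), (fun=> 0); split=> [[]|[]|]; rewrite ?big_ord0. Qed.

Lemma omega_sectionsD A u v : @omega_sections k gT X A u -> @omega_sections k gT X A v ->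
  @omega_sections k gT X A (u + v).
Proof.
move=> [n [a [b [aA bA ->]]]] [m [a' [b' [aA' bA' ->]]]].
exists (n + m)%N, (fun i => match fintype.split i with inl j => a j | inr j => a' j end),
  (fun i => match fintype.split i with inl j => b j | inr j => b' j end); split.
- by move=> i; case: fintype.split.
- by move=> i; case: fintype.split.
rewrite big_split_ord /=; congr (_ + _); apply: eq_bigr => i _.
  by rewrite (unsplitK (inl i)).
by rewrite (unsplitK (inr i)).
Qed.

Lemma omega_sectionsM A c u : (forall f, @sections k gT X A f -> @sections k gT X A (c * f)) ->
  @omega_sections k gT X A u -> @omega_sections k gT X A (c * u).
Proof.
move=> cA [n [a [b [aA bA ->]]]]; exists n, (fun i => c * a i), b; split=> // [i|].
  exact: cA.
by rewrite mulr_sumr; apply: eq_bigr => i _; rewrite mulrA.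
Qed.

Lemma omega_sections_act A g u : @omega_sections k gT X A u -> @omega_sections k gT X A (ca g u).
Proof.
move=> [n [a [b [aA bA ->]]]]; exists n, (fun i => ca g (a i)), (fun i => ca g (b i)).
split=> [i|i|]; [exact: sections_act | exact: sections_act |].
by rewrite rmorph_sum; apply: eq_bigr => i _; rewrite rmorphM /= cov_d_act.
Qed.

Lemma WV_submodule : submodule (fun g => ca g : L -> L) WV.
Proof.
split; [exact: omega_sections0 | | exact: omega_sections_act].
move=> c u v uW vW; apply: omega_sectionsD => //; rewrite covZ.
by apply: omega_sectionsM => // f; rewrite -covZ; apply: OV_scale.
Qed.

Lemma WU_submodule : submodule (fun g => ca g : L -> L) WU.
Proof.
split; [exact: omega_sections0 | | exact: omega_sections_act].
move=> c u v uW vW; apply: omega_sectionsD => //; rewrite covZ.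
by apply: omega_sectionsM => // f; rewrite -covZ; apply: OU_scale.
Qed.

Lemma WV_M c u : OV c -> WV u -> WV (c * u).
Proof. by move=> Oc; apply: omega_sectionsM => f; apply: (subring_setM OV_subring). Qed.

Lemma WV_d u : OV u -> WV (cd u).
Proof.
move=> Ou; exists 1%N, (fun=> 1), (fun=> u); split=> //; last by rewrite big_ord1 mul1r.
by move=> _; apply: subring_set1 OV_subring.
Qed.

Lemma WU_d u : OU u -> WU (cd u).
Proof.
move=> Ou; exists 1%N, (fun=> 1), (fun=> u); split=> //; last by rewrite big_ord1 mul1r.
by move=> _; apply: subring_set1 OU_subring.
Qed.

Lemma OV_WV u : OV u -> WV u.
Proof.
move=> Ou; rewrite -[u]mulr1 -(cov_dx X); apply: WV_M => //; apply: WV_d.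
exact: OV_poly.
Qed.

Hypothesis unram : unramified_off_infty X.

Lemma OU_invariant f : OU f -> (forall g, ca g f = f) -> exists q, f = ci (rat_aff q).
Proof.
move=> Of fG; have [_ /(_ f)[_ H] _] := unram.
by have [|_ [q _ <-] <-] := H; [split | exists q].
Qed.

Lemma OU_theta : exists2 theta, OU theta & galois_trace ca theta = 1.
Proof. exact: galois_trace_one OU_subring unram. Qed.

(* The bases u, v of the etale extension OU / k[y] reduce the claim to the
   derivatives of polynomials in y, where dy = - y^2 dx. *)
Lemma OU_d f : OU f -> exists2 o, OU o & cd f = y ^+ 2 * o.
Proof.
move=> Of; have [_ _ [n [u [v [uO vO uv]]]]] := unram.
have OM := subring_setM OU_subring.
pose P a := exists2 o, OU o & a = y ^+ 2 * o.
have P0 : P 0 by exists 0; [exact: subring_set0 OU_subring | rewrite mulr0].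
have PD a b : P a -> P b -> P (a + b).
  move=> [o Oo ->] [o' Oo' ->]; exists (o + o'); last by rewrite mulrDr.
  exact: (subring_setD OU_subring).
rewrite (derivation_formula uv (phi := idfun) (D := cd)); first last.
- exact: cov_dM.
- by move=> a b; rewrite linearD.
apply: (big_ind P) => // i _; apply: (big_ind P) => // j _.
have [q ->] : exists q, galois_trace ca (v j * (f * u i)) = ci (rat_aff q).
  apply: OU_invariant => [|g]; last exact: ract_trace.
  apply: (subring_set_sum OU_subring) => g _; apply: sections_act.
  by apply: (OM) => //; apply: OM.
exists (- (u j * v i * ci (rat_aff q^`()))).
  by apply: (subring_setN OU_subring); apply: (OM); [apply: OM | apply: OU_aff].
by rewrite cov_d_aff !mulrN mulrCA.
Qed.

Lemma WU_P w : WU w <-> exists2 o, OU o & w = y ^+ 2 * o.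
Proof.
split=> [[n [a [b [aO bO ->]]]]|[o Oo ->]].
  have H i : exists o, OU o /\ cd (b i) = y ^+ 2 * o by have [o ? ?] := OU_d (bO i); exists o.
  have [o oP] := choice H; exists (\sum_i a i * o i).
    apply: (subring_set_sum OU_subring) => i _.
    by apply: (subring_setM OU_subring) => //; have [] := oP i.
  by rewrite mulr_sumr; apply: eq_bigr => i _; have [_ ->] := oP i; rewrite mulrCA.
have -> : y ^+ 2 * o = - o * cd y.
  by rewrite -rat_affX cov_d_aff derivX rat_affX !rmorph1 mulr1 mulrNN mulrC.
apply: omega_sectionsM => [f Of|]; last by apply: WU_d; rewrite -rat_affX; apply: OU_aff.
by apply: (subring_setM OU_subring) => //; apply: (subring_setN OU_subring).
Qed.

End CoverSections.
Lemma lpoly_eq0 (k : fieldType) (q : {poly k}) : (lpoly q == 0) = (q == 0).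
Proof. by rewrite -(rmorph0 (@lpoly k)) (inj_eq (@lpoly_inj k)). Qed.

Section Completion.
Variables (k : fieldType) (gT : finGroupType) (X : p1_cover k gT).
Variables (r : nat) (B : local_galois k gT r).
Local Notation L := (cov_fun X).
Local Notation V := (lprod k r).
Local Notation ci := (cov_incl X).
Local Notation ca := (cov_act X).
Local Notation cd := (cov_d X).
Local Notation act := (loc_act B).
Local Notation incl := (loc_incl B).
Local Notation t := (lX k).
Local Notation xi := (lprod_d (incl t)).
Local Notation e := (ram_e B).
Local Notation x := (ci (rat_x k)).
Local Notation y := (ci (rat_x k)^-1).
Local Notation OV := (@sections k gT X (reg_infty k)).
Local Notation Oloc := (@sections k gT X (local_ring_infty k)).
Local Notation WV := (@omega_sections k gT X (reg_infty k)).
Implicit Types (f u v : L) (g h : gT).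

Variable loc : {rmorphism L -> V}.
Hypothesis locP : forall q : {poly k}, loc (ci (rat_poly q)) = incl (lpoly q).
Hypothesis locA : forall g f, loc (ca g f) = act g (loc f).

Lemma loc_x : loc x = incl t.
Proof. by rewrite locP lpolyX. Qed.

Lemma loc_xX N : loc (x ^+ N) = incl (lmon k N%:Z).
Proof. by rewrite rmorphXn /= loc_x -rmorphXn /= lXX. Qed.

Lemma loc_y : loc y = incl (lmon k (- 1)).
Proof.
have tN : incl t * incl (lmon k (- 1)) = 1 by rewrite -rmorphM lX_mon lmonM subrr lmon0 rmorph1.
have xy : loc x * loc y = 1 by rewrite -rmorphM ci_xy rmorph1.
by rewrite -[LHS]mul1r -tN mulrAC -loc_x xy mul1r.
Qed.

Lemma loc_frac a (p q : {poly k}) : a * rat_poly q = rat_poly p ->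
  loc (ci a) * incl (lpoly q) = incl (lpoly p).
Proof. by move=> E; rewrite -!locP -rmorphM -rmorphM E. Qed.

Lemma locZ (c : k) f : loc (c *: f) = c *: loc f.
Proof.
rewrite covZ rmorphM /= locP -[c%:P]alg_polyC lpolyZ lpoly1 loc_inclZ rmorph1.
by rewrite -lprod_scalerAl mul1r.
Qed.

Lemma loc_aff q : loc (ci (rat_aff q)) = incl (laff q).
Proof.
elim/poly_ind: q => [|q c IH]; first by rewrite !rmorph0.
rewrite !rmorphD !rmorphM /= IH rat_affX rat_affC laffX laffC loc_y loc_inclZ rmorph1.
by rewrite cov_inclA locZ rmorph1.
Qed.

Lemma loc_inj : injective loc.
Proof.
move=> a b ab; apply/eqP; rewrite -subr_eq0; apply/eqP.
have c0 : loc (a - b) = 0 by rewrite rmorphB ab subrr.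
move: (a - b) c0 => {a b ab} c c0.
have [_ _ [n [u [v [_ _ uv]]]]] := cov_galois X.
rewrite (galois_expand_l uv c); apply: big1 => i _.
have [a aE] : exists a, galois_trace ca (v i * c) = ci a.
  by apply: ca_invariant => h; apply: ract_trace.
have [a0|a0] := eqVneq a 0; first by rewrite aE a0 rmorph0 mulr0.
have : loc (ci a) = 0.
  rewrite -aE /galois_trace rmorph_sum big1 // => g _.
  by rewrite /= locA rmorphM c0 mulr0 rmorph0.
move=> E; have : loc (ci (a^-1 * a)) = 0 by rewrite !rmorphM /= E mulr0.
rewrite mulVf // !rmorph1 => /(congr1 (fun f : V => f ord0)) E1.
by case/eqP: (oner_neq0 (laurent k)).
Qed.

Lemma loc_d f : lprod_d (loc f) = loc (cd f) * xi.
Proof.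
have [_ _ [n [u [v [_ _ uv]]]]] := cov_galois X.
rewrite (derivation_formula uv (phi := loc) (D := fun a => lprod_d (loc a))); first last.
- by move=> a b; rewrite rmorphM lprod_dM.
- by move=> a b; rewrite rmorphD lprod_dD.
rewrite [RHS](derivation_formula uv (phi := loc) (D := fun a => loc (cd a) * xi)); first last.
- by move=> a b; rewrite cov_dM rmorphD !rmorphM mulrDl !mulrA.
- by move=> a b; rewrite linearD rmorphD mulrDl.
apply: eq_bigr => i _; apply: eq_bigr => j _; congr (_ * _).
have [a ->] : exists a, galois_trace ca (v j * (f * u i)) = ci a.
  by apply: ca_invariant => h; apply: ract_trace.
have [p [q [q0 E]]] := fraction_numden a; rewrite -!/(rat_poly _) in E.
have qn0 : lpoly q != 0 by rewrite lpoly_eq0.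
have poly_d s : lprod_d (loc (ci (rat_poly s))) = loc (cd (ci (rat_poly s))) * xi.
  by rewrite cov_d_poly !locP lprod_d_incl lderiv_lpoly.
have E' : ci a * ci (rat_poly q) = ci (rat_poly p) by rewrite -rmorphM E.
have H : loc (ci (rat_poly q)) * (lprod_d (loc (ci a)) - loc (cd (ci a)) * xi) = 0.
  have := poly_d p; rewrite -E' cov_dM rmorphM lprod_dM rmorphD !rmorphM /= poly_d.
  by rewrite mulrDl !mulrA => /addrI E1; rewrite mulrBr E1 mulrA subrr.
apply/eqP; rewrite -subr_eq0 -[X in X == _]mul1r -(rmorph1 incl) -(mulVf qn0) rmorphM.
by rewrite -locP -mulrA H mulr0.
Qed.

Lemma loc_OV f : OV f -> lprod_ge 0 (loc f).
Proof.
rewrite -(loc_integral B); apply: integral_closure_morph => _ [_ [q _ <-] <-].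
by rewrite locP; exists (lpoly q) => //; apply: ord_lpoly.
Qed.

Lemma lpoly_unit (q : {poly k}) : q.[0] != 0 -> ord_ge 0 (lpoly q)^-1.
Proof.
move=> q0; have qE : lpoly q 0 = q.[0] by rewrite horner_coef0.
by have := ord_geV (ord_lpoly q); rewrite qE oppr0; apply.
Qed.

Lemma loc_WV w : WV w -> lprod_ge 0 (loc w * xi).
Proof.
move=> [n [a [b [aO bO ->]]]]; rewrite rmorph_sum mulr_suml; apply: lprod_ge_sum => i _.
rewrite rmorphM -mulrA -loc_d -[0]addr0; apply: lprod_geM; first exact: loc_OV.
exact/lprod_ge_d0/loc_OV.
Qed.

Lemma glue_zero_pole (P : set L) f N (s : {poly k}) :
    (forall u v, P u -> P v -> P (u - v)) ->
    (forall q u, P u -> P (ci (rat_poly q) * u)) ->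
    s.[0] != 0 -> P (x ^+ N * f) -> P (ci (rat_poly s) * f) ->
  P f.
Proof.
move=> PB PM s0; elim: N f => [|N IH] f; first by rewrite expr0 mul1r.
move=> Px Ps; apply: IH => //.
have [s1 s1E] : exists s1, s = s1 * 'X + s.[0]%:P.
  have /factor_theorem[s1 E] : root (s - s.[0]%:P) 0 by rewrite /root !hornerE subrr.
  by exists s1; rewrite polyC0 subr0 in E; rewrite -E subrK.
have -> : x ^+ N * f = ci (rat_poly (s.[0]^-1)%:P) *
    (ci (rat_poly 'X^N) * (ci (rat_poly s) * f) - ci (rat_poly s1) * (x ^+ N.+1 * f)).
  have cs : ci (rat_poly (s.[0]^-1)%:P) * ci (rat_poly s.[0]%:P) = 1.
    by rewrite -rmorphM -rmorphM -polyCM mulVf // !rmorph1.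
  rewrite {2}s1E ci_rat_xX !rmorphD !rmorphM /= -/(rat_x k) exprS.
  rewrite -[LHS]mul1r -cs; ring.
by apply: (PM); apply: (PB); apply: PM.
Qed.

Section Basis.
Variables (n : nat) (b : 'I_n -> L).
Hypothesis bG : free_basis (ci @` local_ring_infty k) Oloc b.
Hypothesis bL : free_basis (incl @` power_series k) (lprod_ge 0) (loc \o b).

Lemma loc_local_ring a : local_ring_infty k a ->
  exists p q : {poly k}, [/\ q.[0] != 0, a * rat_poly q = rat_poly p
    & loc (ci a) = incl (lpoly p / lpoly q)].
Proof.
move=> [[p q] /= q0 ->]; exists p, q.
have qn0 : rat_poly q != 0 by rewrite rat_poly_eq0; apply: contraNneq q0 => ->; rewrite horner0.
have ln0 : lpoly q != 0.
  by rewrite lpoly_eq0 -rat_poly_eq0.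
split=> //; first by rewrite divfK.
have E : rat_poly p / rat_poly q * rat_poly q = rat_poly p by rewrite divfK.
by rewrite [RHS]rmorphM /= -(loc_frac E) -mulrA -rmorphM mulfV // rmorph1 mulr1.
Qed.

Lemma Oloc_denominator f : Oloc f -> exists2 s : {poly k}, s.[0] != 0 & OV (ci (rat_poly s) * f).
Proof.
move=> Of; have [|||||_ [s [s0 ->]]] := @integral_closure_localize L (ci @` reg_infty k)
  (ci @` local_ring_infty k) [set c | exists s : {poly k}, s.[0] != 0 /\ c = ci (rat_poly s)]
  f _ _ _ _ _ Of; last by exists s.
- exact/image_subring/reg_infty_subring.
- by move=> _ [s [_ ->]]; exists (rat_poly s) => //; exists s.
- by exists 1; rewrite hornerE oner_neq0 !rmorph1.
- move=> _ _ [s [s0 ->]] [s' [s0' ->]]; exists (s * s').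
  by rewrite hornerM mulf_neq0 // !rmorphM.
- move=> _ [a /loc_local_ring[p [q [q0 E _]]] <-]; exists (ci (rat_poly q)).
    by exists q.
  by exists (rat_poly p); [exists p | rewrite -rmorphM mulrC E].
Qed.

Lemma function_denominator f : exists2 q : {poly k}, q != 0 & OV (ci (rat_poly q) * f).
Proof.
have Gf := galois_integral ca f.
have [|||||_ [s [s0 ->]]] := @integral_closure_localize L (ci @` reg_infty k)
  [set c | forall g, ca g c = c] [set c | exists s : {poly k}, s != 0 /\ c = ci (rat_poly s)]
  f _ _ _ _ _ Gf; last by exists s.
- exact/image_subring/reg_infty_subring.
- by move=> _ [s [_ ->]]; exists (rat_poly s) => //; exists s.
- by exists 1; rewrite oner_neq0 !rmorph1.
- move=> _ _ [s [s0 ->]] [s' [s0' ->]]; exists (s * s').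
  by rewrite mulf_neq0 // !rmorphM.
- move=> c /ca_invariant[a ->]; have [p [q [q0 E]]] := fraction_numden a.
  rewrite -!/(rat_poly _) in E.
  exists (ci (rat_poly q)); first by exists q.
  by exists (rat_poly p); [exists p | rewrite -rmorphM mulrC E].
Qed.

Lemma basis_denominator : exists2 s : {poly k}, s.[0] != 0 &
  forall i, OV (ci (rat_poly s) * b i).
Proof.
have H i : exists s : {poly k}, s.[0] != 0 /\ OV (ci (rat_poly s) * b i).
  by have [s ? ?] := Oloc_denominator (bG.1 i); exists s.
have [s sP] := choice H; exists (\prod_i s i) => [|i].
  by rewrite horner_prod; apply/prodf_neq0 => i _; have [] := sP i.
rewrite (bigD1 i) //= rmorphM rmorphM /= mulrAC mulrC.
by apply: (subring_setM (OV_subring X)); [apply: OV_poly | have [] := sP i].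
Qed.

(* If x^m f is regular at oo and f is so in the completion, then the coordinates
   of x^m f in the common basis b are divisible by x^m. *)
Lemma regular_infty f : lprod_ge 0 (loc f) ->
  exists2 s : {poly k}, s.[0] != 0 & OV (ci (rat_poly s) * f).
Proof.
move=> f0; have [q q0 qf] := function_denominator f.
have [m [s0]] := multiplicity_XsubC q 0; rewrite q0 /root /= => s00 qE.
rewrite polyC0 subr0 in qE.
have s0n : rat_poly s0 != 0 by rewrite rat_poly_eq0; apply: contraNneq s00 => ->; rewrite horner0.
have xf : Oloc (x ^+ m * f).
  have -> : x ^+ m * f = ci (rat_poly s0)^-1 * (ci (rat_poly q) * f).
    have s0V : ci (rat_poly s0)^-1 * ci (rat_poly s0) = 1 by rewrite -rmorphM mulVf // rmorph1.
    by rewrite qE !rmorphM !mulrA s0V mul1r !rmorphXn.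
  apply: integral_closure_scale qf.
  - exact/image_subring/local_ring_subring.
  - by move=> _ [a aA <-]; exists a => //; apply: reg_infty_local.
  - by exists (rat_poly s0)^-1 => //; exists (1, s0) => //=; rewrite rmorph1 mul1r.
have [a [[aA aE] _]] := bG.2 _ xf.
have [c [[cA cE] _]] := bL.2 _ f0.
have [w wP] : exists w : 'I_n -> laurent k, forall i, ord_ge 0 (w i) /\ c i = incl (w i).
  have H i : exists w, ord_ge 0 w /\ c i = incl w by have [w w0 <-] := cA i; exists w.
  by have [w wP] := choice H; exists w.
have [a' a'P] : exists a' : 'I_n -> ratfun k, forall i, local_ring_infty k (a' i) /\ a i = ci (a' i).
  have H i : exists a', local_ring_infty k a' /\ a i = ci a' by have [a' ? <-] := aA i; exists a'.
  by have [a' a'P] := choice H; exists a'.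
have H i : exists pq : {poly k} * {poly k}, pq.2.[0] != 0 /\
    ci (rat_poly pq.2) * a i = x ^+ m * ci (rat_poly pq.1).
  have [[w0 wE] [a'L a'E]] := (wP i, a'P i).
  have [p [q' [q'0 pq locE]]] := loc_local_ring a'L.
  have q'n : lpoly q' != 0.
    by rewrite lpoly_eq0; apply: contraNneq q'0 => ->; rewrite horner0.
  have locai : lpoly p / lpoly q' = lmon k m%:Z * w i.
    have xf0 : lprod_ge 0 (loc (x ^+ m * f)).
      rewrite rmorphM loc_xX -[0]addr0; apply: lprod_geM => //; apply: incl_ge0.
      by apply: ord_ge_le (ord_lmon _); lia.
    have [d [_ dU]] := bL.2 _ xf0.
    have E1 : d = fun l => loc (a l).
      apply: dU; split=> [l|]; last first.
        by rewrite aE rmorph_sum; apply: eq_bigr => l _; rewrite rmorphM.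
      have [a'l a'lE] := a'P l; have [p' [q'' [q''0 _ E]]] := loc_local_ring a'l.
      exists (lpoly p' / lpoly q''); last by rewrite a'lE E.
      by have := ord_geM (ord_lpoly p') (lpoly_unit q''0); rewrite addr0.
    have E2 : d = fun l => incl (lmon k m%:Z * w l).
      apply: dU; split=> [l|].
        have [wl _] := wP l; exists (lmon k m%:Z * w l) => //.
        by apply: ord_ge_le (ord_geM (ord_lmon _) wl); lia.
      rewrite rmorphM loc_xX cE mulr_sumr; apply: eq_bigr => l _.
      by have [_ ->] := wP l; rewrite rmorphM mulrA.
    apply: (@incl_inj _ _ _ B); rewrite -locE -a'E.
    by have := congr1 (fun F => F i) E2; rewrite E1.
  have pE : lpoly p = lmon k m%:Z * (w i * lpoly q').
    by rewrite mulrA -locai divfK.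
  have [p1 p1E] : exists p1, p = p1 * 'X^m.
    exists (drop_poly m p); rewrite -[LHS](poly_take_drop m) [X in X + _](_ : _ = 0) ?add0r //.
    apply/polyP => j; rewrite coef_take_poly coef0; case: ifP => // jm.
    have -> : p`_j = lpoly p j%:Z by [].
    rewrite pE lcoef_lmonM; apply: (ord_geM w0 (ord_lpoly q')).
    by rewrite addr0; lia.
  exists (p1, q'); split=> //=; rewrite a'E -rmorphM mulrC pq p1E !rmorphM !rmorphXn /=.
  by rewrite mulrC.
have [pq pqP] := choice H.
have [s s0' sb] := basis_denominator.
exists (\prod_i (pq i).2 * s).
  by rewrite hornerM horner_prod mulf_neq0 //; apply/prodf_neq0 => i _; have [] := pqP i.
have xV : y ^+ m * x ^+ m = 1 by rewrite -exprMn mulrC ci_xy expr1n.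
have fE : f = \sum_i y ^+ m * (a i * b i).
  by rewrite -mulr_sumr -aE mulrA xV mul1r.
rewrite [X in _ * X]fE mulr_sumr; apply: (subring_set_sum (OV_subring X)) => i _.
have [_ aiE] := pqP i.
have -> : ci (rat_poly (\prod_i (pq i).2 * s)) * (y ^+ m * (a i * b i)) =
    ci (rat_poly (\prod_(j | j != i) (pq j).2)) * (ci (rat_poly (pq i).1) * (ci (rat_poly s) * b i)).
  rewrite (bigD1 i) //= !rmorphM /=.
  transitivity (y ^+ m * (ci (rat_poly (pq i).2) * a i) *
    (ci (rat_poly (\prod_(j | j != i) (pq j).2)) * (ci (rat_poly s) * b i))); first by ring.
  by rewrite aiE [y ^+ m * _]mulrA xV mul1r; ring.
by do 2 (apply: (subring_setM (OV_subring X)); first exact: OV_poly).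
Qed.

Lemma regular_OV f N : OV (x ^+ N * f) -> lprod_ge 0 (loc f) -> OV f.
Proof.
move=> xf /regular_infty[s s0 sf]; apply: (glue_zero_pole _ _ s0 xf sf) => [u v|q u Ou].
  exact: (subring_setB (OV_subring X)).
by apply: (subring_setM (OV_subring X)) => //; apply: OV_poly.
Qed.

Lemma loc_dense (u : V) (m : nat) : exists f N, OV (x ^+ N * f) /\ lprod_ge m%:Z (loc f - u).
Proof.
have [M uM] := lprod_ge_ex u.
have u0 : lprod_ge 0 (incl (lmon k M%:Z) * u).
  by apply: lprod_ge_le (lprod_geM (@incl_lmon_ge _ _ _ B M%:Z) uM); have := ram_e_gt0 B; nia.
have [c [[cA cE] _]] := bL.2 _ u0.
have [w wP] : exists w : 'I_n -> laurent k, forall i, ord_ge 0 (w i) /\ c i = incl (w i).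
  have H i : exists w, ord_ge 0 w /\ c i = incl w by have [w w0 <-] := cA i; exists w.
  by have [w wP] := choice H; exists w.
have [s s0 sb] := basis_denominator.
have sn : lpoly s != 0 by rewrite lpoly_eq0; apply: contraNneq s0 => ->; rewrite horner0.
have H i : exists q, ord_ge (M + m)%N%:Z (w i / lpoly s - lpoly q).
  apply: lpoly_truncate; have [w0 _] := wP i.
  by have := ord_geM w0 (lpoly_unit s0); rewrite addr0.
have [q qP] := choice H.
pose f0 := \sum_i ci (rat_poly (q i)) * (ci (rat_poly s) * b i).
have f0O : OV f0.
  apply: (subring_set_sum (OV_subring X)) => i _.
  by apply: (subring_setM (OV_subring X)) => //; apply: OV_poly.
have xV : y ^+ M * x ^+ M = 1 by rewrite -exprMn mulrC ci_xy expr1n.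
exists (y ^+ M * f0), M; split; first by rewrite mulrA [x ^+ M * _]mulrC xV mul1r.
have locyM : loc (y ^+ M) * incl (lmon k M%:Z) = 1 by rewrite -loc_xX -rmorphM xV rmorph1.
have -> : loc (y ^+ M * f0) - u = loc (y ^+ M) * (loc f0 - incl (lmon k M%:Z) * u).
  by rewrite mulrBr mulrA locyM mul1r rmorphM.
have locy : lprod_ge (- (e * M)%N%:Z) (loc (y ^+ M)).
  rewrite rmorphXn /= loc_y -rmorphXn /= lmonX mulN1r.
  by apply: lprod_ge_le (@incl_lmon_ge _ _ _ B _); lia.
have f0u : lprod_ge (e%:Z * (M + m)%N%:Z) (loc f0 - incl (lmon k M%:Z) * u).
  rewrite cE rmorph_sum -sumrB; apply: lprod_ge_sum => i _; have [_ ->] := wP i.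
  have -> : loc (ci (rat_poly (q i)) * (ci (rat_poly s) * b i)) - incl (w i) * (loc \o b) i =
      incl (lpoly (q i) - w i / lpoly s) * (incl (lpoly s) * loc (b i)).
    rewrite !rmorphM /= !locP rmorphB mulrBl; congr (_ - _).
    by rewrite mulrA -rmorphM divfK.
  rewrite -[e%:Z * _]addr0; apply: lprod_geM.
    by apply: incl_ge; rewrite -opprB; apply: ord_geN; apply: qP.
  rewrite -[0]addr0; apply: lprod_geM; first exact/incl_ge0/ord_lpoly.
  exact: bL.1.
apply: lprod_ge_le (lprod_geM locy f0u); have := ram_e_gt0 B; nia.
Qed.

Lemma loc_unit f (v : V) : loc f * v = 1 -> exists f', f * f' = 1.
Proof.
move=> fv; have [a aE] : exists a, \prod_g ca g f = ci a.
  apply: ca_invariant => g; rewrite rmorph_prod [RHS](reindex_inj (mulgI g)) /=.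
  by apply: eq_bigr => h _; rewrite ractM.
have a0 : a != 0.
  apply/eqP => a0; have : loc (ci a) * \prod_g act g v = 1.
    rewrite -aE rmorph_prod -big_split big1 // => g _ /=.
    by rewrite locA -rmorphM fv rmorph1.
  rewrite a0 !rmorph0 mul0r => /(congr1 (fun F : V => F ord0)) E.
  by case/eqP: (oner_neq0 (laurent k)); apply: esym E.
exists ((\prod_(g | g != 1%g) ca g f) * ci a^-1); rewrite mulrA.
move: aE; rewrite (bigD1 1%g) //= ract1 => ->.
by rewrite -rmorphM mulfV // rmorph1.
Qed.

(* A function tau approximating the uniformizers t_i is a local coordinate at oo,
   so that a differential regular in the completion is a multiple of d tau. *)
Lemma regular_WV w N : WV (x ^+ N * w) -> lprod_ge 0 (loc w * xi) -> WV w.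
Proof.
move=> xw w0; have [tau [M [xtau taut]]] := loc_dense (diag r t) 2.
have tO : OV tau.
  apply: regular_OV xtau _; rewrite -[loc tau](subrK (diag r t)); apply: lprod_geD.
    exact: lprod_ge_le taut.
  exact/lprod_ge_diag/ord_t0.
have du1 : lprod_ge 1 (loc (cd tau) * xi - 1).
  by rewrite -loc_d -(lprod_d_lX k r) -lprod_dB; apply: lprod_ge_d taut.
set u := loc (cd tau) * xi in du1.
have u0 : lprod_ge 0 u.
  by rewrite -[u](subrK 1); apply: lprod_geD; [apply: lprod_ge_le du1 | apply: lprod_ge1].
have u1 i : u i 0 = 1.
  have := du1 i 0 isT; rewrite -[LHS]/(u i 0 - (1 : laurent k) 0) -lmon0 lcoef_lmon eqxx.
  by move/eqP; rewrite subr_eq0 => /eqP.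
pose v : V := fun i => (u i)^-1.
have v0 : lprod_ge 0 v by move=> i; rewrite -oppr0; apply: ord_geV => //; rewrite u1 oner_neq0.
have uv : u * v = 1.
  apply/funext => i; apply: mulfV; apply/eqP => ui; have := u1 i; rewrite ui => /esym/eqP.
  by rewrite oner_eq0.
have [|f' f'E] := @loc_unit (cd tau) (xi * v); first by rewrite mulrA.
have wf0 : lprod_ge 0 (loc (w * f')).
  suff -> : loc (w * f') = loc w * xi * v by have := lprod_geM w0 v0; rewrite addr0.
  have f'v : loc (cd tau) * loc f' = 1 by rewrite -rmorphM f'E rmorph1.
  rewrite rmorphM -mulrA; congr (_ * _).
  by rewrite -[LHS]mulr1 -uv /u !mulrA [loc f' * _]mulrC f'v mul1r.
have [s s0 sO] := regular_infty wf0.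
apply: (glue_zero_pole _ _ s0 xw) => [a b'|q a|].
- by move=> aW bW; apply: (submoduleB (WV_submodule X)).
- by move=> aW; apply: WV_M => //; apply: OV_poly.
have -> : ci (rat_poly s) * w = ci (rat_poly s) * (w * f') * cd tau.
  by rewrite -!mulrA [f' * _]mulrC f'E mulr1.
by apply: WV_M => //; apply: WV_d.
Qed.

End Basis.

End Completion.
Section CoverModules.
Variables (k : fieldType) (gT : finGroupType) (X : p1_cover k gT).
Local Notation L := (cov_fun X).
Local Notation ca := (cov_act X).
Local Notation cd := (cov_d X).
Local Notation x := (cov_incl X (rat_x k)).
Local Notation OU := (@sections k gT X (reg_affine k)).
Local Notation OV := (@sections k gT X (reg_infty k)).
Local Notation OUV := (@sections k gT X (reg_overlap k)).
Local Notation WV := (@omega_sections k gT X (reg_infty k)).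
Implicit Types (f u v : L) (g h : gT).

Lemma ca_lin g (a : k) u v : ca g (a *: u + v) = a *: ca g u + ca g v.
Proof. by rewrite rmorphD /= caZ. Qed.

Lemma OUV_B u v : OUV u -> OUV v -> OUV (u - v).
Proof. exact: (submoduleB (OUV_submodule X)). Qed.

Lemma OU_OUV f : OU f -> OUV f.
Proof. exact/sections_sub/reg_affine_overlap. Qed.

Lemma OV_OUV f : OV f -> OUV f.
Proof. exact/sections_sub/reg_infty_overlap. Qed.

Lemma x_cov_dX N : x * cd (x ^+ N) = x ^+ N *+ N.
Proof.
elim: N => [|N IH]; first by rewrite expr0 cov_d1 mulr0 mulr0n.
by rewrite exprS cov_dM cov_dx mulr1 mulrDr IH mulrSr mulrnAr.
Qed.

Lemma OUV_WV_pole f : OUV f -> exists N, WV (x ^+ N * f) /\ WV (x ^+ N * cd f).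
Proof.
move=> /OUV_P[N Of]; exists N.+1.
have xO : OV x by apply: OV_poly.
split; first by rewrite exprS -mulrA; apply: WV_M => //; apply: OV_WV.
have -> : x ^+ N.+1 * cd f = x * cd (x ^+ N * f) - (x ^+ N * f) *+ N.
  by rewrite cov_dM mulrDr [x * (f * _)]mulrCA x_cov_dX mulrA -exprS -mulrnAr [f * _]mulrC
    mulrnAl mulrnAr addrK.
apply: (submoduleB (WV_submodule X)); first by apply: WV_M => //; apply: WV_d.
rewrite -scaler_nat; apply: (submoduleZ _ (WV_submodule X)); exact: OV_WV.
Qed.

Lemma H0_Omega_wf : subquotient_wf (H0_Omega X).
Proof.
have [U0 UD Ua] := WU_submodule X; have [V0 VD Va] := WV_submodule X.
split=> /=; first exact: ca_lin.
- by split; [exact: ract1 | exact: ractM].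
- split; [by split | |].
    by move=> a u v [uU uV] [vU vV]; split; [apply: UD | apply: VD].
  by move=> g u [uU uV]; split; [apply: Ua | apply: Va].
- by split=> // [a u v -> ->|g u ->]; rewrite ?scaler0 ?addr0 ?rmorph0.
- by move=> _ ->; split.
Qed.

Lemma H1_O_wf : subquotient_wf (H1_O X).
Proof.
have OUr := OU_subring X; have OVr := OV_subring X.
split=> /=; first exact: ca_lin.
- by split; [exact: ract1 | exact: ractM].
- exact: OUV_submodule.
- split.
  + by exists 0, 0; rewrite subrr; split=> //; apply: subring_set0.
  + move=> a _ _ [fU [fV [Uf Vf ->]]] [fU' [fV' [Uf' Vf' ->]]].
    exists (a *: fU + fU'), (a *: fV + fV'); split.
    * by apply: (subring_setD OUr) => //; apply: OU_scale.
    * by apply: (subring_setD OVr) => //; apply: OV_scale.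
    * by rewrite scalerBr opprD addrACA.
  + move=> g _ [fU [fV [Uf Vf ->]]]; exists (ca g fU), (ca g fV).
    by rewrite rmorphB; split=> //; apply: sections_act.
- by move=> _ [fU [fV [Uf Vf ->]]]; apply: OUV_B; [apply: OU_OUV | apply: OV_OUV].
Qed.

Lemma H1_dR_wf : subquotient_wf (H1_dR X).
Proof.
have OUr := OU_subring X; have OVr := OV_subring X.
have [U0 UD Ua] := WU_submodule X; have [V0 VD Va] := WV_submodule X.
have [O0 OD Oa] := OUV_submodule X.
split=> /=.
- by move=> g a [[u1 u2] u3] [[v1 v2] v3] /=; rewrite !ca_lin.
- by split=> [[[u1 u2] u3]|g h [[u1 u2] u3]] /=; rewrite ?ract1 ?ractM.
- split=> [|a [[u1 u2] u3] [[v1 v2] v3] /= [u1U u2V uO E] [v1U v2V vO E']|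
    g [[u1 u2] u3] /= [u1U u2V uO E]].
  + by split=> //=; rewrite subrr linear0.
  + split; [exact: UD | exact: VD | exact: OD |].
    by rewrite opprD addrACA -scalerBr E E' linearP.
  + split; [exact: Ua | exact: Va | exact: Oa |].
    by rewrite -rmorphB E cov_d_act.
- split.
  + by exists 0, 0; rewrite subrr linear0; split=> //; apply: subring_set0.
  + move=> a _ _ [fU [fV [Uf Vf ->]]] [fU' [fV' [Uf' Vf' ->]]].
    exists (a *: fU + fU'), (a *: fV + fV'); split.
    * by apply: (subring_setD OUr) => //; apply: OU_scale.
    * by apply: (subring_setD OVr) => //; apply: OV_scale.
    * transitivity (a *: cd fU + cd fU', a *: cd fV + cd fV', a *: (fU - fV) + (fU' - fV')) => //.
      by rewrite !linearP /= scalerDr addrACA.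
  + move=> g _ [fU [fV [Uf Vf ->]]]; exists (ca g fU), (ca g fV) => /=.
    by rewrite !cov_d_act rmorphB; split=> //; apply: sections_act.
- move=> _ [fU [fV [Uf Vf ->]]] /=; split; [exact: WU_d | exact: WV_d | | by rewrite linearB].
  by apply: OUV_B; [apply: OU_OUV | apply: OV_OUV].
Qed.

End CoverModules.

(** * The isomorphisms *)

Section Isomorphisms.
Variables (k : fieldType) (p : nat) (gT : finGroupType) (X : p1_cover k gT).
Variables (r : nat) (B : local_galois k gT r) (z zv : lprod k r).
Local Notation L := (cov_fun X).
Local Notation V := (lprod k r).
Local Notation ci := (cov_incl X).
Local Notation ca := (cov_act X).
Local Notation cd := (cov_d X).
Local Notation act := (loc_act B).
Local Notation incl := (loc_incl B).
Local Notation t := (lX k).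
Local Notation xi := (lprod_d (incl t)).
Local Notation x := (ci (rat_x k)).
Local Notation y := (ci (rat_x k)^-1).
Local Notation OU := (@sections k gT X (reg_affine k)).
Local Notation OV := (@sections k gT X (reg_infty k)).
Local Notation OUV := (@sections k gT X (reg_overlap k)).
Local Notation Oloc := (@sections k gT X (local_ring_infty k)).
Local Notation WU := (@omega_sections k gT X (reg_affine k)).
Local Notation WV := (@omega_sections k gT X (reg_infty k)).
Local Notation tr := (galois_trace act).
Implicit Types (g h : gT).

Hypothesis chark : p \in [pchar k].
Hypothesis pG : (p.-group [set: gT]%SET)%g.
Hypothesis Dn : (decomp_group B <| [set: gT]%SET)%g.
Hypothesis unram : unramified_off_infty X.
Hypothesis magz : magical B z.
Hypothesis dualz : dual_element B z zv.
Variable loc : {rmorphism L -> V}.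
Hypothesis locP : forall q : {poly k}, loc (ci (rat_poly q)) = incl (lpoly q).
Hypothesis locA : forall g f, loc (ca g f) = act g (loc f).
Variables (n : nat) (b : 'I_n -> L).
Hypothesis bG : free_basis (ci @` local_ring_infty k) Oloc b.
Hypothesis bL : free_basis (incl @` power_series k) (lprod_ge 0) (loc \o b).

Local Notation O := (loc @` OU).
Local Notation M := (conj_sum B zv (max_A B)).
Local Notation N := (conj_sum B z (omega_A_log B)).

Let locI := loc_inj locA.

Lemma O_subring : subring_set O.
Proof.
have OUr := OU_subring X.
split; first by exists 1; rewrite ?rmorph1 //; apply: subring_set1.
  by move=> _ _ [u uO <-] [v vO <-]; exists (u - v); rewrite ?rmorphB //; apply: subring_setB.
by move=> _ _ [u uO <-] [v vO <-]; exists (u * v); rewrite ?rmorphM //; apply: subring_setM.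
Qed.

Lemma O_scale (c : k) (u : V) : O u -> O (c *: u).
Proof. by move=> [o oO <-]; exists (c *: o); rewrite ?(locZ locP) //; apply: OU_scale. Qed.

Lemma O_act g (u : V) : O u -> O (act g u).
Proof. by move=> [o oO <-]; exists (ca g o); rewrite ?locA //; apply: sections_act. Qed.

Lemma O_theta : exists2 theta : V, O theta & tr theta = 1.
Proof.
have [theta tO t1] := OU_theta unram; exists (loc theta); first by exists theta.
rewrite -(rmorph1 loc) -t1 /galois_trace rmorph_sum; apply: eq_bigr => g _.
by rewrite /= locA.
Qed.

Lemma O_inv (u : V) : O u -> (forall g, act g u = u) -> exists2 w, lneg w & u = incl w.
Proof.
move=> [o oO <-] oG; have [g|q ->] := OU_invariant unram oO.
  by apply: locI; rewrite locA.
by exists (laff q); [apply: lneg_laff | apply: loc_aff].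
Qed.

Lemma O_neg (w : laurent k) : lneg w -> O (incl w).
Proof.
by move=> /lneg_laffP[q ->]; exists (ci (rat_aff q)); [apply: OU_aff | apply: loc_aff].
Qed.

Lemma trz : exists a b, [/\ ord_ge 0 a, ord_ge 0 b, a * b = 1 & tr z = incl a].
Proof. exact: magical_trace magz. Qed.

Lemma trzv : exists a b, [/\ ord_ge 0 a, ord_ge 0 b, a * b = 1 & tr zv = incl a].
Proof.
have [a [c [a0 c0 ac aE]]] := trz; exists c, a; split; rewrite 1?mulrC //.
have := dual_trace dualz; rewrite aE => E.
by rewrite -[LHS]mul1r -(rmorph1 incl) -ac rmorphM mulrAC E mul1r.
Qed.

Let dualzv := dual_sym dualz.

Lemma M_disjoint u : M u -> O u -> u = 0.
Proof. exact: (conj_sum_disjoint chark pG O_subring O_scale O_act O_inv dualzv trzv). Qed.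

Lemma M_span u : exists a b, [/\ M a, O b & u = a + b].
Proof.
exact: (conj_sum_span chark pG O_subring O_scale O_act O_theta O_inv O_neg dualzv trzv).
Qed.

Lemma Mz_disjoint u : conj_sum B z (max_A B) u -> O u -> u = 0.
Proof. exact: (conj_sum_disjoint chark pG O_subring O_scale O_act O_inv dualz trz). Qed.

Lemma Mz_span u : exists a b, [/\ conj_sum B z (max_A B) a, O b & u = a + b].
Proof.
exact: (conj_sum_span chark pG O_subring O_scale O_act O_theta O_inv O_neg dualz trz).
Qed.

Let Mm := conj_sum_submodule dualzv.
Let Nm := omega_A_log_submodule dualz.

Lemma WU_loc w : WU w -> exists2 o, OU o & loc w * xi = incl (lmon k (- 2)) * loc o * xi.
Proof.
move=> /(WU_P unram)[o oO ->]; exists o => //.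
by rewrite rmorphM rmorphXn /= (loc_y locP) -rmorphXn /= lmonX.
Qed.

Lemma omega_span om : exists nu w, [/\ N nu, WU w & om = nu + loc w * xi].
Proof.
have [v ->] := omega_form B om; have [a [c [aM [o oO <-] ->]]] := Mz_span v.
exists (incl (lmon k (- 2)) * a * xi), (y ^+ 2 * o); split.
- exact/conj_sum_omegaE.
- by apply/(WU_P unram); exists o.
by rewrite mulrDr mulrDl rmorphM rmorphXn /= (loc_y locP) -rmorphXn /= lmonX.
Qed.

Lemma omega_disjoint w : WU w -> N (loc w * xi) -> w = 0.
Proof.
move=> Ww; have [o oO E] := WU_loc Ww; rewrite E => /conj_sum_omegaE oM.
have o0 : loc o = 0 by apply: Mz_disjoint => //; exists o.
apply: locI; rewrite rmorph0 -[LHS]mulr1 -(xi_mulV B) mulrA E o0.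
by rewrite mulr0 !mul0r.
Qed.

Lemma regular_residue w f : WU w -> OUV f ->
  omega_B_log (loc (w - cd f) * xi) -> WV (w - cd f).
Proof.
move=> Ww Of; have [o oO E] := WU_loc Ww.
rewrite rmorphB mulrBl -(loc_d locP) E => om.
have om0 := residue_zero chark pG O_subring O_scale O_act O_theta O_inv O_neg Dn magz
  (ex_intro2 _ _ o oO erefl) om.
have [N1 [_ N1f]] := OUV_WV_pole Of.
have [N2 N2w] : exists N2, WV (x ^+ N2 * w).
  move/(WU_P unram): Ww => [o' o'O ->]; have [N2 [N2o _]] := OUV_WV_pole (OU_OUV o'O).
  exists (N2 + 2)%N; rewrite exprD -mulrA [x ^+ 2 * _]mulrA -exprMn ci_xy expr1n mul1r.
  exact: N2o.
have xW N' w' : WV w' -> WV (x ^+ N' * w').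
  by apply: WV_M; rewrite -ci_rat_xX; apply: OV_poly.
apply: (regular_WV locP locA bG bL (N := N1 + N2)).
  rewrite mulrBr; apply: (submoduleB (WV_submodule X)).
    by rewrite exprD -mulrA; apply: xW.
  by rewrite addnC exprD -mulrA; apply: xW.
by rewrite rmorphB mulrBl -(loc_d locP) E.
Qed.

Lemma omega_B_log_ge0 (om : V) : lprod_ge 0 om -> omega_B_log om.
Proof. exact: lprod_ge_le. Qed.

Lemma H0_iso : kG_iso (H0_Omega X) (local_H0 B z).
Proof.
have [N0 _ _] := Nm; split; [exact: H0_Omega_wf | exact: local_H0_wf |].
exists (fun w => loc w * xi); split=> /=.
- by move=> w [_ wV]; apply: omega_B_log_ge0; apply: loc_WV wV.
- by move=> a u v _ _; rewrite rmorphD (locZ locP) mulrDl -lprod_scalerAl subrr.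
- by move=> g u _; rewrite locA omega_act_xi subrr.
- move=> w [wU _]; split=> [wN|->]; first exact: omega_disjoint.
  by rewrite rmorph0 mul0r.
- move=> om omB; have [nu [w [nuN wU E]]] := omega_span om.
  exists w; last by rewrite E opprD addrCA subrr addr0 -sub0r; apply: (submoduleB Nm).
  split=> //; rewrite -[w]subr0 -(linear0 cd); apply: regular_residue => //.
    by have [] := OUV_submodule X.
  rewrite linear0 subr0.
  have -> : loc w * xi = om - nu by rewrite E addrAC subrr add0r.
  by apply: lprod_geB => //; apply: (omega_A_log_sub magz).
Qed.

Lemma splitting : exists (pm : V -> V) (po : V -> L),
  [/\ forall u, M (pm u), forall u, OU (po u), forall u, u = pm u + loc (po u)
    & forall m o, M m -> OU o -> pm (m + loc o) = m /\ po (m + loc o) = o].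
Proof.
have H u : exists ao : V * L, [/\ M ao.1, OU ao.2 & u = ao.1 + loc ao.2].
  by have [a [_ [aM [o oO <-] E]]] := M_span u; exists (a, o).
have [s sP] := choice H; exists (fun u => (s u).1), (fun u => (s u).2).
split=> [u|u|u|m o mM oO]; try by have [] := sP u.
have [sM sO H'] := sP (m + loc o).
have E : loc (o - (s (m + loc o)).2) = (s (m + loc o)).1 - m.
  by apply/eqP; rewrite rmorphB subr_eq addrAC -H' addrAC subrr add0r.
have E0 : (s (m + loc o)).1 - m = 0.
  apply: M_disjoint; first exact: (submoduleB Mm).
  by rewrite -E; exists (o - (s (m + loc o)).2) => //; apply: (subring_setB (OU_subring X)).
split; first by apply/eqP; rewrite -subr_eq0 E0.
by apply/eqP; rewrite eq_sym -subr_eq0; apply/eqP/locI; rewrite rmorph0 E E0.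
Qed.

Lemma max_B_M (u : V) : max_B u -> M u.
Proof. exact: (max_B_sub magz dualz). Qed.

Lemma max_B_span (f : L) : OV f -> exists a o, [/\ max_B a, OU o, lprod_d (loc o) = 0 & loc f = a + loc o].
Proof.
move=> Of; have f0 := loc_OV locP Of.
have [a [_ [a1 [o oO <-] c0 E]]] :=
  integral_split chark pG O_subring O_scale O_act O_theta O_inv O_neg Dn f0.
exists a, o; split=> //.
by apply: (O_const_d chark pG O_subring O_scale O_act O_inv) => //; exists o.
Qed.

Lemma OUV_max_B f : OUV f -> max_B (loc f) -> OV f.
Proof.
move=> /OUV_P[N' Nf] f1; apply: (regular_OV locP bG bL Nf).
exact: lprod_ge_le f1.
Qed.

Lemma OUV_dense (w : V) : exists2 f, OUV f & max_B (loc f - w).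
Proof.
by have [f [N' [Nf fw]]] := loc_dense locP bG bL w 1; exists f => //; apply/OUV_P; exists N'.
Qed.

Lemma H1_iso : kG_iso (H1_O X) (local_H1 B zv).
Proof.
have [pm [po [pmM poO pmoE uniq]]] := splitting.
have [M0 MD Ma] := Mm; have OUr := OU_subring X.
have pm_eq u m o : M m -> OU o -> u = m + loc o -> pm u = m.
  by move=> mM oO ->; have [] := uniq m o mM oO.
split; [exact: H1_O_wf | exact: (local_H1_wf magz dualz) |].
exists (fun f => pm (loc f)); split=> /=.
- by move=> f _; apply: pmM.
- move=> a u v _ _; rewrite (@pm_eq _ (a *: pm (loc u) + pm (loc v)) (a *: po (loc u) + po (loc v))).
  + by rewrite subrr; apply: lprod_ge0.
  + exact: MD.
  + by apply: (subring_setD OUr) => //; apply: OU_scale.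
  + by rewrite !rmorphD !(locZ locP) addrACA -scalerDr -!pmoE.
- move=> g u _; rewrite (@pm_eq _ (act g (pm (loc u))) (ca g (po (loc u)))).
  + by rewrite subrr; apply: lprod_ge0.
  + exact: Ma.
  + exact: sections_act.
  + by rewrite !locA -rmorphD -pmoE.
- move=> u uO; split=> [um|[fU [fV [Uf Vf ->]]]].
  + exists (po (loc u)), (po (loc u) - u); split=> //; last by rewrite opprB addrCA subrr addr0.
    rewrite -opprB; apply: (subring_setN (OV_subring X)); apply: OUV_max_B.
      by apply: OUV_B => //; apply: OU_OUV.
    by rewrite rmorphB {1}(pmoE (loc u)) addrK.
  + have [a [o [a1 oO _ E]]] := max_B_span Vf.
    rewrite (@pm_eq _ (- a) (fU - o)); first exact: lprod_geN.
    * by apply: max_B_M; apply: lprod_geN.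
    * exact: (subring_setB OUr).
    * by rewrite !rmorphB /= E opprD addrCA.
- move=> w wM; have [f Of fw] := OUV_dense w.
  exists f => //; rewrite (@pm_eq _ (loc f) 0) //.
  + by rewrite -[loc f](subrK w); apply: (submoduleD Mm) => //; apply: max_B_M.
  + exact: subring_set0 OUr.
  + by rewrite rmorph0 addr0.
Qed.

Lemma HdR_iso : kG_iso (H1_dR X) (local_HdR B z zv).
Proof.
have [pm [po [pmM poO pmoE uniq]]] := splitting.
have [M0 MD Ma] := Mm; have OUr := OU_subring X; have [N0 ND Na] := Nm.
have pm_eq u m o : M m -> OU o -> u = m + loc o -> pm u = m /\ po u = o.
  by move=> mM oO ->; apply: uniq.
split; [exact: H1_dR_wf | exact: local_HdR_wf |].
exists (fun c => (loc (c.1.1 - cd (po (loc c.2))) * xi, pm (loc c.2))); split=> /=.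
- move=> [[wU wV] f] /= [UW VW Of E]; split; first exact: pmM.
  have -> : pm (loc f) = loc f - loc (po (loc f)) by rewrite {2}(pmoE (loc f)) addrK.
  have -> : loc (wU - cd (po (loc f))) * xi - lprod_d (loc f - loc (po (loc f))) = loc wV * xi.
    rewrite lprod_dB !(loc_d locP) -!mulrBl -!rmorphB; congr (loc _ * _).
    by rewrite opprB addrA subrK -E opprB addrCA subrr addr0.
  exact/omega_B_log_ge0/loc_WV.
- move=> a [[uU uV] f] [[vU vV] f'] /= _ _.
  have [|||-> ->] := @pm_eq (loc (a *: f + f')) (a *: pm (loc f) + pm (loc f'))
    (a *: po (loc f) + po (loc f')).
  + exact: MD.
  + by apply: (subring_setD OUr) => //; apply: OU_scale.
  + by rewrite !rmorphD !(locZ locP) addrACA -scalerDr -!pmoE.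
  split; rewrite ?subrr; last exact: lprod_ge0.
  rewrite linearP opprD addrACA -scalerBr rmorphD (locZ locP) mulrDl -lprod_scalerAl.
  by rewrite subrr.
- move=> g [[uU uV] f] /= _.
  have [|||-> ->] := @pm_eq (loc (ca g f)) (act g (pm (loc f))) (ca g (po (loc f))).
  + exact: Ma.
  + exact: sections_act.
  + by rewrite !locA -rmorphD -pmoE.
  split; rewrite ?subrr; last exact: lprod_ge0.
  by rewrite cov_d_act -rmorphB locA omega_act_xi subrr.
- move=> [[wU wV] f] /= [UW VW Of E]; split=> [[wN fm]|[fU [fV [Uf Vf [wUE _ fE]]]]].
  + exists (po (loc f)), (po (loc f) - f).
    have fO : OV (po (loc f) - f).
      rewrite -opprB; apply: (subring_setN (OV_subring X)); apply: OUV_max_B.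
        by apply: OUV_B => //; apply: OU_OUV.
      by rewrite rmorphB {1}(pmoE (loc f)) addrK.
    have wE : wU = cd (po (loc f)).
      apply/eqP; rewrite -subr_eq0; apply/eqP/omega_disjoint => //.
      by apply: (submoduleB (WU_submodule X)) => //; apply: WU_d.
    split=> //; rewrite opprB [f - _]addrC addNKr // linearB -wE.
    by congr (_, _, _); rewrite -E opprB addrC subrK.
  + rewrite fE wUE; have [a [o [a1 oO dO E']]] := max_B_span Vf.
    have [|||-> ->] := @pm_eq (loc (fU - fV)) (- a) (fU - o).
    * by apply: max_B_M; apply: lprod_geN.
    * exact: (subring_setB OUr).
    * by rewrite !rmorphB /= E' opprD addrCA.
    split; last exact: lprod_geN.
    by rewrite linearB opprB addrCA subrr addr0 -(loc_d locP) dO.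
- move=> [om nu] /= [nuM omB]; have [f Of fw] := OUV_dense nu.
  have [|||pmf pof] := @pm_eq (loc f) (loc f) 0.
  + by rewrite -[loc f](subrK nu); apply: (submoduleD Mm) => //; apply: max_B_M.
  + exact: subring_set0 OUr.
  + by rewrite rmorph0 addr0.
  have [eta [w [etaN wU E]]] := omega_span om.
  exists (w, w - cd f, f) => /=; last first.
    rewrite pmf pof linear0 subr0; split=> //=.
    by rewrite E opprD addrCA subrr addr0 -sub0r; apply: (submoduleB Nm).
  split=> //; last by rewrite opprB addrCA subrr addr0.
  apply: regular_residue => //.
  have -> : loc (w - cd f) * xi = (om - lprod_d nu) - eta - lprod_d (loc f - nu).
    rewrite E rmorphB mulrBl -(loc_d locP) lprod_dB opprB.
    by rewrite [eta + _]addrC [_ - lprod_d nu - eta]addrAC addrK addrA subrK.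
  apply: lprod_geB; last by apply: lprod_ge_le (lprod_ge_d fw).
  by apply: lprod_geB => //; apply: (omega_A_log_sub magz).
Qed.

End Isomorphisms.
End HKGCohomology.

Theorem theorem3p2 (k : closedFieldType) (p : nat) (gT : finGroupType)
    (r : nat) (B : local_galois k gT r) (X : p1_cover k gT)
    (z zv : lprod k r)
    (chark : p \in [pchar k])
    (pG : (p.-group [set: gT])%g)
    (normalG0 : (ram_group B ord0 0 <| [set: gT])%g)
    (hkgX : hkg_cover X B)
    (magical_z : magical B z)
    (dual_z : dual_element B z zv) :
  [/\ kG_iso (H0_Omega X) (local_H0 B z),
      kG_iso (H1_O X) (local_H1 B zv)
    & kG_iso (H1_dR X) (local_HdR B z zv)].
Proof.
case: hkgX => unram [loc [locP locA [n [b [bG bL]]]]].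
rewrite HKGCohomology.ram_group0 in normalG0.
split.
- exact: (HKGCohomology.H0_iso chark pG normalG0 unram magical_z dual_z locP locA bG bL).
- exact: (HKGCohomology.H1_iso chark pG normalG0 unram magical_z dual_z locP locA bG bL).
- exact: (HKGCohomology.HdR_iso chark pG normalG0 unram magical_z dual_z locP locA bG bL).
Qed.
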